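(* Let $d\ge 1$, $s\in(\frac d2,\frac d2+1)$, $H=s-\frac d2\in(0,1)$, and $h\sim\mathrm{FGF}_s(\mathbb R^d)$. Then the process defined by $\tilde h(x)=(h,\delta_x-\delta_0)$, $x\in\mathbb R^d$, has the same distribution, up to a multiplicative constant, as the $d$-dimensional fractional Brownian motion with Hurst parameter $H$.
   Context: $\delta_x$ is the unit Dirac mass at $x$. The $d$-dimensional fractional Brownian motion with Hurst parameter $H\in(0,1)$ is the centered Gaussian process $(B(x))_{x\in\mathbb R^d}$ with $\mathbb E[B(x)B(y)]=\frac12\left(|x|^{2H}+|y|^{2H}-|x-y|^{2H}\right)$. $\mathcal S(\mathbb R^d)$ is the real Schwartz space; $\widehat\phi(\xi)=(2\pi)^{-d/2}\int\phi(x)e^{-i\xi\cdot x}dx$. $\mathcal S_H(\mathbb R^d)$ is the set of $\phi\in\mathcal S(\mathbb R^d)$ with $\int x^\beta\phi(x)dx=0$ for all multi-indices $|\beta|\le H$ (for $H\in(0,1)$: $\int\phi=0$), and $\mathcal S'_H(\mathbb R^d)$ is its dual. $\dot H^{-s}(\mathbb R^d)$ is the Hilbert completion of $\{f\in\mathcal S(\mathbb R^d):|\xi|^{-s}\widehat f\in L^2\}$ under $(f,g)_{\dot H^{-s}}=\int|\xi|^{-2s}\widehat f\,\overline{\widehat g}\,d\xi$, identified with the tempered distributions $f$ with $\widehat f\in L^2(|\xi|^{-2s}d\xi)$. $h\sim\mathrm{FGF}_s(\mathbb R^d)$ means $h$ is a random element of $\mathcal S_H'(\mathbb R^d)$ such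 that $(h,\phi)\sim\mathcal N(0,\|\phi\|^2_{\dot H^{-s}(\mathbb R^d)})$ for every $\phi\in\mathcal S_H(\mathbb R^d)$. $T_s(\mathbb R^d)$ is the closure of $\mathcal S_H(\mathbb R^d)$ in $\dot H^{-s}(\mathbb R^d)$, and $(h,\phi)$ is defined for $\phi\in T_s(\mathbb R^d)$ by extending the isometry $\phi\mapsto(h,\phi)\in L^2(\Omega)$; one has $\delta_x-\delta_0\in T_s(\mathbb R^d)$. *)

(* Defs.v *)
From HB Require Import structures.
From mathcomp Require Import all_boot all_order all_algebra.
From mathcomp Require Import complex.
From mathcomp Require Import all_classical all_reals all_analysis.

Set Implicit Arguments.
Unset Strict Implicit.
Unset Printing Implicit Defensive.

Import Order.TTheory GRing.Theory Num.Theory.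
Import numFieldNormedType.Exports.
Import ComplexField.Normc.

Local Open Scope classical_set_scope.
Local Open Scope ring_scope.

Definition cylinders {R : realType} {I T : Type} (ev : I -> T -> R) : set (set T) :=
  [set A | exists i (B : set R), measurable B /\ A = ev i @^-1` B].

Definition rV_display : measure_display.
Proof. exact: default_measure_display. Qed.

Section rV_measurable.
Context {R : realType} (n : nat).

Definition rV_coord (i : 'I_n) (x : 'rV[R]_n) : R := x ord0 i.

(* The Borel sigma-algebra of R^n, generated by the coordinate maps. *)
HB.instance Definition _ := @isMeasurable.Build rV_display 'rV[R]_n
  <<s cylinders rV_coord >> (@sigma_algebra0 _ setT _) (@sigma_algebraC _ _)
  (@sigma_algebra_bigcup _ setT _).

Lemma measurable_rV_coord (i : 'I_n) : measurable_fun setT (rV_coord i).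
Proof.
by move=> _ B mB; rewrite setTI; apply: sub_sigma_algebra; exists i, B.
Qed.

Lemma measurable_fun_rV d (T : measurableType d) (f : T -> 'rV[R]_n) :
  (forall i, measurable_fun setT (rV_coord i \o f)) -> measurable_fun setT f.
Proof.
move=> mf; apply: (@measurability _ _ _ _ _ _ (cylinders rV_coord)) => //.
move=> _ [_ [i [B [mB ->]]] <-]; exact: mf.
Qed.

End rV_measurable.

Section lebesgue_rV.
Context {R : realType}.

Definition rV_cons n (p : R * 'rV[R]_n) : 'rV[R]_n.+1 :=
  row_mx (const_mx p.1 : 'rV[R]_1) p.2.

Definition rV_uncons n (x : 'rV[R]_n.+1) : R * 'rV[R]_n :=
  (x ord0 ord0, rsubmx (x : 'rV[R]_(1 + n))).

Lemma rV_consK n : cancel (@rV_cons n) (@rV_uncons n).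
Proof.
case=> a v; rewrite /rV_uncons /rV_cons /=; congr (_, _); last exact: row_mxKr.
have -> : @ord0 n = lshift n (ord0 : 'I_1) by exact: val_inj.
by rewrite (@row_mxEl _ 1 1 n) mxE.
Qed.

Lemma measurable_rV_cons n : measurable_fun setT (@rV_cons n).
Proof.
apply: measurable_fun_rV => i; rewrite /rV_coord /rV_cons /comp /=.
case: (@splitP 1 n i) => j ij.
  rewrite (_ : (fun _ => _) = fst) //; apply/funext => p.
  have -> : i = lshift n j by exact: val_inj.
  by rewrite (@row_mxEl _ 1 1 n) mxE.
rewrite (_ : (fun _ => _) = rV_coord j \o snd); last first.
  apply/funext => p; have -> : i = rshift 1 j by exact: val_inj.
  by rewrite (@row_mxEr _ 1 1 n).
by apply: measurableT_comp => //; exact: measurable_rV_coord.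
Qed.

Lemma measurable_rV_uncons n : measurable_fun setT (@rV_uncons n).
Proof.
apply/measurable_fun_pairP; split; first exact: (@measurable_rV_coord _ n.+1).
apply: measurable_fun_rV => i.
rewrite (_ : _ \o _ = rV_coord (rshift 1 i)); first exact: measurable_rV_coord.
by apply/funext => x; rewrite /rV_coord /= mxE.
Qed.

Section step.
Variables (n : nat) (mu : {sigma_finite_measure set 'rV[R]_n -> \bar R}).

Definition rV_cons_measure : set 'rV[R]_n.+1 -> \bar R :=
  pushforward (lebesgue_measure \x mu)%E (@rV_cons n).

Let cons0 : rV_cons_measure set0 = 0%E.
Proof. by rewrite /rV_cons_measure /pushforward preimage_set0 measure0. Qed.

Let cons_ge0 A : (0 <= rV_cons_measure A)%E.
Proof. exact: (measure_ge0 (lebesgue_measure \x mu)%E). Qed.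

Let cons_sigma_additive : semi_sigma_additive rV_cons_measure.
Proof.
move=> F mF tF mUF; rewrite /rV_cons_measure /pushforward preimage_bigcup.
have mp A : measurable A -> measurable (@rV_cons n @^-1` A).
  by move=> mA; rewrite -[X in measurable X]setTI; exact: measurable_rV_cons.
apply: measure_semi_sigma_additive.
- by move=> k; exact: mp.
- apply/trivIsetP => /= i j _ _ ij; rewrite -preimage_setI.
  by move/trivIsetP : tF => /(_ _ _ _ _ ij) ->//; rewrite preimage_set0.
- by rewrite -preimage_bigcup; exact: mp.
Qed.

HB.instance Definition _ := isMeasure.Build _ _ _ rV_cons_measure
  cons0 cons_ge0 cons_sigma_additive.

Lemma sigma_finite_rV_cons_measure : sigma_finite setT rV_cons_measure.
Proof.
pose m1 : {sigma_finite_measure set (measurableTypeR R) -> \bar R} :=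
  lebesgue_measure.
have /sigma_finiteP[F [TF ndF Foo]] := sigma_finiteT m1.
have /sigma_finiteP[G [TG ndG Goo]] := sigma_finiteT mu.
exists (fun k => @rV_uncons n @^-1` (F k `*` G k)).
  rewrite -preimage_bigcup (_ : \bigcup_k (F k `*` G k) = setT) ?preimage_setT//.
  rewrite -setXTT TF TG predeqE => -[x y]; split.
    by move=> [k _ []/= ? ?]; split; exists k.
  move=> [/= [i _ Fix] [k _ Gky]]; exists (maxn i k) => //; split.
  - by move: x Fix; exact/subsetPset/ndF/leq_maxl.
  - by move: y Gky; exact/subsetPset/ndG/leq_maxr.
move=> k; have [mF Fk] := Foo k; have [mG Gk] := Goo k.
split.
  rewrite -[X in measurable X]setTI; apply: measurable_rV_uncons => //.
  exact: measurableX.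
rewrite /rV_cons_measure /pushforward -comp_preimage.
rewrite (_ : _ \o _ = id) ?preimage_id; last first.
  by apply/funext => p; exact: rV_consK.
by rewrite (product_measure1E m1 mu)// lte_mul_pinfty// ge0_fin_numE.
Qed.

HB.instance Definition _ := @Measure_isSigmaFinite.Build _ _ _
  rV_cons_measure sigma_finite_rV_cons_measure.
End step.

(* Lebesgue measure on R^n, as the n-fold product of the one on R. *)
Fixpoint lebesgue_rV n : {sigma_finite_measure set 'rV[R]_n -> \bar R} :=
  if n is m.+1 then rV_cons_measure (lebesgue_rV m) else \d_(0 : 'rV[R]_0).

End lebesgue_rV.

Local Open Scope complex_scope.

Section schwartz.
Context {R : realType} {d : nat}.
Local Notation E := 'rV[R]_d.
Implicit Types (f : E -> R) (x y xi : E) (alpha : seq 'I_d) (beta : 'I_d -> nat).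

Definition dot x y : R := \sum_i x ord0 i * y ord0 i.

(* The norm that the library puts on matrices is the sup norm. *)
Definition enorm x : R := Num.sqrt (dot x x).

Definition monomial beta x : R := \prod_i x ord0 i ^+ beta i.

Definition mdeg beta : nat := (\sum_i beta i)%N.

Definition partial (i : 'I_d) f : E -> R := 'D_(delta_mx ord0 i) f.

(* alpha lists the successive directions of differentiation, so the order of
   the derivative is size alpha *)
Definition iter_partial alpha f : E -> R := foldr partial f alpha.

Definition schwartz : set (E -> R) := [set f | forall alpha,
  (forall x, differentiable (iter_partial alpha f) x) /\
  forall beta, exists C : R, forall x,
    `|monomial beta x * iter_partial alpha f x| <= C].

Definition schwartz_moment0 (H : R) : set (E -> R) := [set f | schwartz f /\
  forall beta, (mdeg beta)%:R <= H ->
    \int[lebesgue_rV d]_x (monomial beta x * f x) = 0].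

(* The continuous linear functionals on a subspace D of the Schwartz space,
   for the topology given by the seminorms sup_x |x^beta d^alpha f(x)|; the
   values of l outside D are irrelevant. *)
Definition dual (D : set (E -> R)) : set ((E -> R) -> R) := [set l |
  (forall (a : R) f g, D f -> D g -> l (a *: f + g) = a * l f + l g) /\
  forall e : R, 0 < e -> exists N : nat, exists2 delta : R, 0 < delta &
    forall f, D f ->
      (forall alpha beta x, (size alpha <= N)%N -> (mdeg beta <= N)%N ->
        `|monomial beta x * iter_partial alpha f x| <= delta) ->
      `|l f| <= e].

Definition delta_distr x : (E -> R) -> R := fun f => f x.

End schwartz.

Section fourier.
Context {R : realType} {d : nat}.
Local Notation E := 'rV[R]_d.
Local Notation mu := (lebesgue_rV d).
Implicit Types (f psi : E -> R) (g : E -> R[i]) (l : (E -> R) -> R).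

Definition cexp (t : R) : R[i] := cos t +i* sin t.

Definition cintegral g : R[i] :=
  (\int[mu]_x complex.Re (g x)) +i* (\int[mu]_x complex.Im (g x)).

Definition fourier f (xi : E) : R[i] :=
  ((2 * pi) `^ (- (d%:R / 2)))%:C *
  cintegral (fun x => (f x)%:C * cexp (- dot x xi)).

Definition cmeasurable g :=
  measurable_fun setT (fun x => complex.Re (g x)) /\
  measurable_fun setT (fun x => complex.Im (g x)).

Definition cintegrable g :=
  mu.-integrable setT (fun x => (complex.Re (g x))%:E) /\
  mu.-integrable setT (fun x => (complex.Im (g x))%:E).

(* The Fourier transform of the tempered distribution l is the function g:
   <g, psi> = <l, fourier psi>, where l is extended C-linearly to complex test
   functions. *)
Definition is_fourier l g := cmeasurable g /\
  forall psi, schwartz psi ->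
    cintegrable (fun xi => g xi * (psi xi)%:C) /\
    cintegral (fun xi => g xi * (psi xi)%:C) =
      l (fun x => complex.Re (fourier psi x)) +i*
      l (fun x => complex.Im (fourier psi x)).

(* The squared norm of L^2(|xi|^(-2s) dxi). *)
Definition weighted_sqnorm (s : R) g : \bar R :=
  \int[mu]_xi ((enorm xi `^ (- (2 * s))) * normc (g xi) ^+ 2)%:E.

Definition Hdot (s : R) : set ((E -> R) -> R) := [set l |
  dual schwartz l /\
  exists g, is_fourier l g /\ (weighted_sqnorm s g < +oo)%E].

(* Convergence of the Schwartz functions phi n to l in the homogeneous Sobolev
   space of order -s. *)
Definition Hdot_cvg (s : R) (phi : nat -> E -> R) l :=
  exists g, is_fourier l g /\
    weighted_sqnorm s (fun xi => fourier (phi n) xi - g xi) @[n --> \oo] --> 0%E.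

Definition Hurst (s : R) : R := s - d%:R / 2.

Definition approximates (s : R) (phi : nat -> E -> R) l :=
  (forall n, schwartz_moment0 (Hurst s) (phi n)) /\ Hdot_cvg s phi l.

Definition Tspace (s : R) : set ((E -> R) -> R) :=
  [set l | Hdot s l /\ exists phi, approximates s phi l].

End fourier.
Arguments Hurst {R} d s.

(* The law N(m, v), including the degenerate case v = 0 (the library's
   normal_prob takes the standard deviation, assumed nonzero). *)
Definition normal_law {R : realType} (m v : R) (A : set R) : \bar R :=
  if v == 0 then \d_m A else normal_prob m (Num.sqrt v) A.

Section fgf.
Context {R : realType} {d : nat} {dO : measure_display}
  {Omega : measurableType dO} (P : probability Omega R).
Local Notation E := 'rV[R]_d.

(* Measurability of all the h(., f) is measurability of h for the
   sigma-algebra on the dual generated by the evaluations. *)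
Definition is_FGF (s : R) (h : Omega -> (E -> R) -> R) :=
  (forall w, dual (schwartz_moment0 (Hurst d s)) (h w)) /\
  forall f, schwartz_moment0 (Hurst d s) f ->
    measurable_fun setT (fun w => h w f) /\
    exists v : R, weighted_sqnorm s (fourier f) = v%:E /\
      forall A : set R, measurable A ->
        P ((fun w => h w f) @^-1` A) = normal_law 0 v A.

(* X is the value at l of the extension of f |-> h(., f), S_H -> L^2(Omega),
   to the closure T_s. *)
Definition is_pairing (s : R) (h : Omega -> (E -> R) -> R)
    (l : (E -> R) -> R) (X : {RV P >-> R}) :=
  Tspace s l /\
  forall phi, approximates s phi l ->
    (\int[P]_w ((h w (phi n) - X w) ^+ 2)%:E @[n --> \oo] --> 0)%E.

Definition pairing (s : R) (h : Omega -> (E -> R) -> R) (l : (E -> R) -> R) :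
    {RV P >-> R} :=
  @xget {mfun Omega >-> R} (cst 0) (is_pairing s h l).

Definition gaussian_process (B : E -> {RV P >-> R}) :=
  forall (n : nat) (x : 'I_n -> E) (a : 'I_n -> R),
    exists m v : R, 0 <= v /\ forall A : set R, measurable A ->
      P ((fun w => \sum_(i < n) a i * B (x i) w) @^-1` A) = normal_law m v A.

Definition is_fBM (H : R) (B : E -> {RV P >-> R}) :=
  [/\ gaussian_process B,
      forall x, ('E_P[B x] = 0)%E &
      forall x y, ('E_P[(fun w => (B x w * B y w)%R)] =
        (2^-1 * (enorm x `^ (2 * H) + enorm y `^ (2 * H)
                 - enorm (x - y) `^ (2 * H)))%R%:E)%E].

End fgf.

(* Equality of the laws of two processes on the product sigma-algebra. *)
Definition same_law {R : realType} {I : Type} d1 d2 (T1 : measurableType d1)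
    (T2 : measurableType d2) (P1 : probability T1 R) (P2 : probability T2 R)
    (X : I -> T1 -> R) (Y : I -> T2 -> R) :=
  forall A : set (I -> R), <<s cylinders (fun i (p : I -> R) => p i) >> A ->
    P1 [set w | A (X ^~ w)] = P2 [set w | A (Y ^~ w)].

(* Main.v *)
Require Import Defs.
From HB Require Import structures.
From mathcomp Require Import all_boot all_order all_algebra.
From mathcomp Require Import complex.
From mathcomp Require Import all_classical all_reals all_analysis.
From mathcomp Require Import measurable_realfun ring lra.

Set Implicit Arguments.
Unset Strict Implicit.
Unset Printing Implicit Defensive.

Import Order.TTheory GRing.Theory Num.Theory.
Import numFieldNormedType.Exports.

Local Open Scope classical_set_scope.
Local Open Scope ring_scope.

(* The law of a process X is determined by the expectations of
   cos (sum_q a_q X(x_q) + b), and for centered Gaussian families these depend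
   only on the variances of the linear combinations.  The Fourier transform of
   delta_x - delta_0 is (2 pi)^(-d/2) (e^(-i x.xi) - 1), so all these variances
   reduce to the integrals of |xi|^(-2s) (1 - cos (x.xi)).  Writing |xi|^(-2s)
   as a Gamma integral of Gaussians in xi and integrating first in xi shows that
   such an integral is a constant multiple of |x|^(2H).
   Differences of narrow Gaussians centered at x and 0 approximate
   delta_x - delta_0 in the homogeneous Sobolev space, so the pairing is an
   L^2 limit.  It does not depend on the approximating sequence, because testing
   against Gaussians determines the Fourier transform of a distribution almost
   everywhere. *)

(** [is_FGF] prescribes the law of [h] at one test function at a time. Joint laws are accessible
    because each [h w] is linear: a combination of values of [h] is its value at one function of
    [schwartz_moment0], hence a single normal variable. Since Dirac masses are not test functions,
    this is done for the approximants, and the expectations of cosines are passed to the limit.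

    [pairing] is a choice made by [xget], with value 0 if nothing satisfies [is_pairing]. That
    predicate demands the limit along every approximating sequence, and each sequence may bring its
    own Fourier transform of the limit; hence the uniqueness result.

    The condition on s enters as 0 < H < 1. H > 0 controls small values of the Gamma parameter, that
    is high frequencies; H < 1 controls large values, that is the singularity of the weight at the
    origin, and reduces the moment conditions to a vanishing integral. The constant c is (2
    pi)^(-d/2) times the square root of 2 pi^(d/2) [fbm_cst H] / Gamma(s). *)

Section integral_toolkit.
Context d (T : measurableType d) (R : realType) (mu : {measure set T -> \bar R}).
Implicit Types f g : T -> R.

Lemma integrable_dominated f g : measurable_fun setT f ->
  (forall x, `|f x| <= g x) ->
  mu.-integrable setT (EFin \o g) -> mu.-integrable setT (EFin \o f).
Proof.
move=> mf fg; apply: le_integrable => //; first exact/measurable_EFinP.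
by move=> x _ /=; rewrite lee_fin (le_trans (fg x))// ler_norm.
Qed.

Lemma integrable_measurable f :
  mu.-integrable setT (EFin \o f) -> measurable_fun setT f.
Proof. by move=> /measurable_int/measurable_EFinP. Qed.

Lemma integrable_scale (a : R) f : mu.-integrable setT (EFin \o f) ->
  mu.-integrable setT (EFin \o (fun x => a * f x)).
Proof. exact: (integrableZl measurableT a). Qed.

Lemma integrable_add f g : mu.-integrable setT (EFin \o f) ->
  mu.-integrable setT (EFin \o g) ->
  mu.-integrable setT (EFin \o (fun x => f x + g x)).
Proof. by move=> intf intg; exact: (integrableD measurableT intf intg). Qed.

Lemma integral_EFinE f : mu.-integrable setT (EFin \o f) ->
  (\int[mu]_x (f x)%:E = (\int[mu]_x f x)%:E)%E.
Proof. by move=> intf; rewrite fineK// integrable_fin_num. Qed.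

(** Dominated convergence for real integrands. Convergence is asked at every point, so that the
    measurability of the limit comes for free. *)
Lemma Rintegral_cvg (f_ : nat -> T -> R) f g :
  (forall n, measurable_fun setT (f_ n)) ->
  (forall x, f_ n x @[n --> \oo] --> f x) ->
  mu.-integrable setT (EFin \o g) ->
  (forall n x, `|f_ n x| <= g x) ->
  mu.-integrable setT (EFin \o f) /\
  \int[mu]_x f_ n x @[n --> \oo] --> \int[mu]_x f x.
Proof.
move=> mf_ f_f intg fg.
have mf : measurable_fun setT f.
  by apply: (@measurable_fun_cvg _ _ _ _ f_) => // x _; exact: f_f.
have f_fE x : (EFin \o f_ n) x @[n --> \oo] --> (EFin \o f) x.
  by apply: cvg_EFin; [exact: nearW|exact: f_f].
have [intf _ cvgf] := @dominated_convergence _ _ _ mu setT measurableT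
  (fun n => EFin \o f_ n) (EFin \o f) (EFin \o g)
  (fun n => (measurable_EFinP _ _).2 (mf_ n)) ((measurable_EFinP _ _).2 mf)
  (aeW _ (fun x _ => f_fE x)) intg
  (aeW _ (fun x n _ => fg n x)).
split => //; apply/fine_cvg.
by rewrite fineK ?integrable_fin_num.
Qed.

End integral_toolkit.

(** * Laws determined by trigonometric functions *)

Section bounded_closure.
Context {R : realType} {T : Type}.
Implicit Types (C : set (T -> R)) (f g : T -> R) (A : set T).

(* The functions to which an equality of integrals, known on C, extends by
   linearity and dominated convergence; when C is closed under products they
   include the indicators of the sigma-algebra generated by C. *)
Inductive bclosure C : (T -> R) -> Prop :=
| bclosure_gen f : C f -> bclosure C f
| bclosure_lin a f g : bclosure C f -> bclosure C g ->
    bclosure C (fun x => a * f x + g x)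
| bclosure_lim (f_ : nat -> T -> R) f (M : R) : (forall n, bclosure C (f_ n)) ->
    (forall n x, `|f_ n x| <= M) -> (forall x, f_ n x @[n --> \oo] --> f x) ->
    bclosure C f.

Variable C : set (T -> R).
Hypothesis C1 : C (fun=> 1).
Hypothesis Cbnd : forall f, C f -> exists M : R, forall x, `|f x| <= M.
Hypothesis Cmul : forall f g, C f -> C g -> bclosure C (fun x => f x * g x).

Local Notation cl := (bclosure C).

Lemma bclosure_bounded f : cl f -> exists M : R, forall x, `|f x| <= M.
Proof.
elim=> {f} [f Cf|a f g _ [M fM] _ [N gN]|f_ f M _ _ fM f_f]; first exact: Cbnd.
  exists (`|a| * M + N) => x; rewrite (le_trans (ler_normD _ _))// lerD//.
  by rewrite normrM ler_wpM2l.
exists M => x; rewrite -(cvg_lim _ (cvg_norm (f_f x)))//.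
apply: limr_le; first exact: is_cvg_norm (cvgP _ (f_f x)).
by apply: nearW => n.
Qed.

Lemma bclosure_ext f g : f =1 g -> cl f -> cl g.
Proof. by move=> /funext ->. Qed.

(** Induction on [g] for a fixed [f] of the closure; when [g] is a generator, a second induction on
    [f]. In the limit cases the other factor is bounded, which keeps the uniform bound. [Cmul] lets
    products of generators land in the closure only, since a product of two cosines is a combination
    of cosines. *)
Lemma bclosure_mul f g : cl f -> cl g -> cl (fun x => f x * g x).
Proof.
move=> clf; elim=> {g} [g Cg|a g h _ fg _ fh|g_ g N _ IH gN g_g].
- elim: clf => {f} [f Cf|a f h _ fg _ hg|f_ f M _ IH fM f_f]; first exact: Cmul.
    by apply: bclosure_ext (bclosure_lin a fg hg) => x; ring.
  have [N gN] := Cbnd Cg.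
  apply: (@bclosure_lim _ (fun n x => f_ n x * g x) _ (M * N)) => // [n x|x].
    by rewrite normrM ler_pM.
  by apply: cvgM => //; exact: cvg_cst.
- by apply: bclosure_ext (bclosure_lin a fg fh) => x; ring.
- have [M fM] := bclosure_bounded clf.
  apply: (@bclosure_lim _ (fun n x => f x * g_ n x) _ (M * N)) => // [n x|x].
    by rewrite normrM ler_pM.
  by apply: cvgM => //; exact: cvg_cst.
Qed.

Lemma bclosure_cst a : cl (fun=> a).
Proof.
have c1 := bclosure_gen C1.
(* [bclosure_lin] adds its second function with coefficient 1, so a is written as (a - 1) 1 + 1. *)
by apply: bclosure_ext (bclosure_lin (a - 1) c1 c1) => x; ring.
Qed.

Lemma bclosure_scale a f : cl f -> cl (fun x => a * f x).
Proof.
move=> clf; apply: bclosure_ext (bclosure_lin a clf (bclosure_cst 0)) => x.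
by rewrite addr0.
Qed.

(* The iterates of u |-> u (3 - u^2) / 2 converge to the sign function on
   [-1, 1]. *)
Let q (u : R) : R := u * (3 - u ^+ 2) / 2.

Let iter_q_ge (u : R) n : 0 < u <= 1 ->
  [/\ u <= iter n q u, iter n q u <= 1 & 1 - iter n q u <= (1 - u / 2) ^+ n].
Proof.
move=> /andP[u0 u1]; elim: n => [|n [IH1 IH2 IH3]] /=.
  by rewrite expr0; split => //; lra.
set v := iter n q u in IH1 IH2 IH3 *.
(* The distance to 1 is multiplied by (1 - v)(2 + v)/2 = 1 - v/2 - v^2/2, which is at most 1 - u/2
   because u <= v. *)
have qE : 1 - q v = (1 - v) * ((1 - v) * (2 + v) / 2) by rewrite /q; field.
split.
- by rewrite /q; nra.
- by rewrite -subr_ge0 qE; apply: mulr_ge0; nra.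
- by rewrite qE exprSr; apply: ler_pM => //; nra.
Qed.

Let iter_qN (u : R) n : iter n q (- u) = - iter n q u.
Proof. by elim: n => // n /= ->; rewrite /q sqrrN; field. Qed.

Let iter_q0 n : iter n q 0 = 0.
Proof. by elim: n => // n /= ->; rewrite /q !mul0r. Qed.

Let cvg_iter_q_pos (u : R) : 0 < u <= 1 -> iter n q u @[n --> \oo] --> (1 : R).
Proof.
move=> u01; have /andP[u0 u1] := u01.
have gcvg : (1 - u / 2) ^+ n @[n --> \oo] --> (0 : R).
  by apply: cvg_expr; rewrite ger0_norm; lra.
apply: (@squeeze_cvgr _ _ _ _ (fun n => 1 - (1 - u / 2) ^+ n) (cst 1)).
- apply: nearW => n; have [_ -> ] := iter_q_ge n u01.
  by rewrite andbT lerBlDr -lerBlDl.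
- by rewrite -[X in _ --> X]subr0; apply: cvgB => //; exact: cvg_cst.
- exact: cvg_cst.
Qed.

(** Once [f] is scaled into [-1, 1], the iterates of the polynomial [q] stay in the closure and tend
    to sgn f. The indicator is (sgn^2 + sgn)/2, which also takes the right value 0 where [f]
    vanishes. *)
Lemma bclosure_indic_gt0 f : cl f -> cl (\1_[set x | 0 < f x] : T -> R).
Proof.
move=> clf; have [M0 fM0] := bclosure_bounded clf.
pose M := `|M0| + 1; have M_gt0 : 0 < M by rewrite ltr_wpDl.
have fM x : `|f x / M| <= 1.
  rewrite normrM normfV (gtr0_norm M_gt0) ler_pdivrMr// mul1r.
  by rewrite (le_trans (fM0 x))// (le_trans (ler_norm _))// lerDl.
have clq n : cl (fun x => iter n q (f x / M)).
  elim: n => [|n IH] /=.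
    by apply: bclosure_ext (bclosure_scale M^-1 clf) => x; rewrite mulrC.
  pose v x := iter n q (f x / M).
  have := bclosure_mul (bclosure_mul IH IH) IH.
  move=> /(bclosure_scale (- 2^-1)) /(bclosure_lin (3 / 2) IH).
  by apply: bclosure_ext => x; rewrite /q; field.
have bndq n x : `|iter n q (f x / M)| <= 1.
  have := fM x; have [f0|f0|->] := ltgtP (f x / M) 0; last first.
  - by rewrite iter_q0 normr0.
  - rewrite (gtr0_norm f0) => f1.
    have [le1 le2 _] := iter_q_ge n (introT andP (conj f0 f1)).
    by rewrite ger0_norm// (le_trans _ le1)// ltW.
  - rewrite (ltr0_norm f0) -[in X in _ -> X](opprK (f x / M)) iter_qN normrN => f1.
    have f0' : 0 < - (f x / M) by rewrite oppr_gt0.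
    have [le1 le2 _] := iter_q_ge n (introT andP (conj f0' f1)).
    by rewrite ger0_norm// (le_trans _ le1)// ltW.
apply: (@bclosure_lim _
  (fun n x => 2^-1 * (iter n q (f x / M) * iter n q (f x / M)) +
              2^-1 * iter n q (f x / M)) _ 1).
- move=> n; apply: bclosure_lin; first exact: bclosure_mul.
  exact: bclosure_scale.
- move=> n x; have := bndq n x; rewrite !ler_norml => /andP[? ?].
  by apply/andP; split; nra.
- move=> x; rewrite indicE.
  have fMs : (0 < f x / M) = (0 < f x) by rewrite pmulr_lgt0// invr_gt0.
  have fMn : (f x / M < 0) = (f x < 0) by rewrite pmulr_llt0// invr_gt0.
  have [f0|f0|f0] := ltgtP (f x) 0.
  + have -> : (x \in [set x | 0 < f x]) = false.
      by apply/negbTE; rewrite notin_setE/= => /(lt_trans f0); rewrite ltxx.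
    have -> : false%:R = 2^-1 * ((- 1) * (- 1)) + 2^-1 * (- 1) :> R by rewrite /=; lra.
    have cvN : iter n q (f x / M) @[n --> \oo] --> (- 1 : R).
      rewrite (_ : (fun n => _) = (fun n => - iter n q (- (f x / M)))); last first.
        by apply/funext => n; rewrite iter_qN opprK.
      apply: cvgN; apply: cvg_iter_q_pos; rewrite oppr_gt0 fMn f0/=.
      by have := fM x; rewrite ltr0_norm// fMn.
    apply: cvgD; apply: cvgM; try exact: cvg_cst; last exact: cvN.
    exact: cvgM.
  + have -> : x \in [set x | 0 < f x] by rewrite inE.
    have -> : true%:R = 2^-1 * (1 * 1) + 2^-1 * 1 :> R by rewrite /=; lra.
    have cvN : iter n q (f x / M) @[n --> \oo] --> (1 : R).
      apply: cvg_iter_q_pos; rewrite fMs f0/=.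
      by have := fM x; rewrite gtr0_norm// fMs.
    apply: cvgD; apply: cvgM; try exact: cvg_cst; last exact: cvN.
    exact: cvgM.
  + have -> : (x \in [set x | 0 < f x]) = false.
      by apply/negbTE; rewrite notin_setE/= f0 ltxx.
    rewrite f0 mul0r; under eq_fun do rewrite iter_q0 !mulr0 addr0.
    exact: cvg_cst.
Qed.

Lemma sigma_algebra_bclosure : sigma_algebra setT [set A | cl (\1_A : T -> R)].
Proof.
split.
- by rewrite /= indic0; exact: bclosure_cst.
- move=> A /= clA.
  apply: bclosure_ext (bclosure_lin (- 1) clA (bclosure_cst 1)) => x.
  by rewrite setTD !indicE in_setC; case: (_ \in _) => /=; ring.
- move=> A clA /=.
  (* The indicator of the union is the limit of 1 minus the product of the first n factors 1 - 1_(A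
     k). Closure under products handles overlapping sets directly. *)
  pose p n x : R := \prod_(k < n) (1 - \1_(A k) x).
  have p01 n x : 0 <= p n x <= 1.
    rewrite /p; elim: n => [|n]; first by rewrite big_ord0 ler01 lexx.
    rewrite big_ord_recr/= indicE => /andP[p0 p1].
    by case: (_ \in _); rewrite ?subrr ?subr0 ?mulr0 ?mulr1 ?p0 ?p1 ?lexx ?ler01.
  have clp n : cl (p n).
    elim: n => [|n IH].
      by apply: bclosure_ext (bclosure_cst 1) => x; rewrite /p big_ord0.
    have c1A := bclosure_lin (- 1) (clA n) (bclosure_cst 1).
    apply: bclosure_ext (bclosure_mul IH c1A) => x.
    by rewrite /p big_ord_recr/=; ring.
  apply: (@bclosure_lim _ (fun n x => (- 1) * p n x + 1) _ 1).
  + by move=> n; apply: bclosure_lin => //; exact: bclosure_cst.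
  + move=> n x; have /andP[p0 p1] := p01 n x.
    by rewrite ger0_norm; lra.
  + move=> x; have [[k _ Akx]|nA] := pselect ((\bigcup_k A k) x).
    * rewrite indicE mem_set; last by exists k.
      apply: cvg_near_cst; exists k.+1 => // n /= kn.
      rewrite /p (bigD1 (Ordinal kn))//= indicE mem_set// subrr mul0r.
      by rewrite mulr0 add0r.
    * rewrite indicE memNset//; apply: cvg_near_cst; apply: nearW => n.
      rewrite /p big1; first by rewrite mulr1 addNr.
      move=> k _; rewrite indicE memNset ?subr0// => Akx; apply: nA.
      by exists k.
Qed.

Lemma bclosure_indic_smallest (G : set (set T)) :
  (forall A, G A -> cl (\1_A : T -> R)) ->
  forall A, <<s G >> A -> cl (\1_A : T -> R).
Proof.
by move=> GC; apply: smallest_sub => //; exact: sigma_algebra_bclosure.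
Qed.

End bounded_closure.

(** The sets B whose preimage has its indicator in the closure form a sigma-algebra, so the open
    rays are enough. *)
Lemma indic_preimage_measurable (R : realType) (T : Type) (C : set (T -> R))
    (ev : T -> R) :
  C (fun=> 1) ->
  (forall f, C f -> exists M : R, forall x, `|f x| <= M) ->
  (forall f g, C f -> C g -> bclosure C (fun x => f x * g x)) ->
  (forall a : R, bclosure C (\1_[set x | a < ev x] : T -> R)) ->
  forall B : set R, measurable B -> bclosure C (\1_(ev @^-1` B) : T -> R).
Proof.
move=> C1 Cb Cm Hev B; have [s0 sC sU] := sigma_algebra_bclosure C1 Cb Cm.
have -> : measurable B = (@RGenOInfty.G R).-sigma.-measurable B.
  by rewrite -RGenOInfty.measurableE.
move=> mB.
suff sub : <<s @RGenOInfty.G R >> `<=`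
    [set B : set R | bclosure C (\1_(ev @^-1` B) : T -> R)] by exact: sub.
apply: smallest_sub => [|_ [x ->]]; last first.
  rewrite /= (_ : _ @^-1` _ = [set y | x < ev y]) ; first exact: Hev.
  by apply/seteqP; split => y /=; rewrite in_itv/= andbT.
split => /=.
- by rewrite preimage_set0; exact: s0.
- by move=> A /= /sC; rewrite setTD setTD preimage_setC.
- by move=> F /= HF; rewrite preimage_bigcup; exact: sU.
Qed.

Lemma measurable_cos (R : realType) : measurable_fun setT (@cos R).
Proof. by apply: continuous_measurable_fun; exact: continuous_cos. Qed.

Lemma measurable_sin (R : realType) : measurable_fun setT (@sin R).
Proof. by apply: continuous_measurable_fun; exact: continuous_sin. Qed.

Lemma integrable_bounded d (T : measurableType d) (R : realType)
    (P : probability T R) (f : T -> R) (M : R) :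
  measurable_fun setT f -> (forall x, `|f x| <= M) ->
  P.-integrable setT (EFin \o f).
Proof.
move=> mf fM; apply: (@integrable_dominated _ _ _ P f (cst M)) => //.
exact: finite_measure_integrable_cst.
Qed.

Lemma Rintegral_prob_cst d (T : measurableType d) (R : realType) (P : probability T R)
  (c : R) : \int[P]_w c = c.
Proof.
rewrite Rintegral_cst//; transitivity (c * fine 1%E); last by rewrite mulr1.
by congr (_ * fine _); exact: probability_setT.
Qed.

Section process_law.
Context {R : realType} {I : Type} d1 d2 (T1 : measurableType d1)
  (T2 : measurableType d2) (P1 : probability T1 R) (P2 : probability T2 R)
  (X : I -> T1 -> R) (Y : I -> T2 -> R).
Hypothesis mX : forall i, measurable_fun setT (X i).
Hypothesis mY : forall i, measurable_fun setT (Y i).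

Let lincomb (s : seq (R * I)) (p : I -> R) : R := \sum_(q <- s) q.1 * p q.2.

(** The free phase [b] brings in the sines, and makes the product of two members half the sum of two
    others. *)
Let trig : set ((I -> R) -> R) :=
  [set f | exists s b, f = fun p => cos (lincomb s p + b)].

Hypothesis eq_cos : forall s b,
  \int[P1]_w cos (lincomb s (X ^~ w) + b) =
  \int[P2]_w cos (lincomb s (Y ^~ w) + b).

Let trig1 : trig (fun=> 1).
Proof.
by exists [::], 0; apply/funext => p; rewrite /lincomb big_nil addr0 cos0.
Qed.

Let trig_bounded f : trig f -> exists M : R, forall p, `|f p| <= M.
Proof. by move=> [s [b ->]]; exists 1 => p; exact: cos_max. Qed.

Let trig_mul f g : trig f -> trig g -> bclosure trig (fun p => f p * g p).
Proof.
move=> [s [b ->]] [t [c ->]].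
pose nt := [seq (- q.1, q.2) | q <- t].
have cl1 : bclosure trig (fun p => cos (lincomb (s ++ t) p + (b + c))).
  by apply: bclosure_gen; exists (s ++ t), (b + c).
have cl2 : bclosure trig (fun p => cos (lincomb (s ++ nt) p + (b - c))).
  by apply: bclosure_gen; exists (s ++ nt), (b - c).
have := bclosure_lin 2^-1 cl1 (bclosure_scale trig1 2^-1 cl2).
apply: bclosure_ext => p.
have -> : lincomb (s ++ t) p + (b + c) = (lincomb s p + b) + (lincomb t p + c).
  by rewrite /lincomb big_cat/= addrACA.
have -> : lincomb (s ++ nt) p + (b - c) = (lincomb s p + b) - (lincomb t p + c).
  rewrite /lincomb big_cat/= big_map/= opprD addrACA; congr (_ + _ + _).
  by rewrite -sumrN; congr (_ - _); apply: eq_bigr => q _; rewrite mulNr.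
by rewrite cosD cosB; field.
Qed.

(** The sign of p i - a is the sign of sin ((p i - a)/(n+1)) as soon as |p i - a|/(n+1) < pi, so
    these indicators are eventually constant in n at each p. The sine is a cosine with phase shifted
    by -pi/2. *)
Let half_line i (a : R) : bclosure trig (\1_[set p : I -> R | a < p i]).
Proof.
pose t n : R := n.+1%:R^-1.
have cls n : bclosure trig (fun p : I -> R => sin (t n * (p i - a))).
  apply: bclosure_gen; exists [:: (t n, i)], (- (t n * a) - pi / 2).
  by apply/funext => p; rewrite /lincomb big_seq1/= -cosBpihalf; congr cos; ring.
apply: (@bclosure_lim _ _ _
  (fun n => \1_[set p : I -> R | 0 < sin (t n * (p i - a))]) _ 1).
- by move=> n; exact: (bclosure_indic_gt0 trig1 trig_bounded trig_mul (cls n)).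
- by move=> n p; rewrite indicE; case: (_ \in _); rewrite ?normr1 ?normr0 ?ler01.
- move=> p; apply: cvg_near_cst.
  have pi0 : 0 < pi :> R by exact: pi_gt0.
  have : \forall n \near \oo, t n * `|p i - a| < pi.
    have /cvgrPdist_lt/(_ _ pi0) : t n * `|p i - a| @[n --> \oo] --> (0 : R).
      rewrite -[X in _ --> X](mul0r `|p i - a|); apply: cvgM; last exact: cvg_cst.
      exact: cvg_harmonic.
    by apply: filterS => n; rewrite sub0r normrN; apply: le_lt_trans; exact: ler_norm.
  apply: filterS => n tn; rewrite !indicE; congr (nat_of_bool _)%:R.
  have t0 : 0 < t n by rewrite invr_gt0.
  apply/idP/idP; rewrite !inE/=; last first.
    move=> ap; have ap0 : 0 < p i - a by rewrite subr_gt0.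
    by apply: sin_gt0_pi; rewrite mulr_gt0//= -(gtr0_norm ap0).
  apply: contraTT; rewrite -!leNgt => pa.
  have pa0 : p i - a <= 0 by rewrite subr_le0.
  rewrite -oppr_ge0 -sinN; apply: sin_ge0_pi.
  by rewrite -mulrN mulr_ge0 ?oppr_ge0//= 1?ltW// -(ler0_norm pa0).
Qed.

(** Measurability is proved in the same induction because the linear and limit cases need it to
    speak of integrals. *)
Let eq_integral_bclosure f : bclosure trig f ->
  [/\ measurable_fun setT (fun w => f (X ^~ w)),
      measurable_fun setT (fun w => f (Y ^~ w)) &
      \int[P1]_w f (X ^~ w) = \int[P2]_w f (Y ^~ w)].
Proof.
have mlin d (T : measurableType d) (Z : I -> T -> R) s :
    (forall i, measurable_fun setT (Z i)) ->
    measurable_fun setT (fun w => lincomb s (Z ^~ w)).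
  move=> mZ; apply: measurable_sum => q.
  by apply: measurable_funM => //; exact: mZ.
elim=> {f} [_ [s [b ->]]|a f g clf [mf1 mf2 ef] clg [mg1 mg2 eg]|
            f_ f M _ IH fM f_f].
- split => //; apply: (measurableT_comp (@measurable_cos _)).
    by apply: measurable_funD => //; exact: mlin.
  by apply: measurable_funD => //; exact: mlin.
- have [M fM] := bclosure_bounded trig_bounded clf.
  have [N gN] := bclosure_bounded trig_bounded clg.
  split.
  + by apply: measurable_funD => //; exact: measurable_funM.
  + by apply: measurable_funD => //; exact: measurable_funM.
  + have i1 := integrable_bounded P1 mf1 (fun w => fM _).
    have i2 := integrable_bounded P2 mf2 (fun w => fM _).
    rewrite !RintegralD//; first last.
    * exact: (integrable_bounded P1 mg1 (fun w => gN _)).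
    * exact: (integrableZl measurableT a i1).
    * exact: (integrable_bounded P2 mg2 (fun w => gN _)).
    * exact: (integrableZl measurableT a i2).
    by rewrite !RintegralZl// ef eg.
- have m1 n : measurable_fun setT (fun w => f_ n (X ^~ w)) by have [] := IH n.
  have m2 n : measurable_fun setT (fun w => f_ n (Y ^~ w)) by have [] := IH n.
  have iM d (T : measurableType d) (P : probability T R) :
      P.-integrable setT (EFin \o cst M).
    exact: finite_measure_integrable_cst.
  have [/integrable_measurable mf1 c1] := @Rintegral_cvg _ _ _ P1
    (fun n w => f_ n (X ^~ w)) (fun w => f (X ^~ w)) (cst M) m1
    (fun w => f_f _) (iM _ _ _) (fun n w => fM n _).
  have [/integrable_measurable mf2 c2] := @Rintegral_cvg _ _ _ P2
    (fun n w => f_ n (Y ^~ w)) (fun w => f (Y ^~ w)) (cst M) m2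
    (fun w => f_f _) (iM _ _ _) (fun n w => fM n _).
  split => //; apply: cvg_unique c1 _ => //.
  suff -> : (fun n => \int[P1]_w f_ n (X ^~ w)) =
            (fun n => \int[P2]_w f_ n (Y ^~ w)) by [].
  by apply/funext => n; have [] := IH n.
Qed.

Lemma same_law_of_cos : same_law P1 P2 X Y.
Proof.
move=> A sA.
have clA : bclosure trig (\1_A).
  apply: (bclosure_indic_smallest trig1 trig_bounded trig_mul) sA.
  move=> _ [i [B [mB ->]]].
  exact: (indic_preimage_measurable trig1 trig_bounded trig_mul (half_line i)).
have [m1 m2 e12] := eq_integral_bclosure clA.
have E d (T : measurableType d) (P : probability T R) (Z : I -> T -> R) :
    measurable_fun setT (fun w => \1_A (Z ^~ w) : R) ->
    P [set w | A (Z ^~ w)] = (\int[P]_w \1_A (Z ^~ w))%:E.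
  move=> mZ; rewrite -integral_EFinE; last first.
    by apply: (@integrable_bounded _ _ _ _ _ 1) => // w; rewrite indicE;
      case: (_ \in _); rewrite ?normr1 ?normr0 ?ler01.
  (* The event is the preimage of 1 under its own indicator, whose measurability is already known;
     this yields the measurability of the event. *)
  have eqs : [set w | A (Z ^~ w)] = (fun w => \1_A (Z ^~ w) : R) @^-1` [set 1].
    apply/seteqP; split => w /=; first by move=> Aw; rewrite indicE mem_set.
    rewrite indicE; case: (boolP (_ \in _)); first by rewrite inE.
    by move=> _ /eqP; rewrite eq_sym oner_eq0.
  have mA : measurable [set w | A (Z ^~ w)].
    by rewrite eqs -[X in measurable X]setTI; exact: mZ.
  by rewrite /= integral_indic// setIT.
by rewrite !E// e12.
Qed.

End process_law.

(** * Gaussian integrals *)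

Section real_line_integrals.
Context {R : realType}.
Local Notation leb := (@lebesgue_measure R).

(** The translated measure agrees with Lebesgue measure on half-open intervals, which determine
    it. *)
Lemma lebesgue_measureD (a : R) (A : set R) : measurable A ->
  pushforward leb (fun x : R => (x + a : measurableTypeR R)) A = leb A.
Proof.
move=> mA; apply/esym.
have mD : measurable_fun setT (fun x : measurableTypeR R => (x + a : measurableTypeR R)).
  exact: measurable_funD.
apply: (@lebesgue_measure_unique _
  (measure_function_pushforward__canonical__measure_function_Measure leb mD)) => // _
    [[x y]] _ <-.
rewrite -[RHS]/(leb ((fun z : R => z + a) @^-1` [set` `]x, y]])).
have -> : (fun z : R => z + a) @^-1` [set` `]x, y]] = [set` `]x - a, y - a]].
  by apply/seteqP; split => z /=; rewrite !in_itv/= ltrBlDr lerBrDr.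
rewrite !lebesgue_measure_itv/= !lte_fin ltrD2r /=; case: ifP => // _.
by rewrite -!EFinD; congr (_%:E); ring.
Qed.

Lemma ge0_integral_translation (f : R -> \bar R) (a : R) :
  measurable_fun setT f -> (forall x, (0 <= f x)%E) ->
  (\int[leb]_x f (x + a)%R = \int[leb]_x f x)%E.
Proof.
move=> mf f0.
have mD : measurable_fun setT (fun x : R => (x + a : measurableTypeR R)).
  by apply: measurable_funD.
rewrite [RHS](@eq_measure_integral _ _ _ _ (pushforward leb (fun x : R => (x + a :
  measurableTypeR R)))); last first.
  by move=> A mA _; exact/esym/lebesgue_measureD.
by rewrite ge0_integral_pushforward// preimage_setT.
Qed.

Lemma Rintegral_translation (f : R -> R) (a : R) : measurable_fun setT f ->
  \int[leb]_x f (x + a) = \int[leb]_x f x.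
Proof.
move=> mf; rewrite /Rintegral; congr fine; rewrite integralE [RHS]integralE.
have mEf : measurable_fun setT (EFin \o f) by exact/measurable_EFinP.
congr (_ - _)%E.
  rewrite -(ge0_integral_translation a (measurable_funepos mEf) (funepos_ge0 _)).
  by apply: eq_integral => x _; rewrite !funeposE.
rewrite -(ge0_integral_translation a (measurable_funeneg mEf) (funeneg_ge0 _)).
by apply: eq_integral => x _; rewrite !funenegE.
Qed.

Lemma integrable_translation (f : R -> R) (a : R) :
  leb.-integrable setT (EFin \o f) ->
  leb.-integrable setT (EFin \o (fun x => f (x + a))).
Proof.
move=> intf; have mf := integrable_measurable intf.
have mD : measurable_fun setT (fun x : R => x + a) by exact: measurable_funD.
apply/integrableP; split.
  by apply/measurable_EFinP; exact: (measurableT_comp mf mD).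
have mN : measurable_fun setT (fun x : R => `|f x|%:E).
  by apply/measurable_EFinP; exact: measurableT_comp.
have := @ge0_integral_translation (fun x => `|f x|%:E) a mN.
move=> /(_ (fun x => normr_ge0 _)); move/integrableP : intf => [_].
by move=> /[swap] <-.
Qed.

(** The antiderivative is [atan]. This function is the common majorant for Schwartz functions
    (coordinatewise) and for exp (-k|x|). *)
Lemma integrable_inv_1sqr : leb.-integrable setT (EFin \o (fun x : R => (1 + x ^+ 2)^-1)).
Proof.
have p0 (x : R) : 0 < 1 + x ^+ 2 by rewrite ltr_pwDl// sqr_ge0.
have ci : continuous (fun x : R => (1 + x ^+ 2)^-1).
  move=> x; apply: cvgV; first by rewrite gt_eqF.
  by apply: cvgD; [exact: cvg_cst|exact: sqr_continuous].
have mi : measurable_fun setT (fun x : R => (1 + x ^+ 2)^-1).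
  exact: continuous_measurable_fun.
have i0 (x : R) : 0 <= (1 + x ^+ 2)^-1 by rewrite invr_ge0 ltW.
apply/integrableP; split; first exact/measurable_EFinP.
under eq_integral do rewrite /= ger0_norm//.
have I0y : (\int[leb]_(x in `[0%R, +oo[) ((1 + x ^+ 2)^-1)%:E < +oo)%E.
  rewrite (@ge0_continuous_FTC2y _ _ atan _ (pi / 2))//.
  - by rewrite -EFinB ltry.
  - exact: continuous_subspaceT.
  - exact: cvgy_atan.
  - by apply: cvg_at_right_filter; exact: continuous_atan.
  - by move=> x _; rewrite derive1_atan.
rewrite ge0_symfun_integralT//; last by move=> x /=; rewrite sqrrN.
by rewrite -set_itvcy lte_mul_pinfty.
Qed.

(** Integration by parts on the line: the fundamental theorem on [-n, n], then dominated
    convergence. Limits of [F] along the integers suffice because [f] is integrable. *)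
Lemma Rintegral_derivative_eq0 (F f : R -> R) :
  (forall x, is_derive x (1 : R) F (f x : R)) -> continuous f ->
  leb.-integrable setT (EFin \o f) ->
  F n%:R @[n --> \oo] --> 0 -> F (- n%:R) @[n --> \oo] --> 0 ->
  \int[leb]_x f x = 0.
Proof.
move=> dF cf intf Fy FNy.
have cF : continuous F.
  by move=> x; apply: differentiable_continuous; apply/derivable1_diffP; have [] := dF x.
pose I n : set R := `[- n%:R, n%:R]%classic.
have mI n : measurable (I n) by exact: measurable_itv.
have FTC n : \int[leb]_x (f x * \1_(I n) x) = F n%:R - F (- n%:R).
  have -> : \int[leb]_x (f x * \1_(I n) x) = \int[leb]_(x in I n) f x.
    by rewrite [RHS]Rintegral_mkcond; apply: eq_Rintegral => x _; rewrite patch_indic.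
  case: n => [|n]; first by rewrite /I oppr0 subrr set_itv1 Rintegral_set1.
  rewrite /Rintegral (@continuous_FTC2 _ f F)//.
  - by rewrite gtrN// ltr0n.
  - exact: continuous_subspaceT.
  - split.
    + by move=> x _; have [] := dF x.
    + by apply: cvg_at_right_filter; exact: cF.
    + by apply: cvg_at_left_filter; exact: cF.
  - by move=> x _; rewrite derive1E; have [_ ->] := dF x.
have m1 n : measurable_fun setT (fun x => f x * \1_(I n) x).
  by apply: measurable_funM => //; exact: continuous_measurable_fun.
have b1 n x : `|f x * \1_(I n) x| <= `|f x|.
  by rewrite normrM indicE; case: (_ \in _); rewrite ?normr1 ?normr0 ?mulr1// mulr0.
have l1 x : f x * \1_(I n) x @[n --> \oo] --> f x.
  apply: cvg_near_cst; near=> n.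
  rewrite indicE mem_set ?mulr1// /I/= in_itv/= -ler_norml.
  near: n; exact: nbhs_infty_ger.
have [_ c1] := @Rintegral_cvg _ _ _ leb _ f _ m1 l1 (integrable_norm intf) b1.
apply: (cvg_unique _ c1) => //=.
rewrite [X in X @ _ --> _](_ : _ = fun n => F n%:R - F (- n%:R)); last exact/funext.
by rewrite -(subr0 0); exact: cvgB.
Unshelve. all: end_near. Qed.

End real_line_integrals.

Section gaussian_integrals.
Context {R : realType}.
Local Notation leb := (@lebesgue_measure R).

Definition gauss (k x : R) : R := expR (- (k * x ^+ 2)).

Lemma gauss_ge0 k x : 0 <= gauss k x. Proof. exact: expR_ge0. Qed.

Lemma gauss_gt0 k x : 0 < gauss k x. Proof. exact: expR_gt0. Qed.

Lemma gaussN k x : gauss k (- x) = gauss k x.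
Proof. by rewrite /gauss sqrrN. Qed.

Lemma is_derive_gauss (k x : R) :
  is_derive x (1 : R) (gauss k) (- (2 * k * x) * gauss k x).
Proof.
rewrite /gauss; apply: is_derive_eq; rewrite /GRing.scale/=; ring.
Qed.

Lemma continuous_gauss k : continuous (gauss k).
Proof.
move=> x; apply: differentiable_continuous; apply/derivable1_diffP.
by have [] := is_derive_gauss k x.
Qed.

Lemma measurable_gauss k : measurable_fun setT (gauss k).
Proof. by apply: continuous_measurable_fun; exact: continuous_gauss. Qed.

Lemma normal_pdf_gauss (s : R) x : s != 0 ->
  normal_pdf 0 s x = normal_peak s * gauss (s ^+ 2 *+ 2)^-1 x.
Proof.
move=> s0; rewrite normal_pdfE// /normal_fun /gauss subr0 mulNr.
by rewrite (mulrC (x ^+ 2)).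
Qed.

(** The variance is s^2 = 1/(2k), which turns [gauss k] into a multiple of a normal density of known
    integral. *)
Let gauss_normal (k : R) : 0 < k -> exists2 s : R, s != 0 &
  k = (s ^+ 2 *+ 2)^-1 /\ normal_peak s = (Num.sqrt (pi / k))^-1.
Proof.
move=> k0; exists (Num.sqrt (2 * k)^-1).
  by rewrite gt_eqF// sqrtr_gt0 invr_gt0 mulr_gt0.
have s2 : Num.sqrt (2 * k)^-1 ^+ 2 = (2 * k)^-1 :> R.
  by rewrite sqr_sqrtr// invr_ge0 mulr_ge0// ltW.
have k0' := gt_eqF k0.
split; rewrite ?/normal_peak s2; first by rewrite -mulr_natr; field; rewrite k0'.
congr (Num.sqrt _)^-1; rewrite -mulr_natr; field; by rewrite k0'.
Qed.

Lemma integrable_gauss (k : R) : 0 < k -> leb.-integrable setT (EFin \o gauss k).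
Proof.
move=> /gauss_normal[s s0 [-> _]].
have := integrableZl measurableT (normal_peak s)^-1 (integrable_normal_pdf 0 s).
apply: eq_integrable => // x _ /=.
by rewrite -EFinM normal_pdf_gauss// mulKf// gt_eqF// normal_peak_gt0.
Qed.

Lemma Rintegral_gauss (k : R) : 0 < k -> \int[leb]_x gauss k x = Num.sqrt (pi / k).
Proof.
move=> k0; have [s s0 [kE pE]] := gauss_normal k0.
have := integral_normal_pdf 0 s.
rewrite integral_EFinE; last exact: integrable_normal_pdf.
under eq_Rintegral do rewrite normal_pdf_gauss// -kE.
rewrite RintegralZl//; last exact: integrable_gauss.
move=> [] /(congr1 ( *%R (normal_peak s)^-1)).
by rewrite mulr1 mulKf ?gt_eqF ?normal_peak_gt0// pE invrK.
Qed.

(** With t = k x^2 / 2, the inequality 1 + t <= exp t gives t exp (-t) <= 1; the other half of the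
    exponent is kept. *)
Lemma sqr_gauss_le (k x : R) : 0 < k -> x ^+ 2 * gauss k x <= 2 / k * gauss (k / 2) x.
Proof.
move=> k0; have k2 : 0 < k / 2 by rewrite divr_gt0.
rewrite -(ler_pM2l k2) mulrA (_ : k / 2 * (2 / k * _) = gauss (k / 2) x); last first.
  by field; rewrite gt_eqF.
have -> : gauss k x = gauss (k / 2) x * gauss (k / 2) x.
  by rewrite /gauss -expRD; congr expR; field.
have g0 := gauss_gt0 (k / 2) x.
have : 1 + k / 2 * x ^+ 2 <= (gauss (k / 2) x)^-1.
  by rewrite /gauss -expRN opprK expR_ge1Dx.
move=> h; have {}h : k / 2 * x ^+ 2 * gauss (k / 2) x <= 1.
  by rewrite -ler_pdivlMr// div1r; lra.
by rewrite mulrA -[leRHS]mul1r ler_pM2r.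
Qed.

Lemma integrable_sqr_gauss (k : R) : 0 < k ->
  leb.-integrable setT (EFin \o (fun x => x ^+ 2 * gauss k x)).
Proof.
move=> k0; apply: (@integrable_dominated _ _ _ leb _ (fun x => 2 / k * gauss (k / 2) x)).
- by apply: measurable_funM; [exact: measurable_funX|exact: measurable_gauss].
- by move=> x; rewrite ger0_norm ?sqr_gauss_le// mulr_ge0 ?sqr_ge0 ?gauss_ge0.
- by apply: integrable_scale; apply: integrable_gauss; rewrite divr_gt0.
Qed.

Lemma integrable_id_gauss (k : R) : 0 < k ->
  leb.-integrable setT (EFin \o (fun x => `|x| * gauss k x)).
Proof.
move=> k0; apply: (@integrable_dominated _ _ _ leb _
  (fun x => gauss k x + x ^+ 2 * gauss k x)).
- by apply: measurable_funM; [exact: normr_measurable|exact: measurable_gauss].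
- move=> x; rewrite ger0_norm ?mulr_ge0 ?gauss_ge0//.
  rewrite -{2}(mul1r (gauss k x)) -mulrDl ler_wpM2r ?gauss_ge0//.
  by rewrite -real_normK ?num_real//; have := normr_ge0 x; nra.
- exact: integrable_add (integrable_gauss k0) (integrable_sqr_gauss k0).
Qed.

Lemma cvg_gauss (k : R) : 0 < k -> gauss k n%:R @[n --> \oo] --> (0 : R).
Proof.
(* With c = min (1, k) and n <= n^2, one has c (n + 1) <= 1 + k n^2 <= exp (k n^2). *)
move=> k0; pose c : R := Num.min 1 k.
have c0 : 0 < c by rewrite lt_min ltr01.
apply: (@squeeze_cvgr _ _ _ _ (cst 0) (fun n => c^-1 * harmonic n)).
- apply: nearW => n; rewrite gauss_ge0/= /harmonic -invfM /gauss expRN.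
  rewrite lef_pV2 ?posrE ?expR_gt0 ?mulr_gt0//.
  apply: le_trans (expR_ge1Dx _).
  have c1 : c <= 1 by rewrite ge_min lexx.
  have ck : c <= k by rewrite ge_min lexx orbT.
  have nn : n%:R <= n%:R ^+ 2 :> R by rewrite -natrX ler_nat; case: n => // n;
    rewrite leq_pmulr.
  rewrite -natr1; have := ler0n R n; nra.
- exact: cvg_cst.
- rewrite -[X in _ --> X](mulr0 c^-1); apply: cvgM; first exact: cvg_cst.
  exact: cvg_harmonic.
Qed.

Lemma cvg_dominated_gauss (k C : R) (F : R -> R) : 0 < k ->
  (forall x, `|F x| <= C * gauss k x) ->
  F n%:R @[n --> \oo] --> 0 /\ F (- n%:R) @[n --> \oo] --> 0.
Proof.
move=> k0 FC.
have cC : C * gauss k n%:R @[n --> \oo] --> (0 : R).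
  by rewrite -(mulr0 C); apply: cvgM; [exact: cvg_cst|exact: cvg_gauss].
have cNC : - (C * gauss k n%:R) @[n --> \oo] --> (0 : R).
  by rewrite -oppr0; exact: cvgN.
split; apply: (squeeze_cvgr _ cNC cC); apply: nearW => n; rewrite -ler_norml//.
by rewrite -[in leRHS]gaussN.
Qed.

Lemma Rintegral_id_gauss (k : R) : 0 < k -> \int[leb]_x (x * gauss k x) = 0.
Proof.
move=> k0.
have intx : leb.-integrable setT (EFin \o (fun x => x * gauss k x)).
  apply: (@integrable_dominated _ _ _ leb _ (fun x => `|x| * gauss k x)).
  - by apply: measurable_funM => //; exact: measurable_gauss.
  - by move=> x; rewrite normrM (ger0_norm (gauss_ge0 _ _)).
  - exact: integrable_id_gauss.
have bF x : `|gauss k x| <= 1 * gauss k x by rewrite mul1r ger0_norm ?gauss_ge0.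
have [c1 c2] := cvg_dominated_gauss k0 bF.
have E x : - (2 * k * x) * gauss k x = - (2 * k) * (x * gauss k x) by ring.
have cf : continuous (fun x : R => - (2 * k * x) * gauss k x).
  move=> x; under eq_fun do rewrite E; apply: cvgM; first exact: cvg_cst.
  by apply: cvgM; [exact: cvg_id|exact: continuous_gauss].
have intf : leb.-integrable setT (EFin \o (fun x : R => - (2 * k * x) * gauss k x)).
  by rewrite (funext E); exact: integrable_scale.
have := Rintegral_derivative_eq0 (is_derive_gauss k) cf intf c1 c2.
under eq_Rintegral do rewrite E.
rewrite RintegralZl// => /eqP; rewrite mulf_eq0 oppr_eq0 mulf_eq0 (gt_eqF k0).
by rewrite pnatr_eq0/= => /eqP.
Qed.

(** The derivative of x [gauss k x] has integral 0, which expresses the second moment through the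
    mass. *)
Lemma Rintegral_sqr_gauss (k : R) : 0 < k ->
  \int[leb]_x (x ^+ 2 * gauss k x) = Num.sqrt (pi / k) / (2 * k).
Proof.
move=> k0.
have dF x : is_derive x (1 : R) (fun x : R => x * gauss k x)
    (gauss k x + - (2 * k) * (x ^+ 2 * gauss k x)).
  have := is_derive_gauss k x => dg.
  apply: is_derive_eq; rewrite /GRing.scale/=; ring.
have cf : continuous (fun x => gauss k x + - (2 * k) * (x ^+ 2 * gauss k x)).
  move=> x; apply: cvgD; first exact: continuous_gauss.
  apply: cvgM; first exact: cvg_cst.
  by apply: cvgM; [exact: sqr_continuous|exact: continuous_gauss].
have intf := integrable_add (integrable_gauss k0)
  (integrable_scale (- (2 * k)) (integrable_sqr_gauss k0)).
have k2 : 0 < k / 2 by rewrite divr_gt0.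
have bF x : `|x * gauss k x| <= (1 + 2 / k) * gauss (k / 2) x.
  have h := sqr_gauss_le x k0.
  have h2 : gauss k x <= gauss (k / 2) x.
    rewrite ler_expR lerN2 ler_wpM2r ?sqr_ge0//; lra.
  rewrite normrM (ger0_norm (gauss_ge0 _ _)).
  apply: (@le_trans _ _ ((1 + x ^+ 2) * gauss k x)); last lra.
  rewrite ler_wpM2r ?gauss_ge0//.
  by rewrite -(real_normK (num_real x)); have := normr_ge0 x; nra.
have [c1 c2] := cvg_dominated_gauss k2 bF.
have := Rintegral_derivative_eq0 dF cf intf c1 c2.
rewrite RintegralD//; first last.
- exact: (integrable_scale (- (2 * k)) (integrable_sqr_gauss k0)).
- exact: integrable_gauss.
rewrite RintegralZl//; last exact: integrable_sqr_gauss.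
rewrite Rintegral_gauss// => /eqP; rewrite addr_eq0 mulNr opprK => /eqP ->.
by field; rewrite gt_eqF.
Qed.

Lemma integrable_gauss_bounded (k M : R) (f : R -> R) : 0 < k ->
  measurable_fun setT f -> (forall x, `|f x| <= M) ->
  leb.-integrable setT (EFin \o (fun x => gauss k x * f x)).
Proof.
move=> k0 mf fM; apply: (@integrable_dominated _ _ _ leb _ (fun x => M * gauss k x)).
- by apply: measurable_funM => //; exact: measurable_gauss.
- by move=> x; rewrite normrM (ger0_norm (gauss_ge0 _ _)) mulrC ler_wpM2r ?gauss_ge0.
- by apply: integrable_scale; exact: integrable_gauss.
Qed.

Let measurable_cos_affine (y b : R) : measurable_fun setT (fun x : R => cos (y * x + b)).
Proof.
apply: (measurableT_comp (@measurable_cos R)).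
by apply: measurable_funD => //; exact: measurable_funM.
Qed.

Let measurable_sin_affine (y b : R) : measurable_fun setT (fun x : R => sin (y * x + b)).
Proof.
apply: (measurableT_comp (@measurable_sin R)).
by apply: measurable_funD => //; exact: measurable_funM.
Qed.

(* Integrating the derivative of [gauss k x * sin (y x + b)]: this is the
   differential equation of the Fourier transform of the Gaussian. *)
Let gauss_sin_parts (k y b : R) : 0 < k ->
  \int[leb]_x (- (x * gauss k x * sin (y * x + b))) =
  - (y / (2 * k)) * \int[leb]_x (gauss k x * cos (y * x + b)).
Proof.
move=> k0.
have dF x : is_derive x (1 : R) (fun x : R => gauss k x * sin (y * x + b))
    (2 * k * (- (x * gauss k x * sin (y * x + b))) + y * (gauss k x * cos (y * x + b))).
  have := is_derive_gauss k x => dg.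
  apply: is_derive_eq; rewrite /GRing.scale/=; ring.
have csin : continuous (fun x : R => sin (y * x + b)).
  move=> x; apply: continuous_comp; last exact: continuous_sin.
  by apply: cvgD; [apply: cvgM; [exact: cvg_cst|exact: cvg_id]|exact: cvg_cst].
have ccos : continuous (fun x : R => cos (y * x + b)).
  move=> x; apply: continuous_comp; last exact: continuous_cos.
  by apply: cvgD; [apply: cvgM; [exact: cvg_cst|exact: cvg_id]|exact: cvg_cst].
have i1 : leb.-integrable setT (EFin \o (fun x => - (x * gauss k x * sin (y * x + b)))).
  apply: (@integrable_dominated _ _ _ leb _ (fun x => `|x| * gauss k x)).
  - apply: measurableT_comp => //; apply: measurable_funM => //.
      by apply: measurable_funM => //; exact: measurable_gauss.
    exact: measurable_sin_affine.
  - move=> x; rewrite normrN 2!normrM (ger0_norm (gauss_ge0 _ _)) ler_piMr ?sin_max//.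
    by rewrite mulr_ge0 ?gauss_ge0.
  - exact: integrable_id_gauss.
have i2 : leb.-integrable setT (EFin \o (fun x => gauss k x * cos (y * x + b))).
  by apply: (@integrable_gauss_bounded _ 1) => // x; exact: cos_max.
have intf := integrable_add (integrable_scale (2 * k) i1) (integrable_scale y i2).
have cf : continuous (fun x : R => 2 * k * (- (x * gauss k x * sin (y * x + b))) + y *
  (gauss k x * cos (y * x + b))).
  move=> x; apply: cvgD.
    apply: cvgM; first exact: cvg_cst.
    apply: cvgN; apply: cvgM; last exact: csin.
    by apply: cvgM; [exact: cvg_id|exact: continuous_gauss].
  apply: cvgM; first exact: cvg_cst.
  by apply: cvgM; [exact: continuous_gauss|exact: ccos].
have bF x : `|gauss k x * sin (y * x + b)| <= 1 * gauss k x.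
  by rewrite mul1r normrM (ger0_norm (gauss_ge0 _ _)) ler_piMr ?gauss_ge0 ?sin_max.
have [c1 c2] := cvg_dominated_gauss k0 bF.
have := Rintegral_derivative_eq0 dF cf intf c1 c2.
rewrite RintegralD//; first last.
- exact: (integrable_scale y i2).
- exact: (integrable_scale (2 * k) i1).
rewrite !RintegralZl// => /eqP; rewrite addr_eq0 => /eqP H.
have k20 : 2 * k != 0 by rewrite mulf_neq0 ?pnatr_eq0// gt_eqF.
apply: (mulfI k20); rewrite H; field; by rewrite gt_eqF.
Qed.

(** As a function of y the integral [u] satisfies u' = -(y/(2k)) u, so u exp (y^2/(4k)) is constant;
    its value at y = 0 is the Gaussian mass times cos b. *)
Lemma Rintegral_gauss_cos (k y b : R) : 0 < k ->
  \int[leb]_x (gauss k x * cos (y * x + b)) =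
  Num.sqrt (pi / k) * expR (- (y ^+ 2 / (4 * k))) * cos b.
Proof.
move=> k0; pose f (y x : R) := gauss k x * cos (y * x + b).
pose u (y : R) := \int[leb]_x f y x.
have df (z x : R) : is_derive z (1 : R) (f ^~ x) (- (x * gauss k x * sin (z * x + b))).
  by rewrite /f; apply: is_derive_eq; rewrite /GRing.scale/=; ring.
have intf z : leb.-integrable setT (EFin \o f z).
  by apply: (@integrable_gauss_bounded _ 1) => // x; exact: cos_max.
have pf z x : partial1of2 f z x = - (x * gauss k x * sin (z * x + b)).
  by rewrite partial1of2E; have [_ ->] := df z x.
have bpf z x : `|partial1of2 f z x| <= `|x| * gauss k x.
  rewrite pf normrN 2!normrM (ger0_norm (gauss_ge0 _ _)) ler_piMr ?sin_max//.
  by rewrite mulr_ge0 ?gauss_ge0.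
have du z : is_derive z (1 : R) u (- (z / (2 * k)) * u z).
  (* The majorant |x| [gauss k x] of the y-derivative does not depend on y, so any neighbourhood of
     [z] serves. *)
  have zI : `]z - 1, z + 1[%classic z by rewrite /= in_itv/=; apply/andP; split; lra.
  have dF z' x : `]z - 1, z + 1[%classic z' -> setT x -> derivable (f ^~ x) z' 1.
    by move=> _ _; have [] := df z' x.
  have G0 x : 0 <= `|x| * gauss k x by rewrite mulr_ge0 ?gauss_ge0.
  apply: DeriveDef.
    exact: (derivable_under_integral measurableT zI (fun z' _ => intf z') dF G0
      (integrable_id_gauss k0) (fun z' x _ _ => bpf z' x)).
  rewrite -derive1E (differentiation_under_integral measurableT zI (fun z' _ => intf
    z') dF G0
      (integrable_id_gauss k0) (fun z' x _ _ => bpf z' x)).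
  rewrite -gauss_sin_parts//; apply: eq_Rintegral => x _; exact: pf.
pose w (z : R) := u z * expR (z ^+ 2 / (4 * k)).
have k40 : 4 * k != 0 by rewrite mulf_neq0 ?pnatr_eq0// gt_eqF.
have dw z : is_derive z (1 : R) w 0.
  have := du z => duz; rewrite /w.
  apply: is_derive_eq; rewrite /GRing.scale/=; field; by rewrite gt_eqF.
have := is_derive_0_is_cst y 0 dw.
rewrite /w expr0n/= mul0r expR0 mulr1 => wE.
have -> : \int[leb]_x (gauss k x * cos (y * x + b)) = u 0 * expR (- (y ^+ 2 / (4 * k))).
  by rewrite -wE -mulrA -expRD addrN expR0 mulr1.
rewrite [RHS]mulrAC; congr (_ * _).
rewrite /u /f; under eq_Rintegral do rewrite mul0r add0r.
by rewrite RintegralZr ?Rintegral_gauss//; exact: integrable_gauss.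
Qed.

End gaussian_integrals.

(** * Second moments and cosine expectations of normal laws, including degenerate ones *)

Section normal_law_theory.
Context {R : realType}.
Local Notation leb := (@lebesgue_measure R).

Lemma normal_pdf_sqrt (m v x : R) : 0 < v ->
  normal_pdf m (Num.sqrt v) (x + m) =
  (Num.sqrt (pi / (2 * v)^-1))^-1 * gauss (2 * v)^-1 x.
Proof.
move=> v0; have s0 : Num.sqrt v != 0 by rewrite gt_eqF ?sqrtr_gt0.
have vE : Num.sqrt v ^+ 2 = v by rewrite sqr_sqrtr// ltW.
rewrite normal_pdfE// /normal_fun /normal_peak /gauss vE addrK invrK.
congr ((Num.sqrt _)^-1 * expR _); first by rewrite -mulr_natr; ring.
by rewrite mulNr -(mulr_natr v) (mulrC v) (mulrC (x ^+ 2)).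
Qed.

(** The Radon-Nikodym derivative of [normal_prob] and [normal_pdf] have the same integral over every
    measurable set, hence agree almost everywhere. *)
Lemma ge0_integral_normal_prob (m s : R) (f : R -> R) : s != 0 ->
  measurable_fun setT f -> (forall x, 0 <= f x) ->
  (\int[normal_prob m s]_x (f x)%:E =
   \int[leb]_x (f x * normal_pdf m s x)%:E)%E.
Proof.
move=> s0 mf f0.
pose nu : {finite_measure set (measurableTypeR R) -> \bar R} := normal_prob m s.
have dom : nu `<< leb by exact: normal_prob_dominates.
have intpdf := integrable_normal_pdf m s.
rewrite -[LHS](Radon_Nikodym_SigmaFinite.change_of_variables dom)//; last first.
  exact/measurable_EFinP.
apply: ae_eq_integral => //.
- apply: emeasurable_funM; first exact/measurable_EFinP.
  exact: measurable_int (Radon_Nikodym_SigmaFinite.f_integrable dom).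
- by apply/measurable_EFinP; apply: measurable_funM => //; exact: measurable_normal_pdf.
have : ae_eq leb setT (Radon_Nikodym_SigmaFinite.f nu leb)
    (EFin \o normal_pdf m s).
  apply: integral_ae_eq => //.
  - exact: Radon_Nikodym_SigmaFinite.f_integrable.
  - exact: measurable_int intpdf.
  - by move=> E _ mE; rewrite -(Radon_Nikodym_SigmaFinite.f_integral dom).
by apply: filterS => x /= H _; rewrite H// EFinM.
Qed.

Context d (T : measurableType d) (P : probability T R) (X : T -> R) (m v : R).
Hypotheses (mX : measurable_fun setT X) (v0 : 0 <= v).
Hypothesis lawX : forall A : set R, measurable A -> P (X @^-1` A) = normal_law m v A.

Let ge0_integral_law (f : R -> R) : measurable_fun setT f -> (forall x, 0 <= f x) ->
  (\int[P]_w (f (X w))%:E =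
   \int[pushforward P (X : T -> measurableTypeR R)]_x (f x)%:E)%E.
Proof.
move=> mf f0; rewrite ge0_integral_pushforward ?preimage_setT//.
- exact/measurable_EFinP.
- by move=> y _; rewrite lee_fin.
Qed.

Let ge0_integral_law_dirac (f : R -> R) : v = 0 ->
  measurable_fun setT f -> (forall x, 0 <= f x) ->
  (\int[P]_w (f (X w))%:E = (f m)%:E)%E.
Proof.
move=> v_eq0 mf f0; rewrite ge0_integral_law//.
move: lawX; rewrite /normal_law v_eq0 eqxx => lawm.
rewrite (@eq_measure_integral _ _ _ _ \d_(m : measurableTypeR R)); last first.
  by move=> A mA _; exact: lawm.
rewrite integral_dirac//; first by rewrite diracT mul1e.
exact/measurable_EFinP.
Qed.

Let ge0_integral_law_gauss (f : R -> R) : 0 < v ->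
  measurable_fun setT f -> (forall x, 0 <= f x) ->
  leb.-integrable setT (EFin \o (fun x => f (x + m) * gauss (2 * v)^-1 x)) ->
  (\int[P]_w (f (X w))%:E = ((Num.sqrt (pi / (2 * v)^-1))^-1 *
    \int[leb]_x (f (x + m) * gauss (2 * v)^-1 x))%:E)%E.
Proof.
move=> v_gt0 mf f0 intf; rewrite ge0_integral_law//.
move: lawX; rewrite /normal_law (gt_eqF v_gt0) => lawm.
rewrite (@eq_measure_integral _ _ _ _ (normal_prob m (Num.sqrt v))); last first.
  by move=> A mA _; exact: lawm.
rewrite ge0_integral_normal_prob ?gt_eqF ?sqrtr_gt0//.
have mg : measurable_fun setT (fun x => f x * normal_pdf m (Num.sqrt v) x).
  by apply: measurable_funM => //; exact: measurable_normal_pdf.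
rewrite -(@ge0_integral_translation _ _ m); last 2 first.
- exact/measurable_EFinP.
- by move=> x; rewrite lee_fin mulr_ge0 ?normal_pdf_ge0.
rewrite -RintegralZl// -integral_EFinE; last exact: integrable_scale.
by apply: eq_integral => x _; rewrite normal_pdf_sqrt// mulrCA.
Qed.

Let kv : 0 < v -> 0 < (2 * v)^-1.
Proof. by move=> v_gt0; rewrite invr_gt0 mulr_gt0. Qed.

Let sqrt_kv_gt0 : 0 < v -> 0 < Num.sqrt (pi / (2 * v)^-1).
Proof. by move=> v_gt0; rewrite sqrtr_gt0 divr_gt0 ?pi_gt0 ?kv. Qed.

(** At c = 0 this gives the isometry of the field; comparing two values of [c] recovers both [m] and
    [v] from second moments. *)
Lemma normal_law_sqr c :
  (\int[P]_w ((X w + c) ^+ 2)%:E = (v + (m + c) ^+ 2)%:E)%E.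
Proof.
have mf : measurable_fun setT (fun x : R => (x + c) ^+ 2).
  by apply: measurable_funX; exact: measurable_funD.
have E x : (x + m + c) ^+ 2 * gauss (2 * v)^-1 x = x ^+ 2 * gauss (2 * v)^-1 x +
   (2 * (m + c) * (x * gauss (2 * v)^-1 x) + (m + c) ^+ 2 * gauss (2 * v)^-1 x).
  by ring.
have [v_eq0|vN0] := eqVneq v 0.
  by rewrite (ge0_integral_law_dirac v_eq0 mf) ?v_eq0 ?add0r// => x; exact: sqr_ge0.
have v_gt0 : 0 < v by rewrite lt_neqAle eq_sym vN0.
have i1 := integrable_sqr_gauss (kv v_gt0).
have i2 : leb.-integrable setT (EFin \o (fun x => x * gauss (2 * v)^-1 x)).
  apply: (@integrable_dominated _ _ _ leb _ (fun x => `|x| * gauss (2 * v)^-1 x)).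
  - by apply: measurable_funM => //; exact: measurable_gauss.
  - by move=> x; rewrite normrM (ger0_norm (gauss_ge0 _ _)).
  - exact: integrable_id_gauss (kv v_gt0).
have i3 := integrable_gauss (kv v_gt0).
have i23 := integrable_add (integrable_scale (2 * (m + c)) i2)
              (integrable_scale ((m + c) ^+ 2) i3).
rewrite (ge0_integral_law_gauss v_gt0 mf) => [|x|]; last 2 first.
- exact: sqr_ge0.
- by rewrite (funext E); exact: integrable_add.
under eq_Rintegral do rewrite E.
rewrite RintegralD// RintegralD//; last 2 first.
- exact: integrable_scale.
- exact: integrable_scale.
rewrite !RintegralZl// Rintegral_id_gauss ?kv// Rintegral_sqr_gauss ?kv//.
rewrite Rintegral_gauss ?kv//; congr (_%:E).
have := sqrt_kv_gt0 v_gt0; set q := Num.sqrt _ => q0.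
by field; rewrite vN0 gt_eqF.
Qed.

Lemma normal_law_cos b :
  \int[P]_w cos (X w + b) = expR (- (v / 2)) * cos (m + b).
Proof.
have mf : measurable_fun setT (fun x : R => cos (x + b) + 1).
  apply: measurable_funD => //; apply: (measurableT_comp (@measurable_cos R)).
  exact: measurable_funD.
have f0 (x : R) : 0 <= cos (x + b) + 1.
  by rewrite -lerBlDr sub0r; exact: cos_geN1.
have icos : P.-integrable setT (EFin \o (fun w => cos (X w + b))).
  apply: (@integrable_bounded _ _ _ _ _ 1); last by move=> w; exact: cos_max.
  apply: (measurableT_comp (@measurable_cos R)).
  exact: measurable_funD.
(* Adding 1 makes the integrand nonnegative, as the transfer of the integral to the law requires. *)
suff : (\int[P]_w (cos (X w + b) + 1)%:E =
    (expR (- (v / 2)) * cos (m + b) + 1)%:E)%E.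
  have i1 : P.-integrable setT (EFin \o cst (1 : R)).
    exact: finite_measure_integrable_cst.
  rewrite integral_EFinE; last exact: (integrable_add icos i1).
  move=> [] /eqP; rewrite RintegralD// Rintegral_prob_cst.
  by move=> /eqP/addIr.
have [v_eq0|vN0] := eqVneq v 0.
  by rewrite (ge0_integral_law_dirac v_eq0 mf)// v_eq0 mul0r oppr0 expR0 mul1r.
have v_gt0 : 0 < v by rewrite lt_neqAle eq_sym vN0.
have E x : (cos (x + m + b) + 1) * gauss (2 * v)^-1 x =
    gauss (2 * v)^-1 x * cos (1 * x + (m + b)) + gauss (2 * v)^-1 x.
  by rewrite mul1r addrA; ring.
have i1 : leb.-integrable setT
    (EFin \o (fun x => gauss (2 * v)^-1 x * cos (1 * x + (m + b)))).
  apply: (@integrable_gauss_bounded _ _ 1) => //; first exact: kv.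
    apply: (measurableT_comp (@measurable_cos R)).
    by apply: measurable_funD => //; exact: measurable_funM.
  by move=> x; exact: cos_max.
have i2 := integrable_gauss (kv v_gt0).
rewrite (ge0_integral_law_gauss v_gt0 mf)//; last first.
  by rewrite (funext E); exact: integrable_add.
under eq_Rintegral do rewrite E.
rewrite RintegralD// Rintegral_gauss_cos ?kv// Rintegral_gauss ?kv//.
have := sqrt_kv_gt0 v_gt0; set q := Num.sqrt _ => q0.
have -> : 1 ^+ 2 / (4 * (2 * v)^-1) = v / 2 by field; rewrite vN0.
by congr (_%:E); field; rewrite gt_eqF.
Qed.

End normal_law_theory.

(** * Integrals over row vectors, by splitting off the first coordinate *)

Section rV_integrals.
Context {R : realType}.
Local Notation leb := (@lebesgue_measure R).
Local Notation mu := (@lebesgue_rV R).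

Lemma ge0_integral_rVS n (f : 'rV[R]_n.+1 -> \bar R) :
  measurable_fun setT f -> (forall x, 0 <= f x)%E ->
  (\int[mu n.+1]_x f x = \int[leb]_a \int[mu n]_v f (rV_cons (a, v)))%E.
Proof.
move=> mf f0; have mc := @measurable_rV_cons R n.
transitivity (\int[pushforward (leb \x mu n)%E (@rV_cons R n)]_x f x)%E.
  exact: (@eq_measure_integral _ _ _ _ (pushforward (leb \x mu n)%E (@rV_cons R n))).
rewrite ge0_integral_pushforward ?preimage_setT//.
rewrite fubini_tonelli1//; first exact: measurableT_comp.
by move=> p; exact: f0.
Qed.

(** Integrability of every slice ensures that each inner integral is finite, so that [fine] can be
    taken inside the outer integral. *)
Lemma Rintegral_rVS n (f : 'rV[R]_n.+1 -> R) :
  (mu n.+1).-integrable setT (EFin \o f) ->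
  (forall a, (mu n).-integrable setT (EFin \o (fun v => f (rV_cons (a, v))))) ->
  \int[mu n.+1]_x f x = \int[leb]_a \int[mu n]_v f (rV_cons (a, v)).
Proof.
move=> intf intv; have mc := @measurable_rV_cons R n.
have mf : measurable_fun setT f := integrable_measurable intf.
have mfc : measurable_fun setT (EFin \o f \o @rV_cons R n).
  by apply: measurableT_comp => //; exact/measurable_EFinP.
have intfc : (leb \x mu n)%E.-integrable setT (EFin \o f \o @rV_cons R n).
  apply/integrableP; split => //.
  move/integrableP : intf => [_]; rewrite ge0_integral_rVS//; last first.
    by apply: measurableT_comp => //; exact/measurable_EFinP.
  rewrite fubini_tonelli1//; exact: measurableT_comp.
rewrite /Rintegral; congr fine.
transitivity (\int[pushforward (leb \x mu n)%E (@rV_cons R n)]_x (f x)%:E)%E.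
  exact: (@eq_measure_integral _ _ _ _ (pushforward (leb \x mu n)%E (@rV_cons R n))).
rewrite integral_pushforward ?preimage_setT//; last exact/measurable_EFinP.
rewrite -integral12_prod_meas1//; apply: eq_integral => a _.
by rewrite /fubini_F/= fineK//; exact: integrable_fin_num (intv a).
Qed.

Lemma rV_cons_coord0 n (a : R) (v : 'rV[R]_n) : rV_cons (a, v) ord0 ord0 = a.
Proof. by have := rV_consK (a, v) => -[]. Qed.

Lemma rV_cons_coordS n (a : R) (v : 'rV[R]_n) i :
  rV_cons (a, v) ord0 (lift ord0 i) = v ord0 i.
Proof.
rewrite /rV_cons (_ : lift ord0 i = rshift 1 i); last exact: val_inj.
exact: (@row_mxEr _ 1 1 n).
Qed.

Lemma measurable_prod_coord n (w : R -> R) : measurable_fun setT w ->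
  measurable_fun setT (fun x : 'rV[R]_n => \prod_i w (x ord0 i)).
Proof.
move=> mw; apply: measurable_prod => i _.
exact: (measurableT_comp mw (measurable_rV_coord i)).
Qed.

Lemma ge0_integral_prod n (w : R -> R) : measurable_fun setT w ->
  (forall x, 0 <= w x) -> leb.-integrable setT (EFin \o w) ->
  (\int[mu n]_x (\prod_i w (x ord0 i))%:E = ((\int[leb]_x w x) ^+ n)%:E)%E.
Proof.
move=> mw w0 intw; elim: n => [|n IH].
  rewrite integral_dirac// ?diracT ?mul1e ?big_ord0//.
  by apply/measurable_EFinP; exact: measurable_prod_coord.
rewrite ge0_integral_rVS//; last 2 first.
- by apply/measurable_EFinP; exact: measurable_prod_coord.
- by move=> x; rewrite lee_fin prodr_ge0.
under eq_integral => a _.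
  under eq_integral => v _.
    rewrite big_ord_recl rV_cons_coord0.
    under eq_bigr do rewrite rV_cons_coordS.
    rewrite EFinM; over.
  rewrite ge0_integralZl//; last 3 first.
  - by apply/measurable_EFinP; exact: measurable_prod_coord.
  - by move=> v _; rewrite lee_fin prodr_ge0.
  - by rewrite lee_fin.
  rewrite IH; over.
rewrite ge0_integralZr//; last 3 first.
- exact/measurable_EFinP.
- by move=> x _; rewrite lee_fin.
- by rewrite lee_fin exprn_ge0// Rintegral_ge0.
by rewrite integral_EFinE// -EFinM exprS.
Qed.

Lemma integrable_prod n (w : R -> R) : measurable_fun setT w ->
  (forall x, 0 <= w x) -> leb.-integrable setT (EFin \o w) ->
  (mu n).-integrable setT (EFin \o (fun x : 'rV[R]_n => \prod_i w (x ord0 i))).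
Proof.
move=> mw w0 intw; apply/integrableP; split.
  by apply/measurable_EFinP; exact: measurable_prod_coord.
under eq_integral do rewrite /= ger0_norm ?prodr_ge0//.
by rewrite ge0_integral_prod// ltry.
Qed.

Definition gauss_rV n (k : R) (x : 'rV[R]_n) : R := expR (- (k * dot x x)).

Lemma gauss_rV_prod n k (x : 'rV[R]_n) : gauss_rV k x = \prod_i gauss k (x ord0 i).
Proof.
rewrite /gauss_rV /gauss /dot mulr_sumr -sumrN expR_sum.
by apply: eq_bigr => i _; rewrite expr2.
Qed.

Lemma gauss_rV_ge0 n k (x : 'rV[R]_n) : 0 <= gauss_rV k x.
Proof. exact: expR_ge0. Qed.

Lemma measurable_gauss_rV n k : measurable_fun setT (@gauss_rV n k).
Proof.
rewrite (funext (@gauss_rV_prod n k)); apply: measurable_prod_coord.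
exact: measurable_gauss.
Qed.

Lemma integrable_gauss_rV n k : 0 < k ->
  (mu n).-integrable setT (EFin \o @gauss_rV n k).
Proof.
move=> k0; rewrite (funext (@gauss_rV_prod n k)); apply: integrable_prod.
- exact: measurable_gauss.
- exact: gauss_ge0.
- exact: integrable_gauss.
Qed.

Lemma Rintegral_gauss_rV n k : 0 < k ->
  \int[mu n]_x gauss_rV k x = Num.sqrt (pi / k) ^+ n.
Proof.
move=> k0; rewrite /Rintegral; under eq_integral do rewrite gauss_rV_prod.
rewrite ge0_integral_prod//; first by rewrite Rintegral_gauss.
- exact: measurable_gauss.
- exact: gauss_ge0.
- exact: integrable_gauss.
Qed.

Lemma measurable_dot n (y : 'rV[R]_n) : measurable_fun setT (dot y).
Proof.
rewrite /dot; apply: measurable_sum => i; apply: measurable_funM => //.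
exact: measurable_rV_coord.
Qed.

Lemma dotC n (x y : 'rV[R]_n) : dot x y = dot y x.
Proof. by rewrite /dot; apply: eq_bigr => i _; rewrite mulrC. Qed.

Lemma dot_rV_cons n (a c : R) (v w : 'rV[R]_n) :
  dot (rV_cons (a, v)) (rV_cons (c, w)) = a * c + dot v w.
Proof.
rewrite /dot big_ord_recl !rV_cons_coord0; congr (_ + _).
by apply: eq_bigr => i _; rewrite !rV_cons_coordS.
Qed.

Lemma rV_cons_unconsE n (y : 'rV[R]_n.+1) : exists a v, y = rV_cons (a, v).
Proof.
exists (y ord0 ord0), (\row_i y ord0 (lift ord0 i)); apply/rowP => i.
case: (unliftP ord0 i) => [j|] ->; last by rewrite rV_cons_coord0.
by rewrite rV_cons_coordS mxE.
Qed.

Lemma integrable_gauss_rV_bounded n (k M : R) (f : 'rV[R]_n -> R) : 0 < k ->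
  measurable_fun setT f -> (forall x, `|f x| <= M) ->
  (mu n).-integrable setT (EFin \o (fun x => gauss_rV k x * f x)).
Proof.
move=> k0 mf fM; apply: (@integrable_dominated _ _ _ (mu n) _ (fun x => M * gauss_rV k
  x)).
- by apply: measurable_funM => //; exact: measurable_gauss_rV.
- by move=> x; rewrite normrM (ger0_norm (gauss_rV_ge0 _ _)) mulrC ler_wpM2r
  ?gauss_rV_ge0.
- by apply: integrable_scale; exact: integrable_gauss_rV.
Qed.

Lemma measurable_cos_dot n (y : 'rV[R]_n) b :
  measurable_fun setT (fun x => cos (dot y x + b)).
Proof.
apply: (measurableT_comp (@measurable_cos R)).
by apply: measurable_funD => //; exact: measurable_dot.
Qed.

Lemma integrable_gauss_rV_cos n (k b : R) (y : 'rV[R]_n) : 0 < k ->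
  (mu n).-integrable setT (EFin \o (fun x => gauss_rV k x * cos (dot y x + b))).
Proof.
move=> k0; apply: (@integrable_gauss_rV_bounded _ _ 1) => //.
  exact: measurable_cos_dot.
by move=> x; exact: cos_max.
Qed.

(** Induction on n with the phase generalized: for the remaining coordinates, the term c a of the
    first coordinate is part of the phase. The induction hypothesis then leaves cos (c a + b), to be
    integrated in a by the one-dimensional formula. *)
Lemma Rintegral_gauss_rV_cos n (k b : R) (y : 'rV[R]_n) : 0 < k ->
  \int[mu n]_x (gauss_rV k x * cos (dot y x + b)) =
  Num.sqrt (pi / k) ^+ n * expR (- (dot y y / (4 * k))) * cos b.
Proof.
move=> k0; elim: n y b => [|n IH] y b.
  rewrite /Rintegral integral_dirac// ?diracT ?mul1e/=.
    by rewrite /gauss_rV /dot !big_ord0 mul0r mulr0 !oppr0 expR0 expr0 add0r !mul1r.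
  apply/measurable_EFinP; apply: measurable_funM.
    exact: measurable_gauss_rV.
  exact: measurable_cos_dot.
have [c [w ->]] := rV_cons_unconsE y.
have E a v : gauss_rV k (rV_cons (a, v)) * cos (dot (rV_cons (c, w)) (rV_cons (a, v)) +
  b) =
    gauss k a * (gauss_rV k v * cos (dot w v + (c * a + b))).
  rewrite mulrA; congr (_ * cos _); last by rewrite dot_rV_cons; ring.
  by rewrite /gauss_rV /gauss -expRD dot_rV_cons expr2; congr expR; ring.
rewrite Rintegral_rVS//; last 2 first.
- exact: integrable_gauss_rV_cos.
- move=> a; under eq_fun do rewrite E.
  by apply: integrable_scale; exact: integrable_gauss_rV_cos.
have E2 a : \int[mu n]_v (gauss_rV k (rV_cons (a, v)) *
      cos (dot (rV_cons (c, w)) (rV_cons (a, v)) + b)) =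
    Num.sqrt (pi / k) ^+ n * expR (- (dot w w / (4 * k))) *
    (gauss k a * cos (c * a + b)).
  under eq_Rintegral do rewrite E.
  by rewrite RintegralZl ?IH//; [ring|exact: integrable_gauss_rV_cos].
under eq_Rintegral do rewrite E2.
rewrite RintegralZl//; last first.
  apply: (@integrable_gauss_bounded _ _ 1) => //; last by move=> x; exact: cos_max.
  apply: (measurableT_comp (@measurable_cos R)).
  by apply: measurable_funD => //; exact: measurable_funM.
rewrite Rintegral_gauss_cos// dot_rV_cons.
have -> : - ((c * c + dot w w) / (4 * k)) = - (c ^+ 2 / (4 * k)) + - (dot w w / (4 * k)).
  by ring.
by rewrite expRD [X in _ = X * _ * _]exprS; ring.
Qed.

End rV_integrals.

(** * Continuous functions are measurable for the sigma-algebra generated by the coordinates *)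

Section rV_continuous_measurable.
Context {R : realType} {n : nat}.

Let box (q : 'rV[rat]_n * nat) : set 'rV[R]_n :=
  [set x | forall i, `|x ord0 i - ratr (q.1 ord0 i)| < q.2.+1%:R^-1].

Let measurable_box q : measurable (box q).
Proof.
rewrite (_ : box q = \bigcap_(i in [set: 'I_n])
    (rV_coord i @^-1` [set y : R | `|y - ratr (q.1 ord0 i)| < q.2.+1%:R^-1])); last first.
  by apply/seteqP; split => x /= bx i; [move=> _; exact: bx|exact: bx].
apply: fin_bigcap_measurable => [|i _]; first exact: finite_finset.
rewrite -[X in measurable X]setTI; apply: measurable_rV_coord => //.
have -> : [set y : R | `|y - ratr (q.1 ord0 i)| < q.2.+1%:R^-1] =
    (fun y => `|y - ratr (q.1 ord0 i)|) @^-1` `]-oo, q.2.+1%:R^-1[%classic.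
  by apply/seteqP; split => y /=; rewrite in_itv.
rewrite -[X in measurable X]setTI.
have : measurable_fun setT (fun y : R => `|y - ratr (q.1 ord0 i)|).
  by apply: measurableT_comp => //; exact: measurable_funB.
exact.
Qed.

Lemma open_measurable_rV (U : set 'rV[R]_n) : open U -> measurable U.
Proof.
move=> oU.
pose F (q : 'rV[rat]_n * nat) : set 'rV[R]_n := [set x | box q x /\ box q `<=` U].
have -> : U = \bigcup_q F q.
  apply/seteqP; split => [x Ux|x [q _ [bx]]]; last exact.
  have /nbhs_ballP[e /= e0 eU] : nbhs x U by exact: open_nbhs_nbhs.
  (* A box of radius 1/(k+1) around a rational point near x contains only points within 2/(k+1) of
     x, hence the factor 2. *)
  have [k ke] : exists k : nat, 2 / k.+1%:R < e.
    have : \forall k \near \oo, 2 * harmonic k < e.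
      have : 2 * harmonic k @[k --> \oo] --> (0 : R).
        rewrite -(mulr0 (2 : R)); apply: cvgM; first exact: cvg_cst.
        exact: cvg_harmonic.
      by move=> /cvgr_lt; apply.
    by move=> [k _ /(_ k (leqnn k))]; exists k.
  have k0 : (0 : R) < k.+1%:R^-1 by rewrite invr_gt0.
  have qi i : {q : rat | `|x ord0 i - ratr q| < k.+1%:R^-1}.
    apply: cid; have /rat_in_itvoo[q] : x ord0 i < x ord0 i + k.+1%:R^-1 by rewrite ltrDl.
    rewrite in_itv/= => /andP[q1 q2]; exists q.
    by rewrite distrC gtr0_norm ?subr_gt0// ltrBlDl.
  exists (\row_i sval (qi i), k) => //; split.
    by move=> i /=; rewrite mxE; exact: (svalP (qi i)).
  move=> y /= bq; apply: eU; split => // i j; rewrite (ord1 i) /ball/=.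
  have := bq j; rewrite /= mxE => hy; have hx := svalP (qi j).
  rewrite (le_lt_trans _ ke)// -[X in X / _]/(1 + 1) mulrDl !mul1r.
  rewrite (le_trans (ler_distD (ratr (sval (qi j))) _ _))// lerD ?(ltW hx)//.
  by rewrite distrC ltW.
apply: countable_bigcupT_measurable; first exact: countableP.
move=> q; have [sub|nsub] := pselect (box q `<=` U).
  by rewrite (_ : F q = box q)//; apply/seteqP; split => x // [].
by rewrite (_ : F q = set0)//; apply/seteqP; split => x // [].
Qed.

Lemma continuous_measurable_rV (f : 'rV[R]_n -> R) :
  continuous f -> measurable_fun setT f.
Proof.
move=> cf; apply: (measurability _ (RGenOInfty.measurableE R)) => //.
move=> _ [_ [a ->] <-]; rewrite setTI; apply: open_measurable_rV.
by apply: open_comp => [x _|]; [exact: cf|exact: interval_open].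
Qed.

End rV_continuous_measurable.

(** * Schwartz functions and their Fourier transforms *)

Section schwartz_space.
Context {R : realType} {d : nat}.
Local Notation E := 'rV[R]_d.
Local Notation mu := (@lebesgue_rV R d).
Implicit Types (f g p q : E -> R) (x y : E) (alpha : seq 'I_d) (beta : 'I_d -> nat).

Lemma schwartz_differentiable f alpha x :
  schwartz f -> differentiable (iter_partial alpha f) x.
Proof. by move=> /(_ alpha)[]. Qed.

Lemma schwartz_continuous f : schwartz f -> continuous f.
Proof.
move=> sf x; apply: differentiable_continuous.
exact: (schwartz_differentiable [::] x sf).
Qed.

Lemma schwartz_measurable f : schwartz f -> measurable_fun setT f.
Proof. by move=> sf; apply: continuous_measurable_rV; exact: schwartz_continuous. Qed.

Lemma iter_partial_lin (a : R) f g alpha : schwartz f -> schwartz g ->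
  iter_partial alpha (a *: f + g) = a *: iter_partial alpha f + iter_partial alpha g.
Proof.
move=> sf sg; elim: alpha => [//|i alpha IH] /=.
rewrite [X in partial i X]IH; apply/funext => x.
have df : derivable (iter_partial alpha f) x (delta_mx ord0 i).
  by apply: diff_derivable; exact: schwartz_differentiable.
have dg : derivable (iter_partial alpha g) x (delta_mx ord0 i).
  by apply: diff_derivable; exact: schwartz_differentiable.
by rewrite /partial (deriveD (derivableZ (k := a) df) dg) deriveZ.
Qed.

Lemma schwartz_lin (a : R) f g : schwartz f -> schwartz g -> schwartz (a *: f + g).
Proof.
move=> sf sg alpha; rewrite iter_partial_lin//; split => [x|beta].
  apply: differentiableD; last exact: schwartz_differentiable.
  by apply: differentiableZ; exact: schwartz_differentiable.
have [_ /(_ beta)[C fC]] := sf alpha; have [_ /(_ beta)[D gD]] := sg alpha.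
exists (`|a| * C + D) => x.
have -> : monomial beta x * (a *: iter_partial alpha f + iter_partial alpha g) x =
    a * (monomial beta x * iter_partial alpha f x) + monomial beta x * iter_partial
      alpha g x.
  by rewrite /= -[(_ + _) x]/(a * _ + _) mulrDr mulrCA.
by rewrite (le_trans (ler_normD _ _))// lerD// normrM ler_wpM2l.
Qed.

Lemma monomial0 x : monomial (fun=> 0%N) x = 1.
Proof. by rewrite /monomial big1. Qed.

Lemma measurable_monomial beta : measurable_fun setT (@monomial R d beta).
Proof.
apply: measurable_prod => i _; apply: measurable_funX.
exact: measurable_rV_coord.
Qed.

(** The seminorms bound monomials only. Multiplying by 1 + x_i^2 adds the bounds for the exponents
    beta and beta + 2 e_i, so the product is absorbed one coordinate at a time. *)
Lemma schwartz_decay f beta : schwartz f -> exists C : R, forall x,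
  `|monomial beta x * f x| <= C * \prod_i (1 + x ord0 i ^+ 2)^-1.
Proof.
move=> sf.
have p0 x i : 0 < 1 + x ord0 i ^+ 2 :> R by rewrite ltr_pwDl// sqr_ge0.
suff [C HC] : exists C : R, forall x,
    (\prod_i (1 + x ord0 i ^+ 2)) * `|monomial beta x * f x| <= C.
  exists C => x; rewrite prodfV ler_pdivlMr; last by apply: prodr_gt0 => i _.
  by rewrite mulrC.
elim: (index_enum _) beta => [|i l IH] beta.
  have [_ /(_ beta)[C HC]] := sf [::].
  by exists C => x; rewrite big_nil mul1r; exact: HC.
have [C1 H1] := IH beta.
have [C2 H2] := IH (fun j => beta j + 2 * (j == i))%N.
exists (C1 + C2) => x; rewrite big_cons mulrDl mul1r mulrDl lerD//.
apply: le_trans (H2 x); rewrite le_eqVlt; apply/orP; left; apply/eqP.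
rewrite mulrAC mulrC; congr (_ * _).
rewrite -[X in X * _ = _]ger0_norm ?sqr_ge0// -normrM mulrA; congr (`|_ * _|).
rewrite /monomial (bigD1 i)//= [RHS](bigD1 i)//= eqxx muln1 exprD mulrA.
rewrite [X in X * _ = _]mulrC; congr (_ * _); apply: eq_bigr => j /negbTE ->.
by rewrite muln0 addn0.
Qed.

Lemma schwartz_monomial_integrable f beta : schwartz f ->
  mu.-integrable setT (EFin \o (fun x => monomial beta x * f x)).
Proof.
move=> sf; have [C HC] := schwartz_decay beta sf.
have i0 (x : R) : 0 <= (1 + x ^+ 2)^-1 by rewrite invr_ge0 addr_ge0 ?sqr_ge0.
apply: (@integrable_dominated _ _ _ mu _ (fun x => C * \prod_i (1 + x ord0 i ^+ 2)^-1))
  => //.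
- by apply: measurable_funM; [exact: measurable_monomial|exact: schwartz_measurable].
- apply: integrable_scale; apply: (@integrable_prod _ _ (fun x : R => (1 + x ^+ 2)^-1))
  => //.
    exact: integrable_measurable integrable_inv_1sqr.
  exact: integrable_inv_1sqr.
Qed.

Lemma schwartz_integrable f : schwartz f -> mu.-integrable setT (EFin \o f).
Proof.
move=> sf; have := schwartz_monomial_integrable (fun=> 0%N) sf.
by apply: eq_integrable => // x _ /=; rewrite monomial0 mul1r.
Qed.

Lemma schwartz_integrable_bounded f g (M : R) : schwartz f ->
  measurable_fun setT g -> (forall x, `|g x| <= M) ->
  mu.-integrable setT (EFin \o (fun x => f x * g x)).
Proof.
move=> sf mg gM.
apply: (@integrable_dominated _ _ _ mu _ (fun x => M * `|f x|)) => //.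
- by apply: measurable_funM => //; exact: schwartz_measurable.
- by move=> x; rewrite normrM mulrC ler_wpM2r.
- by apply: integrable_scale; apply: integrable_norm; exact: schwartz_integrable.
Qed.

Lemma schwartz_moment0_lin (H a : R) f g : schwartz_moment0 H f ->
  schwartz_moment0 H g -> schwartz_moment0 H (a *: f + g).
Proof.
move=> [sf f0] [sg g0]; split; first exact: schwartz_lin.
move=> beta bH.
have E x : monomial beta x * (a *: f + g) x =
    a * (monomial beta x * f x) + monomial beta x * g x.
  by rewrite -[(_ + _) x]/(a * _ + _) mulrDr mulrCA.
under eq_Rintegral do rewrite E.
have i1 := schwartz_monomial_integrable beta sf.
have i2 := schwartz_monomial_integrable beta sg.
rewrite RintegralD//; last exact: (integrable_scale a i1).
by rewrite RintegralZl// f0// g0// mulr0 addr0.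
Qed.

(* Polynomial functions: the derivatives of [expR \o q], q polynomial, are
   multiples of it by such functions. *)
Inductive polyfun : (E -> R) -> Prop :=
| polyfun_cst c : polyfun (fun=> c)
| polyfun_coord i : polyfun (fun x => x ord0 i)
| polyfun_add p q : polyfun p -> polyfun q -> polyfun (fun x => p x + q x)
| polyfun_mul p q : polyfun p -> polyfun q -> polyfun (fun x => p x * q x).

Lemma polyfun_sum (I : Type) (s : seq I) (F : I -> E -> R) :
  (forall i, polyfun (F i)) -> polyfun (fun x => \sum_(i <- s) F i x).
Proof.
move=> pF; elim: s => [|i s IH].
  by rewrite (_ : (fun x => _) = fun=> 0); [exact: polyfun_cst|apply/funext => x;
    rewrite big_nil].
rewrite (_ : (fun x => _) = fun x => F i x + \sum_(j <- s) F j x).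
  exact: polyfun_add.
by apply/funext => x; rewrite big_cons.
Qed.

Lemma polyfun_prod (I : Type) (s : seq I) (F : I -> E -> R) :
  (forall i, polyfun (F i)) -> polyfun (fun x => \prod_(i <- s) F i x).
Proof.
move=> pF; elim: s => [|i s IH].
  by rewrite (_ : (fun x => _) = fun=> 1); [exact: polyfun_cst|apply/funext => x;
    rewrite big_nil].
rewrite (_ : (fun x => _) = fun x => F i x * \prod_(j <- s) F j x).
  exact: polyfun_mul.
by apply/funext => x; rewrite big_cons.
Qed.

Lemma polyfun_exp p n : polyfun p -> polyfun (fun x => p x ^+ n).
Proof.
move=> pp; elim: n => [|n IH]; first exact: polyfun_cst.
rewrite (_ : (fun x => _) = fun x => p x * p x ^+ n); first exact: polyfun_mul.
by apply/funext => x; rewrite exprS.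
Qed.

Lemma polyfun_differentiable p x : polyfun p -> differentiable p x.
Proof.
elim=> [c|i|f g _ df _ dg|f g _ df _ dg].
- exact: differentiable_cst.
- exact: differentiable_coord.
- exact: differentiableD.
- exact: differentiableM.
Qed.

Lemma polyfun_partial i p : polyfun p -> polyfun (partial i p).
Proof.
elim=> [c|j|f g pf df pg dg|f g pf df pg dg].
- rewrite (_ : partial i _ = fun=> 0); first exact: polyfun_cst.
  by apply/funext => x; rewrite /partial derive_cst.
- rewrite (_ : partial i _ = fun=> (delta_mx ord0 i : E) ord0 j);
  first exact: polyfun_cst.
  apply/funext => x; apply/cvg_lim => //; apply: cvg_near_cst; near=> h.
  rewrite /= !mxE addrK /GRing.scale/= mulKf//.
  by near: h; exact: nbhs_dnbhs_neq.
- rewrite (_ : partial i _ = fun x => partial i f x + partial i g x);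
  first exact: polyfun_add.
  apply/funext => x; rewrite /partial deriveD//; apply: diff_derivable;
    exact: polyfun_differentiable.
- rewrite (_ : partial i _ = fun x => f x * partial i g x + g x * partial i f x).
    by apply: polyfun_add; exact: polyfun_mul.
  apply/funext => x; rewrite /partial deriveM//; apply: diff_derivable;
    exact: polyfun_differentiable.
Unshelve. all: end_near. Qed.

(** The exponent [e] is arbitrary so that a product can be split with e/2 for each factor, and so
    that the growth stays below the decay of a given Gaussian. *)
Lemma polyfun_growth p : polyfun p -> forall e : R, 0 < e ->
  exists C : R, forall x, `|p x| <= C * expR (e * dot x x).
Proof.
have d0 x : 0 <= dot x x by rewrite /dot sumr_ge0// => i _; rewrite -expr2 sqr_ge0.
elim=> [c|i|f g pf Hf pg Hg|f g pf Hf pg Hg] e e0.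
- exists `|c| => x; rewrite ler_peMr// -expR0 ler_expR.
  by rewrite mulr_ge0// ltW.
- exists (1 + e^-1) => x.
  have xi : x ord0 i ^+ 2 <= dot x x.
    by rewrite /dot (bigD1 i)//= -expr2 lerDl sumr_ge0// => j _; rewrite -expr2 sqr_ge0.
  have h1 : `|x ord0 i| <= 1 + dot x x.
    apply: le_trans (_ : 1 + x ord0 i ^+ 2 <= _); last by rewrite lerD2l.
    by rewrite -(real_normK (num_real (x ord0 i))); have := normr_ge0 (x ord0 i); nra.
  have h2 : 1 + e * dot x x <= expR (e * dot x x) by exact: expR_ge1Dx.
  have h3 : dot x x <= e^-1 * expR (e * dot x x).
    by rewrite ler_pdivlMl//; lra.
  have h4 : 1 <= expR (e * dot x x) by rewrite -expR0 ler_expR mulr_ge0// ltW.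
  rewrite mulrDl mul1r; lra.
- have [C HC] := Hf e e0; have [D HD] := Hg e e0.
  by exists (C + D) => x; rewrite mulrDl (le_trans (ler_normD _ _))// lerD.
- have e2 : 0 < e / 2 by rewrite divr_gt0.
  have [C HC] := Hf _ e2; have [D HD] := Hg _ e2.
  exists (C * D) => x; rewrite normrM.
  have -> : expR (e * dot x x) = expR (e / 2 * dot x x) * expR (e / 2 * dot x x).
    by rewrite -expRD; congr expR; field.
  by rewrite mulrACA ler_pM.
Qed.

Lemma iter_partial_polyexp q alpha p : polyfun q -> polyfun p ->
  exists2 r, polyfun r &
    iter_partial alpha (fun x => p x * expR (q x)) = fun x => r x * expR (q x).
Proof.
move=> pq; elim: alpha p => [|i alpha IH] p pp; first by exists p.
have [r pr rE] := IH p pp.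
exists (fun x => partial i r x + r x * partial i q x).
  apply: polyfun_add; first exact: polyfun_partial.
  by apply: polyfun_mul => //; exact: polyfun_partial.
rewrite /= [X in partial i X]rE; apply/funext => x.
have dr := polyfun_differentiable x pr; have dq := polyfun_differentiable x pq.
have de : differentiable (expR : R -> R) (q x).
  exact/derivable1_diffP/derivable_expR.
have deq : differentiable (expR \o q) x by exact: differentiable_comp.
have Deq : 'D_(delta_mx ord0 i) (expR \o q) x = expR (q x) * partial i q x.
  rewrite deriveE// diff_comp//= /partial deriveE// diff1E//.
  by rewrite derive1E derive_val /GRing.scale/= mulrC.
rewrite /partial -[fun x => r x * _]/(r * (expR \o q)) deriveM; last 2 first.
- exact: diff_derivable.
- exact: diff_derivable.
by rewrite Deq /partial /GRing.scale/=; ring.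
Qed.

Definition gauss_at (k : R) (b x : E) : R := gauss_rV k (x - b).

Lemma dotBB x y : dot (x - y) (x - y) = dot x x - 2 * dot x y + dot y y.
Proof.
rewrite /dot mulr_sumr -sumrB -big_split/=; apply: eq_bigr => i _.
by rewrite !mxE; ring.
Qed.

Lemma dot_ge0 x : 0 <= dot x x.
Proof. by rewrite /dot sumr_ge0// => i _; rewrite -expr2 sqr_ge0. Qed.

Lemma polyfun_dotBB k b : polyfun (fun x => - (k * dot (x - b) (x - b))).
Proof.
rewrite (_ : (fun x => _) = fun x => - k * \sum_i (x ord0 i + - b ord0 i) ^+ 2).
  apply: polyfun_mul; first exact: polyfun_cst.
  apply: polyfun_sum => i; apply: polyfun_exp.
  by apply: polyfun_add; [exact: polyfun_coord|exact: polyfun_cst].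
apply/funext => x; rewrite mulNr /dot; congr (- (_ * _)).
by apply: eq_bigr => i _; rewrite !mxE expr2.
Qed.

Lemma schwartz_gauss_at k b : 0 < k -> schwartz (gauss_at k b).
Proof.
move=> k0 alpha; set q := fun x => - (k * dot (x - b) (x - b)).
have pq : polyfun q by exact: polyfun_dotBB.
have [r pr] := @iter_partial_polyexp q alpha (fun=> 1) pq (polyfun_cst 1).
rewrite (_ : (fun x => _) = gauss_at k b); last first.
  by apply/funext => x; rewrite mul1r.
move=> ->; split => [x|beta].
  apply: differentiableM; first exact: polyfun_differentiable.
  apply: differentiable_comp; first exact: polyfun_differentiable.
  exact/derivable1_diffP/derivable_expR.
have pm : polyfun (fun x => monomial beta x * r x).
  apply: polyfun_mul => //; apply: polyfun_prod => i; apply: polyfun_exp.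
  exact: polyfun_coord.
have k2 : 0 < k / 2 by rewrite divr_gt0.
have [C HC] := polyfun_growth pm k2.
exists (C * expR (k * dot b b)) => x; rewrite mulrA normrM (ger0_norm (expR_ge0 _)).
apply: (@le_trans _ _ (C * expR (k / 2 * dot x x) * expR (q x))).
  by rewrite ler_wpM2r ?expR_ge0.
have C0 : 0 <= C.
  have := le_trans (normr_ge0 _) (HC 0); rewrite pmulr_lge0//; exact: expR_gt0.
rewrite -mulrA -expRD ler_wpM2l// ler_expR /q dotBB.
(* This is |x - b|^2 >= |x|^2/2 - |b|^2 in disguise: half of the Gaussian exponent survives
   recentring, at the price of the factor exp (k |b|^2) in the witness. *)
have : 0 <= dot (x - 2 *: b) (x - 2 *: b) by exact: dot_ge0.
have -> : dot (x - 2 *: b) (x - 2 *: b) = dot x x - 4 * dot x b + 4 * dot b b.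
  rewrite /dot !mulr_sumr -sumrB -big_split/=; apply: eq_bigr => i _.
  by rewrite !mxE; ring.
nra.
Qed.

End schwartz_space.

(** * Translation invariance in several dimensions *)

Section rV_translation.
Context {R : realType}.
Local Notation leb := (@lebesgue_measure R).
Local Notation mu := (@lebesgue_rV R).

Lemma rV_cons_add n (a b : R) (v w : 'rV[R]_n) :
  rV_cons (a, v) + rV_cons (b, w) = rV_cons (a + b, v + w).
Proof.
apply/rowP => i; rewrite mxE; case: (unliftP ord0 i) => [j|] ->.
  by rewrite !rV_cons_coordS mxE.
by rewrite !rV_cons_coord0.
Qed.

Lemma measurable_rV_translation n (b : 'rV[R]_n) :
  measurable_fun setT (fun x : 'rV[R]_n => x + b).
Proof.
apply: measurable_fun_rV => i.
rewrite (_ : _ \o _ = fun x => rV_coord i x + b ord0 i).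
  by apply: measurable_funD => //; exact: measurable_rV_coord.
by apply/funext => x; rewrite /rV_coord /= mxE.
Qed.

Lemma ge0_integral_rV_translation n (b : 'rV[R]_n) (f : 'rV[R]_n -> \bar R) :
  measurable_fun setT f -> (forall x, 0 <= f x)%E ->
  (\int[mu n]_x f (x + b)%R = \int[mu n]_x f x)%E.
Proof.
elim: n b f => [|n IH] b f mf f0.
  by apply: eq_integral => x _; congr f; apply/rowP => -[].
have [c [w ->]] := rV_cons_unconsE b.
rewrite ge0_integral_rVS//; last first.
  by apply: measurableT_comp => //; exact: measurable_rV_translation.
have mfc : measurable_fun setT (f \o @rV_cons R n).
  by apply: measurableT_comp => //; exact: measurable_rV_cons.
pose F (a : R) : \bar R := (\int[mu n]_v f (rV_cons (a, v)))%E.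
have mF : measurable_fun setT F.
  exact: (@measurable_fun_fubini_tonelli_F _ _ _ _ _ (mu n) _ mfc (fun p => f0 _)).
have F0 a : (0 <= F a)%E by exact: integral_ge0.
transitivity (\int[leb]_a F (a + c)%R)%E; last first.
  by rewrite (ge0_integral_translation c mF F0) ge0_integral_rVS.
apply: eq_integral => a _; rewrite /F -[RHS](IH w).
- by apply: eq_integral => v _; rewrite rV_cons_add.
- by apply: (measurableT_comp mfc); exact: measurable_pair1.
- by move=> v; exact: f0.
Qed.

Lemma Rintegral_rV_translation n (b : 'rV[R]_n) (f : 'rV[R]_n -> R) :
  measurable_fun setT f -> \int[mu n]_x f (x + b) = \int[mu n]_x f x.
Proof.
move=> mf; rewrite /Rintegral; congr fine; rewrite integralE [RHS]integralE.
have mEf : measurable_fun setT (EFin \o f) by exact/measurable_EFinP.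
congr (_ - _)%E.
  rewrite -(ge0_integral_rV_translation b (measurable_funepos mEf) (funepos_ge0 _)).
  by apply: eq_integral => x _; rewrite !funeposE.
rewrite -(ge0_integral_rV_translation b (measurable_funeneg mEf) (funeneg_ge0 _)).
by apply: eq_integral => x _; rewrite !funenegE.
Qed.

Lemma dotDr n (x y z : 'rV[R]_n) : dot x (y + z) = dot x y + dot x z.
Proof.
by rewrite /dot -big_split/=; apply: eq_bigr => i _; rewrite mxE mulrDr.
Qed.

Lemma dotDl n (x y z : 'rV[R]_n) : dot (y + z) x = dot y x + dot z x.
Proof. by rewrite dotC dotDr ![dot x _]dotC. Qed.

Lemma dotNr n (x y : 'rV[R]_n) : dot x (- y) = - dot x y.
Proof.
by rewrite /dot -sumrN; apply: eq_bigr => i _; rewrite mxE mulrN.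
Qed.

Lemma dotNl n (x y : 'rV[R]_n) : dot (- y) x = - dot y x.
Proof. by rewrite dotC dotNr dotC. Qed.

Lemma dot0r n (x : 'rV[R]_n) : dot x 0 = 0.
Proof. by rewrite /dot big1// => i _; rewrite mxE mulr0. Qed.

Lemma dot0l n (x : 'rV[R]_n) : dot 0 x = 0.
Proof. by rewrite dotC dot0r. Qed.

Lemma measurable_gauss_at n (k : R) (b : 'rV[R]_n) : measurable_fun setT (gauss_at k b).
Proof.
have h1 := @measurable_gauss_rV R n k; have h2 := measurable_rV_translation (- b).
exact (measurableT_comp h1 h2).
Qed.

Lemma Rintegral_gauss_at_cos n (k c : R) (b y : 'rV[R]_n) : 0 < k ->
  \int[mu n]_x (gauss_at k b x * cos (dot y x + c)) =
  Num.sqrt (pi / k) ^+ n * expR (- (dot y y / (4 * k))) * cos (dot y b + c).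
Proof.
move=> k0; rewrite -(@Rintegral_rV_translation _ b); last first.
  by apply: measurable_funM; [exact: measurable_gauss_at|exact: measurable_cos_dot].
under eq_Rintegral do rewrite /gauss_at addrK dotDr -addrA.
by rewrite Rintegral_gauss_rV_cos.
Qed.

End rV_translation.

Section fourier_theory.
Context {R : realType} {d : nat}.
Local Notation E := 'rV[R]_d.
Local Notation mu := (@lebesgue_rV R d).
Implicit Types (f : E -> R) (x y xi : E) (g h : E -> R[i]).

Definition fourier_cst : R := (2 * pi) `^ (- (d%:R / 2)).

Lemma fourier_cst_gt0 : 0 < fourier_cst.
Proof. by rewrite powR_gt0// mulr_gt0// pi_gt0. Qed.

(** Real and imaginary parts are both put in the form of a cosine integral, with phase 0 and pi/2,
    so that each later computation is done once for an arbitrary phase. *)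
Lemma Re_fourier f xi :
  complex.Re (fourier f xi) = fourier_cst * \int[mu]_x (f x * cos (dot xi x + 0)).
Proof.
rewrite /fourier /= mul0r subr0; congr (_ * _).
by apply: eq_Rintegral => x _; rewrite /= mul0r subr0 cosN dotC addr0.
Qed.

Lemma Im_fourier f xi : complex.Im (fourier f xi) =
  fourier_cst * \int[mu]_x (f x * cos (dot xi x + pi / 2)).
Proof.
rewrite /fourier /= mul0r addr0; congr (_ * _).
apply: eq_Rintegral => x _; rewrite /= mul0r addr0 sinN dotC.
by rewrite cosDpihalf.
Qed.

Lemma measurable_Rintegral_param (F : E * E -> R) : measurable_fun setT F ->
  measurable_fun setT (fun xi => \int[mu]_x F (xi, x)).
Proof.
move=> mF; have mEF : measurable_fun setT (EFin \o F) by exact/measurable_EFinP.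
rewrite /Rintegral; apply: (measurableT_comp (fine_measurable measurableT)).
rewrite (_ : (fun xi => _) = fun xi =>
    (fubini_F mu (EFin \o F)^\+ xi - fubini_F mu (EFin \o F)^\- xi)%E).
  apply: emeasurable_funB; apply: measurable_fun_fubini_tonelli_F.
  - exact: measurable_funepos.
  - exact: funepos_ge0.
  - exact: measurable_funeneg.
  - exact: funeneg_ge0.
apply/funext => xi; rewrite integralE /fubini_F; congr (_ - _)%E.
  by apply: eq_integral => x _; rewrite !funeposE.
by apply: eq_integral => x _; rewrite !funenegE.
Qed.

Lemma measurable_fourier f : measurable_fun setT f -> cmeasurable (fourier f).
Proof.
move=> mf.
have mc (c : R) : measurable_fun setT (fun p : E * E => f p.2 * cos (dot p.1 p.2 + c)).
  apply: measurable_funM; first exact: (measurableT_comp mf measurable_snd).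
  apply: (measurableT_comp (@measurable_cos R)); apply: measurable_funD => //.
  apply: measurable_sum => i; apply: measurable_funM.
    exact: (measurableT_comp (measurable_rV_coord i) measurable_fst).
  exact: (measurableT_comp (measurable_rV_coord i) measurable_snd).
split.
  rewrite (funext (Re_fourier f)); apply: measurable_funM => //.
  exact: (measurable_Rintegral_param (mc 0)).
rewrite (funext (Im_fourier f)); apply: measurable_funM => //.
exact: (measurable_Rintegral_param (mc (pi / 2))).
Qed.

Lemma schwartz_cos_integrable f y c : schwartz f ->
  mu.-integrable setT (EFin \o (fun x => f x * cos (dot y x + c))).
Proof.
move=> sf; apply: (@schwartz_integrable_bounded _ _ _ _ 1) => //.
  exact: measurable_cos_dot.
by move=> x; exact: cos_max.
Qed.

Lemma fourier_lin (a : R) f1 f2 xi : schwartz f1 -> schwartz f2 ->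
  fourier (a *: f1 + f2) xi = a%:C%C * fourier f1 xi + fourier f2 xi.
Proof.
move=> s1 s2.
have L c : \int[mu]_x ((a *: f1 + f2) x * cos (dot xi x + c)) =
    a * \int[mu]_x (f1 x * cos (dot xi x + c)) + \int[mu]_x (f2 x * cos (dot xi x + c)).
  rewrite -RintegralZl//; last exact: schwartz_cos_integrable.
  rewrite -RintegralD//; last 2 first.
  - by apply: integrable_scale; exact: schwartz_cos_integrable.
  - exact: schwartz_cos_integrable.
  apply: eq_Rintegral => x _.
  by rewrite -[(_ + _) x]/(a * f1 x + f2 x) mulrDl mulrA.
apply/eqP; rewrite eq_complex; apply/andP; split; apply/eqP.
  rewrite Re_fourier L mulrDr mulrCA -!Re_fourier.
  by case: (fourier f1 xi) => ? ?; case: (fourier f2 xi) => ? ? /=; ring.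
rewrite Im_fourier L mulrDr mulrCA -!Im_fourier.
by case: (fourier f1 xi) => ? ?; case: (fourier f2 xi) => ? ? /=; ring.
Qed.

Lemma normc_sqr (z : R[i]) :
  ComplexField.Normc.normc z ^+ 2 = complex.Re z ^+ 2 + complex.Im z ^+ 2.
Proof. by case: z => a b /=; rewrite sqr_sqrtr// addr_ge0 ?sqr_ge0. Qed.

Lemma normc_sqr_add_le (z w : R[i]) : ComplexField.Normc.normc (z + w) ^+ 2 <=
  2 * ComplexField.Normc.normc z ^+ 2 + 2 * ComplexField.Normc.normc w ^+ 2.
Proof.
rewrite !normc_sqr; case: z => a b; case: w => c e /=.
have := sqr_ge0 (a - c); have := sqr_ge0 (b - e); nra.
Qed.

Definition fgf_weight (s : R) xi : R := enorm xi `^ (- (2 * s)).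

Lemma fgf_weight_ge0 s xi : 0 <= fgf_weight s xi.
Proof. exact: powR_ge0. Qed.

Lemma measurable_enorm : measurable_fun setT (@enorm R d).
Proof.
have mdot : measurable_fun setT (fun x : E => dot x x).
  apply: measurable_sum => i.
  by apply: measurable_funM; exact: measurable_rV_coord.
apply: (@measurableT_comp _ _ _ _ _ _ (@Num.sqrt R) _ (fun x : E => dot x x)) => //.
by apply: continuous_measurable_fun; exact: sqrt_continuous.
Qed.

Lemma measurable_fgf_weight s : measurable_fun setT (fgf_weight s).
Proof. exact: (measurableT_comp (measurable_powR _) measurable_enorm). Qed.

Lemma cmeasurable_sqnorm g : cmeasurable g ->
  measurable_fun setT (fun xi => ComplexField.Normc.normc (g xi) ^+ 2).
Proof.
move=> [mR mI]; under eq_fun do rewrite normc_sqr.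
by apply: measurable_funD; exact: measurable_funX.
Qed.

Lemma measurable_weighted s g : cmeasurable g -> measurable_fun setT
  (fun xi => fgf_weight s xi * ComplexField.Normc.normc (g xi) ^+ 2).
Proof.
move=> mg; apply: measurable_funM; first exact: measurable_fgf_weight.
exact: cmeasurable_sqnorm.
Qed.

Lemma emeasurable_weighted s g : cmeasurable g -> measurable_fun setT
  (fun xi => (enorm xi `^ (- (2 * s)) * ComplexField.Normc.normc (g xi) ^+ 2)%:E).
Proof. by move=> mg; apply/measurable_EFinP; exact: measurable_weighted. Qed.

Lemma weighted_sqnorm_ge0 s g : (0 <= weighted_sqnorm s g)%E.
Proof. by apply: integral_ge0 => xi _; rewrite lee_fin mulr_ge0 ?powR_ge0 ?sqr_ge0. Qed.

Lemma cmeasurableD g h : cmeasurable g -> cmeasurable h ->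
  cmeasurable (fun xi => g xi + h xi).
Proof.
move=> [gR gI] [hR hI]; split.
  rewrite (_ : (fun _ => _) = fun xi => complex.Re (g xi) + complex.Re (h xi)).
    exact: measurable_funD.
  by apply/funext => xi; case: (g xi) => ? ?; case: (h xi).
rewrite (_ : (fun _ => _) = fun xi => complex.Im (g xi) + complex.Im (h xi)).
  exact: measurable_funD.
by apply/funext => xi; case: (g xi) => ? ?; case: (h xi).
Qed.

Lemma cmeasurableN g : cmeasurable g -> cmeasurable (fun xi => - g xi).
Proof.
move=> [gR gI]; split.
  rewrite (_ : (fun _ => _) = fun xi => - complex.Re (g xi)).
    exact: measurableT_comp.
  by apply/funext => xi; case: (g xi).
rewrite (_ : (fun _ => _) = fun xi => - complex.Im (g xi)).
  exact: measurableT_comp.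
by apply/funext => xi; case: (g xi).
Qed.

Lemma cmeasurableB g h : cmeasurable g -> cmeasurable h ->
  cmeasurable (fun xi => g xi - h xi).
Proof. by move=> mg mh; apply: cmeasurableD => //; exact: cmeasurableN. Qed.

Lemma weighted_sqnormN s g : weighted_sqnorm s (fun xi => - g xi) = weighted_sqnorm s g.
Proof.
apply: eq_integral => xi _; rewrite !normc_sqr; case: (g xi) => a b /=.
by rewrite !sqrrN.
Qed.

(** The pointwise bound |z + w|^2 <= 2|z|^2 + 2|w|^2 replaces the triangle inequality: no square
    roots, and enough for convergence to 0. *)
Lemma weighted_sqnorm_add_le s g h : cmeasurable g -> cmeasurable h ->
  (weighted_sqnorm s (fun xi => g xi + h xi)%R <=
   2%:E * weighted_sqnorm s g + 2%:E * weighted_sqnorm s h)%E.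
Proof.
move=> mg mh; rewrite /weighted_sqnorm -!ge0_integralZl//; first last.
- by move=> xi _; rewrite lee_fin mulr_ge0 ?powR_ge0 ?sqr_ge0.
- exact: emeasurable_weighted.
- by move=> xi _; rewrite lee_fin mulr_ge0 ?powR_ge0 ?sqr_ge0.
- exact: emeasurable_weighted.
rewrite -ge0_integralD//; first last.
- by apply: emeasurable_funM => //; exact: emeasurable_weighted.
- by move=> xi _; rewrite mule_ge0// lee_fin mulr_ge0 ?powR_ge0 ?sqr_ge0.
- by apply: emeasurable_funM => //; exact: emeasurable_weighted.
- by move=> xi _; rewrite mule_ge0// lee_fin mulr_ge0 ?powR_ge0 ?sqr_ge0.
apply: ge0_le_integral => //.
- by move=> xi _; rewrite lee_fin mulr_ge0 ?powR_ge0 ?sqr_ge0.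
- by apply: emeasurable_weighted; exact: cmeasurableD.
- apply: emeasurable_funD.
    by apply: emeasurable_funM => //; exact: emeasurable_weighted.
  by apply: emeasurable_funM => //; exact: emeasurable_weighted.
- move=> xi _; rewrite -!EFinM -EFinD lee_fin.
  rewrite [X in _ <= X + _]mulrCA [X in _ <= _ + X]mulrCA -mulrDr ler_wpM2l ?powR_ge0//.
  exact: normc_sqr_add_le.
Qed.

Lemma weighted_sqnorm_sub_le s g g1 g2 : cmeasurable g -> cmeasurable g1 ->
  cmeasurable g2 -> (weighted_sqnorm s (fun xi => g1 xi - g2 xi)%R <=
   2%:E * weighted_sqnorm s (fun xi => g1 xi - g xi)%R +
   2%:E * weighted_sqnorm s (fun xi => g2 xi - g xi)%R)%E.
Proof.
move=> mg m1 m2; rewrite -[X in (_ <= _ + 2%:E * X)%E]weighted_sqnormN.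
rewrite (_ : (fun xi => g1 xi - g2 xi) =
    (fun xi => (g1 xi - g xi) + - (g2 xi - g xi))).
  apply: weighted_sqnorm_add_le; first exact: cmeasurableB.
  by apply: cmeasurableN; exact: cmeasurableB.
by apply/funext => xi; ring.
Qed.

End fourier_theory.

(** * The integral of the weight against 1 - cos *)

Section line_integrals.
Context {R : realType}.
Local Notation leb := (@lebesgue_measure R).

(** Squaring exp (t/2) >= 1 + t/2 at t = k|x| gives exp t >= 1 + (k^2/4) x^2, whence the constant
    min (1, k^2/4). *)
Lemma expR_abs_le (k x : R) : 0 < k ->
  expR (- (k * `|x|)) <= (Num.min 1 (k ^+ 2 / 4))^-1 * (1 + x ^+ 2)^-1.
Proof.
move=> k0; set c := Num.min _ _.
have c0 : 0 < c by rewrite lt_min ltr01 divr_gt0// exprn_gt0.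
have c1 : c <= 1 by rewrite ge_min lexx.
have c2 : c <= k ^+ 2 / 4 by rewrite ge_min lexx orbT.
have x0 : 0 <= x ^+ 2 by exact: sqr_ge0.
rewrite -invfM expRN lef_pV2 ?posrE ?expR_gt0 ?mulr_gt0 ?ltr_pwDl//.
have h := expR_ge1Dx (k * `|x| / 2).
have -> : expR (k * `|x|) = expR (k * `|x| / 2) ^+ 2.
  by rewrite expr2 -expRD; congr expR; field.
have kx : 0 <= k * `|x| by rewrite mulr_ge0// ltW.
have h2 : (1 + k * `|x| / 2) ^+ 2 <= expR (k * `|x| / 2) ^+ 2.
  by rewrite lerXn2r// nnegrE ?expR_ge0// addr_ge0// divr_ge0.
apply: le_trans h2.
have -> : (1 + k * `|x| / 2) ^+ 2 = 1 + k * `|x| + k ^+ 2 / 4 * x ^+ 2.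
  by rewrite -(real_normK (num_real x)); field.
nra.
Qed.

Lemma integrable_expR_abs (k : R) : 0 < k ->
  leb.-integrable setT (EFin \o (fun x => expR (- (k * `|x|)))).
Proof.
move=> k0; apply: (@integrable_dominated _ _ _ leb _
    (fun x => (Num.min 1 (k ^+ 2 / 4))^-1 * (1 + x ^+ 2)^-1)).
- apply: measurableT_comp => //; apply: measurableT_comp => //.
  by apply: measurable_funM => //; exact: normr_measurable.
- by move=> x; rewrite ger0_norm ?expR_ge0// expR_abs_le.
- by apply: integrable_scale; exact: integrable_inv_1sqr.
Qed.

(** This serves the positivity of [gamma_cst] and [fbm_cst], hence of the final constant. *)
Lemma Rintegral_gt0_itv01 (f : R -> R) (c : R) : 0 < c ->
  leb.-integrable setT (EFin \o f) -> (forall x, 0 <= f x) ->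
  (forall x, 0 <= x <= 1 -> c <= f x) -> 0 < \int[leb]_x f x.
Proof.
move=> c0 intf f0 cf; apply: (lt_le_trans c0).
have mI : measurable (`[0, 1]%classic : set R) by exact: measurable_itv.
have i01 : leb.-integrable setT (EFin \o (fun x => c * \1_(`[0, 1]%classic) x)).
  apply: integrable_scale; apply: (integrable_indic_itv 0 1 true false).
have -> : c = \int[leb]_x (c * \1_(`[0, 1]%classic) x).
  rewrite RintegralZl//; last exact: (integrable_indic_itv 0 1 true false).
  rewrite /Rintegral integral_indic//= setIT lebesgue_measure_itv/= lte01.
  by rewrite oppr0 adde0 mulr1.
apply: le_Rintegral => // x _; rewrite indicE.
case: (boolP (x \in _)); last by rewrite mulr0.
by rewrite inE/= in_itv/= mulr1 => /cf.
Qed.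

(* The substitution t = exp u in Gamma(s) = int_0^oo t^(s-1) e^(-t) dt. *)
Definition gamma_integrand (s u : R) : R := expR (s * u - expR u).

Lemma measurable_gamma_integrand s : measurable_fun setT (gamma_integrand s).
Proof.
by apply: measurableT_comp => //; apply: measurable_funB.
Qed.

Lemma integrable_gamma_integrand (s : R) : 0 < s ->
  leb.-integrable setT (EFin \o gamma_integrand s).
Proof.
move=> s0; apply: (@integrable_dominated _ _ _ leb _
    (fun u => expR (4 * s ^+ 2) * expR (- (s * `|u|)))).
- exact: measurable_gamma_integrand.
- move=> u; rewrite ger0_norm ?expR_ge0// -expRD ler_expR.
  have [u0|u0] := leP 0 u.
    rewrite ger0_norm//.
    have h : (u / 2) ^+ 2 <= expR u.
      have h1 := expR_ge1Dx (u / 2).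
      have -> : expR u = expR (u / 2) ^+ 2 by rewrite expr2 -expRD; congr expR; field.
      by rewrite lerXn2r// ?nnegrE ?expR_ge0 ?divr_ge0//; lra.
    (* Expanded, the square says s u - u^2/4 <= 4 s^2 - s u, the origin of the factor exp (4 s^2);
       exp u >= u^2/4 supplies the rest. *)
    have := sqr_ge0 (u / 2 - 2 * s); nra.
  rewrite ltr0_norm//; have := expR_ge0 u; nra.
- by apply: integrable_scale; exact: integrable_expR_abs.
Qed.

Definition gamma_cst (s : R) : R := \int[leb]_u gamma_integrand s u.

Lemma gamma_cst_gt0 s : 0 < s -> 0 < gamma_cst s.
Proof.
move=> s0; apply: (@Rintegral_gt0_itv01 _ (expR (- expR 1))).
- exact: expR_gt0.
- exact: integrable_gamma_integrand.
- by move=> x; exact: expR_ge0.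
- move=> x /andP[x0 x1]; rewrite ler_expR.
  have : expR x <= expR 1 by rewrite ler_expR.
  have : 0 <= s * x by rewrite mulr_ge0// ltW.
  lra.
Qed.

(** After t = exp u, a scaling of t by r^2 is a translation of u by ln (r^2), so translation
    invariance gives the power of r. *)
Lemma gamma_scaling (s r : R) : 0 < s -> 0 < r ->
  leb.-integrable setT (EFin \o (fun u => expR (s * u - expR u * r ^+ 2))) /\
  \int[leb]_u expR (s * u - expR u * r ^+ 2) = r `^ (- (2 * s)) * gamma_cst s.
Proof.
move=> s0 r0; have r20 : 0 < r ^+ 2 by rewrite exprn_gt0.
have E u : expR (s * u - expR u * r ^+ 2) =
    r `^ (- (2 * s)) * gamma_integrand s (u + ln (r ^+ 2)).
  rewrite /gamma_integrand [X in _ = _ * expR (_ - X)]expRD lnK ?posrE// /powR gt_eqF//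
    -expRD.
  by congr expR; rewrite lnXn// mulr2n; ring.
have intg := integrable_translation (ln (r ^+ 2)) (integrable_gamma_integrand s0).
split; first by rewrite (funext E); exact: integrable_scale.
under eq_Rintegral do rewrite E.
rewrite (RintegralZl _ measurableT intg).
by rewrite (Rintegral_translation _ (measurable_gamma_integrand s)).
Qed.

(* The integrand left, for |x| = 1, once the Gaussians exp (- e^u |xi|^2) have
   been integrated in xi. *)
Definition fbm_integrand (H u : R) : R := expR (H * u) * (1 - expR (- (expR (- u) / 4))).

Lemma fbm_integrand_ge0 H u : 0 <= fbm_integrand H u.
Proof.
by rewrite mulr_ge0 ?expR_ge0// subr_ge0 -expR0 ler_expR oppr_le0.
Qed.

Lemma measurable_fbm_integrand H : measurable_fun setT (fbm_integrand H).
Proof.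
apply: measurable_funM.
  by apply: measurableT_comp => //; exact: measurable_funM.
apply: measurable_funB => //; apply: measurableT_comp => //.
apply: measurableT_comp => //; apply: measurable_funM => //.
by apply: measurableT_comp => //.
Qed.

(** For u >= 0 the bound 1 - exp (-t) <= t leaves exp (-(1 - H) u), integrable since H < 1; for u <
    0 the second factor is at most 1 and exp (H u) is integrable since H > 0. *)
Lemma integrable_fbm_integrand H : 0 < H < 1 ->
  leb.-integrable setT (EFin \o fbm_integrand H).
Proof.
move=> /andP[H0 H1]; apply: (@integrable_dominated _ _ _ leb _
    (fun u => expR (- (H * `|u|)) + expR (- ((1 - H) * `|u|)))).
- exact: measurable_fbm_integrand.
- move=> u; rewrite ger0_norm ?fbm_integrand_ge0// /fbm_integrand.
  have e1 := expR_ge0 (- (H * `|u|)); have e2 := expR_ge0 (- ((1 - H) * `|u|)).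
  have [u0|u0] := leP 0 u.
    have h : 1 - expR (- (expR (- u) / 4)) <= expR (- u).
      have := expR_ge1Dx (- (expR (- u) / 4)); have := expR_ge0 (- u); lra.
    apply: (@le_trans _ _ (expR (H * u) * expR (- u))).
      by rewrite ler_wpM2l ?expR_ge0.
    rewrite -expRD ger0_norm//.
    have -> : H * u - u = - ((1 - H) * u) by ring.
    by rewrite lerDr expR_ge0.
  have h : 1 - expR (- (expR (- u) / 4)) <= 1.
    by have := expR_ge0 (- (expR (- u) / 4)); lra.
  apply: (@le_trans _ _ (expR (H * u) * 1)); first by rewrite ler_wpM2l ?expR_ge0.
  by rewrite mulr1 ltr0_norm// mulrN opprK lerDl expR_ge0.
- apply: integrable_add; apply: integrable_expR_abs => //; lra.
Qed.

Definition fbm_cst (H : R) : R := \int[leb]_u fbm_integrand H u.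

Lemma fbm_cst_gt0 H : 0 < H < 1 -> 0 < fbm_cst H.
Proof.
move=> H01; have /andP[H0 H1] := H01.
apply: (@Rintegral_gt0_itv01 _ (1 - expR (- (expR (- 1) / 4)))).
- by rewrite subr_gt0 expR_lt1 oppr_lt0 divr_gt0 ?expR_gt0.
- exact: integrable_fbm_integrand.
- exact: fbm_integrand_ge0.
- move=> x /andP[x0 x1]; rewrite -[leLHS]mul1r ler_pM//.
  + by rewrite -expR0 ler_expR mulr_ge0// ltW.
  + by rewrite lerD2l lerN2 ler_expR lerN2 ler_pM2r ?invr_gt0// ler_expR lerN2.
Qed.

Lemma fbm_scaling (H r : R) : 0 < H < 1 -> 0 <= r ->
  leb.-integrable setT
    (EFin \o (fun u => expR (H * u) * (1 - expR (- (r ^+ 2 * expR (- u) / 4))))) /\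
  \int[leb]_u (expR (H * u) * (1 - expR (- (r ^+ 2 * expR (- u) / 4)))) =
  r `^ (2 * H) * fbm_cst H.
Proof.
(* The case r = 0 is separate because the translation is by ln (r^2); both sides are then 0, the
   right one because H is nonzero. *)
move=> H01; rewrite le_eqVlt => /predU1P[<-|r0].
  have E u : expR (H * u) * (1 - expR (- (0 ^+ 2 * expR (- u) / 4))) = 0 :> R.
    by rewrite expr0n/= !mul0r oppr0 expR0 subrr mulr0.
  split; first by rewrite (funext E); exact: integrable0.
  under eq_Rintegral do rewrite E.
  rewrite powR0 ?mul0r; last by rewrite mulf_neq0 ?pnatr_eq0// gt_eqF//; case/andP: H01.
  by rewrite /Rintegral integral0.
have r20 : 0 < r ^+ 2 by rewrite exprn_gt0.
have E u : expR (H * u) * (1 - expR (- (r ^+ 2 * expR (- u) / 4))) =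
    r `^ (2 * H) * fbm_integrand H (u + - ln (r ^+ 2)).
  rewrite /fbm_integrand opprD opprK expRD lnK ?posrE// mulrA.
  rewrite /powR gt_eqF// -expRD (mulrC (r ^+ 2)); congr (expR _ * _).
  by rewrite lnXn// mulr2n; ring.
have intf := integrable_translation (- ln (r ^+ 2)) (integrable_fbm_integrand H01).
split; first by rewrite (funext E); exact: integrable_scale.
under eq_Rintegral do rewrite E.
rewrite (RintegralZl _ measurableT intf).
by rewrite (Rintegral_translation _ (measurable_fbm_integrand H)).
Qed.

End line_integrals.

Section fgf_kernel.
Context {R : realType} {d : nat}.
Local Notation E := 'rV[R]_d.
Local Notation leb := (@lebesgue_measure R).
Local Notation mu := (@lebesgue_rV R d).
Implicit Types x xi : E.

Lemma enorm_ge0 x : 0 <= enorm x. Proof. exact: sqrtr_ge0. Qed.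

Lemma enorm_sqr x : enorm x ^+ 2 = dot x x.
Proof. by rewrite sqr_sqrtr// dot_ge0. Qed.

Lemma enorm_eq0 x : enorm x = 0 -> x = 0.
Proof.
move=> x0; have /eqP : dot x x = 0 by rewrite -enorm_sqr x0 expr0n.
rewrite /dot psumr_eq0 => [/allP H|i _]; last by rewrite -expr2 sqr_ge0.
apply/rowP => i; rewrite mxE; apply/eqP.
by have := H i (mem_index_enum i); rewrite -expr2 sqrf_eq0.
Qed.

(* The phase [+ 0] matches the form [cos (dot x xi + b)] of the lemmas on
   cosines. *)
Definition ncos x xi : R := 1 - cos (dot x xi + 0).

Lemma ncos_ge0 x xi : 0 <= ncos x xi.
Proof. by rewrite subr_ge0; exact: cos_le1. Qed.

Lemma measurable_ncos x : measurable_fun setT (ncos x).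
Proof. by apply: measurable_funB => //; exact: measurable_cos_dot. Qed.

(** The power of pi is the mass of the Gaussians integrated in xi; [gamma_cst s] is Gamma(s), the
    constant of the integral representation of the weight. *)
Definition kernel_cst (s : R) : R :=
  Num.sqrt pi ^+ d * fbm_cst (Hurst d s) / gamma_cst s.

Variable s : R.
Hypothesis hs : 0 < Hurst d s < 1.

Let s_gt0 : 0 < s.
Proof.
have d0 : 0 <= d%:R / 2 :> R by rewrite divr_ge0.
by move: hs => /andP[]; rewrite /Hurst; lra.
Qed.

Lemma kernel_cst_gt0 : 0 < kernel_cst s.
Proof.
rewrite /kernel_cst; apply: divr_gt0; last exact: gamma_cst_gt0.
apply: mulr_gt0; last exact: fbm_cst_gt0.
by rewrite exprn_gt0// sqrtr_gt0 pi_gt0.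
Qed.

(** Integrated in the real variable it gives Gamma(s) times the weighted 1 - cos; integrated in the
    vector it gives the one-dimensional integrand of [fbm_scaling]. *)
Let Phi x (p : E * R) : R := expR (s * p.2) * gauss_rV (expR p.2) p.1 * ncos x p.1.

Let Phi_ge0 x p : 0 <= Phi x p.
Proof. by rewrite !mulr_ge0 ?expR_ge0 ?ncos_ge0. Qed.

Let measurable_Phi x : measurable_fun setT (Phi x).
Proof.
have m1 := @measurable_fst _ _ E R; have m2 := @measurable_snd _ _ E R.
have me : measurable_fun setT (fun p : E * R => expR p.2).
  exact: (measurableT_comp (@measurable_expR R) m2).
apply: measurable_funM; last exact: (measurableT_comp (measurable_ncos x) m1).
apply: measurable_funM.
  by apply: measurableT_comp => //; exact: measurable_funM.
apply: measurableT_comp => //; apply: measurableT_comp => //.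
apply: measurable_funM => //; apply: measurable_sum => i.
by apply: measurable_funM; exact: (measurableT_comp (measurable_rV_coord i) m1).
Qed.

Let integral_Phi_line x xi : (\int[leb]_u (Phi x (xi, u))%:E =
  (gamma_cst s * (fgf_weight s xi * ncos x xi))%:E)%E.
Proof.
(* This case covers xi = 0, where the Gamma integral for the weight diverges; otherwise [enorm xi]
   is positive. *)
have [p0|p0] := eqVneq (ncos x xi) 0.
  under eq_integral do rewrite /Phi /= p0 mulr0.
  by rewrite p0 !mulr0 integral0.
have r0 : 0 < enorm xi.
  rewrite lt_neqAle enorm_ge0 andbT; apply: contra p0 => /eqP/esym/enorm_eq0 ->.
  by rewrite /ncos dot0r addr0 cos0 subrr.
have [intg gE] := gamma_scaling s_gt0 r0.
have PE u : Phi x (xi, u) = ncos x xi * expR (s * u - expR u * enorm xi ^+ 2).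
  by rewrite /Phi /= /gauss_rV -expRD mulrC enorm_sqr.
under eq_integral do rewrite PE.
rewrite integral_EFinE; last exact: integrable_scale.
rewrite (RintegralZl _ measurableT intg) gE /fgf_weight.
by congr (_%:E); ring.
Qed.

(** Here the Hurst parameter appears: the mass (pi / e^u)^(d/2) turns e^(s u) into pi^(d/2) e^((s -
    d/2) u). *)
Let integral_Phi_space x u : (\int[mu]_xi (Phi x (xi, u))%:E =
  (Num.sqrt pi ^+ d *
    (expR (Hurst d s * u) * (1 - expR (- (enorm x ^+ 2 * expR (- u) / 4)))))%:E)%E.
Proof.
have e0 : 0 < expR u by exact: expR_gt0.
have i1 := @integrable_gauss_rV R d (expR u) e0.
have i2 := @integrable_gauss_rV_cos R d (expR u) 0 x e0.
have PE xi : Phi x (xi, u) = expR (s * u) *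
    (gauss_rV (expR u) xi + (- 1) * (gauss_rV (expR u) xi * cos (dot x xi + 0))).
  by rewrite /Phi /ncos /=; ring.
under eq_integral do rewrite PE.
have i3 := integrable_add i1 (integrable_scale (- 1) i2).
rewrite integral_EFinE; last exact: integrable_scale.
rewrite (RintegralZl _ measurableT i3) RintegralD//; last exact: integrable_scale.
rewrite (RintegralZl _ measurableT i2) Rintegral_gauss_rV// Rintegral_gauss_rV_cos//.
rewrite cos0 mulr1 enorm_sqr.
have sE : Num.sqrt (pi / expR u) = Num.sqrt pi * expR (- (u / 2)).
  rewrite sqrtrM ?pi_ge0//; congr (_ * _); rewrite -expRN.
  have -> : expR (- u) = expR (- (u / 2)) ^+ 2.
    by rewrite expr2 -expRD; congr expR; field.
  by rewrite sqrtr_sqr ger0_norm ?expR_ge0.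
have pE : Num.sqrt (pi / expR u) ^+ d = Num.sqrt pi ^+ d * expR (- (d%:R / 2 * u)).
  rewrite sE exprMn -expRM_natl; congr (_ * expR _); by field.
have HE : expR (s * u) = expR (Hurst d s * u) * expR (d%:R / 2 * u).
  by rewrite -expRD /Hurst; congr expR; ring.
have qE : dot x x / (4 * expR u) = dot x x * expR (- u) / 4.
  by rewrite expRN; field; rewrite gt_eqF.
rewrite pE qE HE; congr (_%:E).
have : expR (d%:R / 2 * u) * expR (- (d%:R / 2 * u)) = 1 by rewrite -expRD subrr expR0.
set A := expR (d%:R / 2 * u); set B := expR (- (d%:R / 2 * u)) => AB.
set C := expR (- _); set D := expR _.
transitivity ((A * B) * (Num.sqrt pi ^+ d * (D * (1 - C)))); first by ring.
by rewrite AB mul1r.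
Qed.

(** Since [Phi] is nonnegative, Tonelli applies before any integrability is known; the finite value
    of the iterated integral then yields integrability as well. *)
Lemma integral_weight_ncos x :
  mu.-integrable setT (EFin \o (fun xi => fgf_weight s xi * ncos x xi)) /\
  \int[mu]_xi (fgf_weight s xi * ncos x xi) =
  kernel_cst s * enorm x `^ (2 * Hurst d s).
Proof.
have g0 := gamma_cst_gt0 s_gt0.
have mEPhi : measurable_fun setT (EFin \o Phi x) by exact/measurable_EFinP.
have Tonelli : (\int[mu]_xi (gamma_cst s * (fgf_weight s xi * ncos x xi))%:E =
    (gamma_cst s * (kernel_cst s * enorm x `^ (2 * Hurst d s)))%:E)%E.
  transitivity (\int[mu]_xi \int[leb]_u (Phi x (xi, u))%:E)%E.
    by apply: eq_integral => xi _; rewrite integral_Phi_line.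
  have EPhi_ge0 p : (0 <= (EFin \o Phi x) p)%E by rewrite lee_fin Phi_ge0.
  rewrite (@fubini_tonelli _ _ _ _ _ mu leb (EFin \o Phi x) mEPhi EPhi_ge0).
  under eq_integral do rewrite /= integral_Phi_space.
  have [i1 E1] := fbm_scaling hs (enorm_ge0 x).
  rewrite integral_EFinE; last exact: integrable_scale.
  rewrite (RintegralZl _ measurableT i1) E1 /kernel_cst; congr (_%:E).
  by field; rewrite gt_eqF.
have mw : measurable_fun setT (fun xi => fgf_weight s xi * ncos x xi).
  by apply: measurable_funM; [exact: measurable_fgf_weight|exact: measurable_ncos].
have w0 xi : 0 <= fgf_weight s xi * ncos x xi.
  by rewrite mulr_ge0 ?fgf_weight_ge0 ?ncos_ge0.
have intw : mu.-integrable setT (EFin \o (fun xi => fgf_weight s xi * ncos x xi)).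
  have i1 : mu.-integrable setT
      (EFin \o (fun xi => gamma_cst s * (fgf_weight s xi * ncos x xi))).
    apply/integrableP; split; first by apply/measurable_EFinP; exact: measurable_funM.
    under eq_integral => xi _ do rewrite /= ger0_norm ?(mulr_ge0 (ltW g0) (w0 xi))//.
    by rewrite Tonelli ltry.
  have := integrable_scale (gamma_cst s)^-1 i1.
  by apply: eq_integrable => // xi _ /=; rewrite mulKf// gt_eqF.
split => //; have g0' : gamma_cst s != 0 by rewrite gt_eqF.
apply: (mulfI g0'); rewrite -(RintegralZl _ measurableT intw).
by move: Tonelli; rewrite integral_EFinE; [case|exact: integrable_scale].
Qed.

End fgf_kernel.

(** * Uniqueness of the Fourier transform of a distribution *)

Section fourier_uniqueness.
Context {R : realType} {d : nat}.
Local Notation E := 'rV[R]_d.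
Local Notation mu := (@lebesgue_rV R d).
Implicit Types x xi b : E.

Lemma dotZr (a : R) x y : dot x (a *: y : E) = a * dot x y.
Proof. by rewrite /dot mulr_sumr; apply: eq_bigr => i _; rewrite mxE mulrCA. Qed.

(** Completing the square: the new centre is the barycentre of [b1] and [b2] with weights [k1] and
    [k2]. Gaussians are thus stable under products up to constants. *)
Lemma gauss_at_mul (k1 k2 : R) b1 b2 : 0 < k1 -> 0 < k2 -> exists c b, forall x,
  gauss_at k1 b1 x * gauss_at k2 b2 x = c * gauss_at (k1 + k2) b x.
Proof.
move=> k10 k20; have k0 : 0 < k1 + k2 by exact: addr_gt0.
pose b := (k1 + k2)^-1 *: (k1 *: b1 + k2 *: b2).
exists (expR ((k1 + k2) * dot b b - k1 * dot b1 b1 - k2 * dot b2 b2)), b => x.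
rewrite /gauss_at /gauss_rV -!expRD; congr expR; rewrite !dotBB.
have -> : dot x b = (k1 + k2)^-1 * (k1 * dot x b1 + k2 * dot x b2).
  by rewrite /b dotZr dotDr !dotZr.
by field; rewrite gt_eqF.
Qed.

Lemma gauss_at_le1 (k : R) b x : 0 < k -> `|gauss_at k b x| <= 1.
Proof.
move=> k0; rewrite ger0_norm ?expR_ge0// -expR0 ler_expR oppr_le0.
by rewrite mulr_ge0 ?dot_ge0// ltW.
Qed.

Section gauss_determining.
Variable w : E -> R.
Hypothesis intw : forall (k : R) b, 0 < k ->
  mu.-integrable setT (EFin \o (fun x => w x * gauss_at k b x)).
Hypothesis w0 : forall (k : R) b, 0 < k -> \int[mu]_x (w x * gauss_at k b x) = 0.

(** [w] is integrable only against Gaussians; fixing one of them as a factor gives an integrable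
    function to which dominated convergence applies. *)
Let v x : R := w x * gauss_at 1 0 x.

Let intv : mu.-integrable setT (EFin \o v).
Proof. exact: intw. Qed.

Let mv : measurable_fun setT v.
Proof. exact: integrable_measurable intv. Qed.

(** The constant 1 is adjoined because the closure argument starts from it; testing [v] against it
    amounts to testing [w] against a Gaussian. *)
Let C : set (E -> R) := [set f | f = (fun=> 1) \/
  exists (c k : R) b, 0 < k /\ f = fun x => c * gauss_at k b x].

Let C1 : C (fun=> 1). Proof. by left. Qed.

Let Cbnd f : C f -> exists M : R, forall x, `|f x| <= M.
Proof.
move=> [->|[c [k [b [k0 ->]]]]]; first by exists 1 => x; rewrite normr1.
by exists `|c| => x; rewrite normrM ler_piMr// gauss_at_le1.
Qed.

Let Cmul f g : C f -> C g -> bclosure C (fun x => f x * g x).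
Proof.
move=> [->|[c [k [b [k0 ->]]]]] Cg.
  by apply: bclosure_ext (bclosure_gen Cg) => x; rewrite mul1r.
case: Cg => [->|[c' [k' [b' [k0' ->]]]]].
  apply: bclosure_gen; right; exists c, k, b; split => //.
  by apply/funext => x; rewrite mulr1.
have [c2 [b2 H]] := gauss_at_mul b b' k0 k0'.
apply: bclosure_gen; right; exists (c * c' * c2), (k + k'), b2.
split; first exact: addr_gt0.
by apply/funext => x; rewrite mulrACA H mulrA.
Qed.

Let closure_null f : bclosure C f ->
  measurable_fun setT f /\ \int[mu]_x (v x * f x) = 0.
Proof.
have iv (g : E -> R) (M : R) : measurable_fun setT g -> (forall x, `|g x| <= M) ->
    mu.-integrable setT (EFin \o (fun x => v x * g x)).
  move=> mg gM; apply: (@integrable_dominated _ _ _ mu _ (fun x => M * `|v x|)).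
  - exact: measurable_funM.
  - by move=> x; rewrite normrM mulrC ler_wpM2r.
  - by apply: integrable_scale; exact: integrable_norm.
elim=> {f} [_ [->|[c [k [b [k0 ->]]]]]|a f g clf [mf f0] clg [mg g0]|f_ f M _ IH fM f_f].
- split => //; under eq_Rintegral do rewrite mulr1.
  exact: w0.
- split; first by apply: measurable_funM => //; exact: measurable_gauss_at.
  have [c2 [b2 H]] := gauss_at_mul 0 b (@ltr01 R) k0.
  have E2 x : v x * (c * gauss_at k b x) = (c * c2) * (w x * gauss_at (1 + k) b2 x).
    rewrite /v; transitivity (c * w x * (gauss_at 1 0 x * gauss_at k b x)); first by ring.
    by rewrite H; ring.
  have k1 : 0 < 1 + k by rewrite addr_gt0.
  under eq_Rintegral do rewrite E2.
  by rewrite (RintegralZl _ measurableT (intw b2 k1)) w0// mulr0.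
- have [M fM] := bclosure_bounded Cbnd clf.
  have [N gN] := bclosure_bounded Cbnd clg.
  split; first by apply: measurable_funD => //; exact: measurable_funM.
  have if_ := iv _ _ mf fM; have ig_ := iv _ _ mg gN.
  have E2 x : v x * (a * f x + g x) = a * (v x * f x) + v x * g x by ring.
  under eq_Rintegral do rewrite E2.
  rewrite RintegralD//; last exact: integrable_scale.
  by rewrite (RintegralZl _ measurableT if_) f0 g0 mulr0 addr0.
- have mf_ n : measurable_fun setT (f_ n) by have [] := IH n.
  have mf : measurable_fun setT f.
    by apply: (@measurable_fun_cvg _ _ _ _ f_) => // x _; exact: f_f.
  split => //.
  have m1 n : measurable_fun setT (fun x => v x * f_ n x) by exact: measurable_funM.
  have c1 x : v x * f_ n x @[n --> \oo] --> v x * f x.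
    by apply: cvgM; [exact: cvg_cst|exact: f_f].
  have iM : mu.-integrable setT (EFin \o (fun x => M * `|v x|)).
    by apply: integrable_scale; exact: integrable_norm.
  have b1 n x : `|v x * f_ n x| <= M * `|v x|.
    by rewrite normrM mulrC ler_wpM2r.
  have [_] := @Rintegral_cvg _ _ _ mu _ _ _ m1 c1 iM b1.
  have -> : (fun n => \int[mu]_x (v x * f_ n x)) = fun=> 0.
    by apply/funext => n; have [] := IH n.
  by move=> c0; apply/esym; apply: cvg_unique c0 => //; exact: cvg_cst.
Qed.

(** Of two equal Gaussians centred at (a - 1) e_i and (a + 1) e_i, the second is larger exactly at
    the points nearer to its centre, that is where x_i > a. *)
Let half_line i (a : R) : bclosure C (\1_[set x : E | a < rV_coord i x]).
Proof.
pose e (c : R) : E := c *: delta_mx ord0 i.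
have cl c : bclosure C (gauss_at 1 (e c)).
  apply: bclosure_gen; right; exists 1, 1, (e c); split => //.
  by apply/funext => x; rewrite mul1r.
have -> : [set x : E | a < rV_coord i x] =
    [set x | 0 < (- 1) * gauss_at 1 (e (a - 1)) x + gauss_at 1 (e (a + 1)) x].
  apply/seteqP; rewrite /rV_coord; suff H x : (a < x ord0 i) =
      (0 < (- 1) * gauss_at 1 (e (a - 1)) x + gauss_at 1 (e (a + 1)) x).
    by split => x /=; rewrite H.
  rewrite mulN1r addrC subr_gt0 ltr_expR ltrN2 !mul1r !dotBB.
  have de z c : dot z (e c) = c * z ord0 i.
    rewrite /e dotZr; congr (_ * _); rewrite /dot (bigD1 i)//= !mxE !eqxx mulr1.
    by rewrite big1 ?addr0// => j /negbTE ji; rewrite !mxE ji andbF mulr0.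
  have dee c : dot (e c) (e c) = c ^+ 2.
    by rewrite de /e !mxE !eqxx mulr1 expr2.
  rewrite !dee !de; apply/idP/idP; lra.
apply: (bclosure_indic_gt0 C1 Cbnd Cmul).
by apply: bclosure_lin.
Qed.

Lemma gauss_determining : ae_eq mu setT (EFin \o w) (cst 0%E).
Proof.
have clA (A : set E) : measurable A -> bclosure C (\1_A).
  move=> mA; apply: (bclosure_indic_smallest C1 Cbnd Cmul _ mA).
  move=> _ [i [B [mB ->]]].
  exact: (indic_preimage_measurable C1 Cbnd Cmul (half_line i)).
have v0 : ae_eq mu setT (EFin \o v) (cst 0%E).
  apply: integral_ae_eq => // A _ mA.
  rewrite integral0 integral_mkcond.
  have [_ H] := closure_null (clA A mA).
  have iA : mu.-integrable setT (EFin \o (fun x => v x * \1_A x)).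
    apply: (@integrable_dominated _ _ _ mu _ (fun x => `|v x|)).
    - by apply: measurable_funM => //; exact: measurable_indic.
    - move=> x; rewrite normrM indicE; case: (_ \in _); rewrite ?normr1 ?normr0 ?mulr1//.
      by rewrite mulr0.
    - exact: integrable_norm.
  transitivity (\int[mu]_x (v x * \1_A x))%:E; last by rewrite H.
  by rewrite -integral_EFinE// epatch_indic.
apply: filterS v0 => x /= H _; have := H I => -[] /eqP.
by rewrite mulf_eq0 (gt_eqF (expR_gt0 _)) orbF => /eqP ->.
Qed.

End gauss_determining.

(** Against each Gaussian both candidates give the value of [l] at the same transform. The test
    functions being real, real and imaginary parts separate and [gauss_determining] applies to each
    difference. *)
Lemma is_fourier_unique (l : (E -> R) -> R) (g1 g2 : E -> R[i]) :
  is_fourier l g1 -> is_fourier l g2 -> {ae mu, forall xi, g1 xi = g2 xi}.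
Proof.
move=> [[m1R m1I] H1] [[m2R m2I] H2].
have ReE (z : R[i]) (r : R) : complex.Re (z * r%:C%C) = complex.Re z * r.
  by case: z => a b /=; rewrite mulr0 subr0.
have ImE (z : R[i]) (r : R) : complex.Im (z * r%:C%C) = complex.Im z * r.
  by case: z => a b /=; rewrite mulr0 add0r.
pose wR xi := complex.Re (g1 xi) - complex.Re (g2 xi).
have iwR (k : R) b : 0 < k ->
    mu.-integrable setT (EFin \o (fun xi => wR xi * gauss_at k b xi)).
  move=> k0; have sg := schwartz_gauss_at b k0.
  have [[i1R i1I] _] := H1 _ sg; have [[i2R i2I] _] := H2 _ sg.
  have := integrable_add i1R (integrable_scale (- 1) i2R).
  by apply: eq_integrable => // xi _ /=; rewrite !ReE; congr (_%:E); rewrite /wR; ring.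
have wR0 (k : R) b : 0 < k -> \int[mu]_xi (wR xi * gauss_at k b xi) = 0.
  move=> k0; have sg := schwartz_gauss_at b k0.
  have [[i1R i1I] e1] := H1 _ sg; have [[i2R i2I] e2] := H2 _ sg.
  have := e1; rewrite -e2 => -[] eR eI.
  transitivity (\int[mu]_xi (complex.Re (g1 xi * (gauss_at k b xi)%:C%C) -
     complex.Re (g2 xi * (gauss_at k b xi)%:C%C))).
    by apply: eq_Rintegral => xi _; rewrite !ReE /wR; ring.
  by rewrite RintegralB// eR subrr.
have aeR := gauss_determining iwR wR0.
pose wI xi := complex.Im (g1 xi) - complex.Im (g2 xi).
have iwI (k : R) b : 0 < k ->
    mu.-integrable setT (EFin \o (fun xi => wI xi * gauss_at k b xi)).
  move=> k0; have sg := schwartz_gauss_at b k0.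
  have [[i1R i1I] _] := H1 _ sg; have [[i2R i2I] _] := H2 _ sg.
  have := integrable_add i1I (integrable_scale (- 1) i2I).
  by apply: eq_integrable => // xi _ /=; rewrite !ImE; congr (_%:E); rewrite /wI; ring.
have wI0 (k : R) b : 0 < k -> \int[mu]_xi (wI xi * gauss_at k b xi) = 0.
  move=> k0; have sg := schwartz_gauss_at b k0.
  have [[i1R i1I] e1] := H1 _ sg; have [[i2R i2I] e2] := H2 _ sg.
  have := e1; rewrite -e2 => -[] eR eI.
  transitivity (\int[mu]_xi (complex.Im (g1 xi * (gauss_at k b xi)%:C%C) -
     complex.Im (g2 xi * (gauss_at k b xi)%:C%C))).
    by apply: eq_Rintegral => xi _; rewrite !ImE /wI; ring.
  by rewrite RintegralB// eI subrr.
have aeI := gauss_determining iwI wI0.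
apply: filterS2 aeR aeI => xi /(_ Logic.I) [] /eqP hR /(_ Logic.I) [] /eqP hI.
apply/eqP; rewrite eq_complex; apply/andP; split.
  by move: hR; rewrite subr_eq0.
by move: hI; rewrite subr_eq0.
Qed.

Lemma weighted_sqnorm_ae (s : R) (u g1 g2 : E -> R[i]) : cmeasurable u ->
  cmeasurable g1 -> cmeasurable g2 -> {ae mu, forall xi, g1 xi = g2 xi} ->
  weighted_sqnorm s (fun xi => u xi - g1 xi) = weighted_sqnorm s (fun xi => u xi - g2 xi).
Proof.
move=> mu_ m1 m2 ae12; apply: ae_eq_integral => //.
- by apply: emeasurable_weighted; exact: cmeasurableB.
- by apply: emeasurable_weighted; exact: cmeasurableB.
- by apply: filterS ae12 => xi -> _.
Qed.

End fourier_uniqueness.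

(** * Approximation of delta_x - delta_0 *)

Section delta_increments.
Context {R : realType} {d : nat}.
Local Notation E := 'rV[R]_d.
Local Notation mu := (@lebesgue_rV R d).
Local Notation delta x := (delta_distr (x : E) - delta_distr 0).
Implicit Types x y xi b : E.

Local Open Scope complex_scope.

(** The term at 0 is left as cos (0.xi + c) so that lemmas on cosines with a phase apply to both
    terms alike. *)
Definition cosdiff x (c : R) xi : R := cos (dot x xi + c) - cos (dot 0 xi + c).

(* The Fourier transform [(2 pi)^(-d/2) (e^(-i x.xi) - 1)] of
   [delta_x - delta_0]; [cos (t + pi / 2) = sin (- t)]. *)
Definition delta_ft x xi : R[i] :=
  (fourier_cst (d := d) * cosdiff x 0 xi) +i* (fourier_cst (d := d) * cosdiff x (pi /
    2) xi).

Lemma measurable_cosdiff x c : measurable_fun setT (cosdiff x c).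
Proof. by apply: measurable_funB; exact: measurable_cos_dot. Qed.

Lemma cosdiff_le2 x c xi : `|cosdiff x c xi| <= 2.
Proof.
rewrite (le_trans (ler_normB _ _))// -[leRHS]/(1 + 1) lerD//; exact: cos_max.
Qed.

Lemma cmeasurable_delta_ft x : cmeasurable (delta_ft x).
Proof. by split; apply: measurable_funM => //; exact: measurable_cosdiff. Qed.

Lemma dual_delta x : dual schwartz (delta x).
Proof.
split => [a f g _ _|e e0].
  rewrite -[LHS]/((a * f x + g x) - (a * f 0 + g 0)).
  by rewrite -[RHS]/(a * (f x - f 0) + (g x - g 0)); ring.
exists 0%N, (e / 2); first by rewrite divr_gt0.
move=> f sf H; have Hx z : `|f z| <= e / 2.
  have := H [::] (fun=> 0%N) z; rewrite monomial0 mul1r /=; apply => //.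
  by rewrite /mdeg big1.
rewrite -[_ f]/(f x - f 0) (le_trans (ler_normB _ _))//.
by rewrite (splitr e) lerD.
Qed.

(** By symmetry of [dot], the pairing with [psi] is the integral defining [fourier psi] at x minus
    the one at 0. *)
Lemma is_fourier_delta x : is_fourier (delta x) (delta_ft x).
Proof.
split; first exact: cmeasurable_delta_ft.
move=> psi spsi.
have i1 c : mu.-integrable setT (EFin \o (fun xi => psi xi * cosdiff x c xi)).
  apply: (@schwartz_integrable_bounded _ _ _ _ 2) => //; first exact: measurable_cosdiff.
  exact: cosdiff_le2.
have L c : \int[mu]_xi (psi xi * cosdiff x c xi) =
    \int[mu]_xi (psi xi * cos (dot x xi + c)) - \int[mu]_xi (psi xi * cos (dot 0 xi + c)).
  rewrite -RintegralB//; [|exact: schwartz_cos_integrable..].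
  by apply: eq_Rintegral => xi _; rewrite /cosdiff mulrBr.
have RE xi : complex.Re (delta_ft x xi * (psi xi)%:C) =
    fourier_cst (d := d) * (psi xi * cosdiff x 0 xi).
  by rewrite /= mulr0 subr0 mulrAC mulrA.
have IE xi : complex.Im (delta_ft x xi * (psi xi)%:C) =
    fourier_cst (d := d) * (psi xi * cosdiff x (pi / 2) xi).
  by rewrite /= mulr0 add0r mulrAC mulrA.
split.
  split; [rewrite (_ : (fun xi => _) = EFin \o (fun xi => fourier_cst (d := d) * (psi
    xi * cosdiff x 0 xi)))|
    rewrite (_ : (fun xi => _) = EFin \o (fun xi => fourier_cst (d := d) * (psi xi *
      cosdiff x (pi / 2) xi)))].
  - exact: integrable_scale.
  - by apply/funext => xi /=; rewrite -RE.
  - exact: integrable_scale.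
  - by apply/funext => xi /=; rewrite -IE.
rewrite /cintegral; under eq_Rintegral do rewrite RE.
under [X in _ +i* X]eq_Rintegral do rewrite IE.
rewrite (RintegralZl _ measurableT (i1 0)) (RintegralZl _ measurableT (i1 (pi / 2))) !L.
rewrite -[delta x (fun x0 => complex.Re _)]/(complex.Re (fourier psi x) - complex.Re
  (fourier psi 0)).
rewrite -[delta x (fun x0 => complex.Im _)]/(complex.Im (fourier psi x) - complex.Im
  (fourier psi 0)).
by rewrite !Re_fourier !Im_fourier !mulrBr.
Qed.

(** The prefactor is the inverse of the mass of each Gaussian, so the two terms approach unit Dirac
    masses as k grows and their masses cancel. *)
Definition gauss_increment (k : R) x : E -> R :=
  (Num.sqrt (pi / k) ^+ d)^-1 *: ((- 1) *: gauss_at k 0 + gauss_at k x).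

Let peak_gt0 (k : R) : 0 < k -> 0 < Num.sqrt (pi / k) ^+ d :> R.
Proof. by move=> k0; rewrite exprn_gt0// sqrtr_gt0 divr_gt0// pi_gt0. Qed.

Lemma schwartz_cst0 : schwartz (0 : E -> R).
Proof.
have s1 := schwartz_gauss_at (0 : E) (@ltr01 R).
have := schwartz_lin (- 1) s1 s1.
by rewrite (_ : _ + _ = 0)// scaleN1r addNr.
Qed.

Lemma schwartz_scale (a : R) (f : E -> R) : schwartz f -> schwartz (a *: f).
Proof. by move=> sf; rewrite -[a *: f]addr0; apply: schwartz_lin => //;
  exact: schwartz_cst0. Qed.

Lemma schwartz_gauss_increment k x : 0 < k -> schwartz (gauss_increment k x).
Proof.
move=> k0; apply: schwartz_scale; apply: schwartz_lin; exact: schwartz_gauss_at.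
Qed.

Lemma gauss_increment_cos k x y c : 0 < k ->
  \int[mu]_z (gauss_increment k x z * cos (dot y z + c)) =
  expR (- (dot y y / (4 * k))) * cosdiff x c y.
Proof.
move=> k0; have p0 := peak_gt0 k0.
have ic b : mu.-integrable setT (EFin \o (fun z => gauss_at k b z * cos (dot y z + c))).
  by apply: schwartz_cos_integrable; exact: schwartz_gauss_at.
have GE z : gauss_increment k x z * cos (dot y z + c) =
    (Num.sqrt (pi / k) ^+ d)^-1 * ((- 1) * (gauss_at k 0 z * cos (dot y z + c)) +
      gauss_at k x z * cos (dot y z + c)).
  by rewrite -[gauss_increment k x z]/(_ * (-1 * gauss_at k 0 z + gauss_at k x z)); ring.
under eq_Rintegral do rewrite GE.
have i2 := integrable_add (integrable_scale (- 1) (ic 0)) (ic x).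
rewrite (RintegralZl _ measurableT i2) RintegralD//; last exact: integrable_scale.
rewrite (RintegralZl _ measurableT (ic 0)) !Rintegral_gauss_at_cos//.
rewrite /cosdiff (dotC x y) (dotC 0 y); field.
by rewrite gt_eqF.
Qed.

Lemma fourier_gauss_increment k x xi : 0 < k ->
  fourier (gauss_increment k x) xi = (expR (- (dot xi xi / (4 * k))))%:C * delta_ft x xi.
Proof.
move=> k0; apply/eqP; rewrite eq_complex; apply/andP; split; apply/eqP.
  by rewrite Re_fourier gauss_increment_cos//= mul0r subr0 mulrCA.
by rewrite Im_fourier gauss_increment_cos//= mul0r addr0 mulrCA.
Qed.

(** H < 1 leaves only the zero multi-index, and the remaining integral is the cosine integral at
    frequency 0. *)
Lemma gauss_increment_moment0 (H k : R) x : H < 1 -> 0 < k ->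
  schwartz_moment0 H (gauss_increment k x).
Proof.
move=> H1 k0; split; first exact: schwartz_gauss_increment.
move=> beta bH; have b0 : mdeg beta = 0%N.
  by apply/eqP; rewrite -leqn0 -ltnS -(ltr_nat R); exact: le_lt_trans bH H1.
have bi i : beta i = 0%N.
  by move: b0; rewrite /mdeg => /eqP; rewrite sum_nat_eq0 => /forallP/(_ i)/eqP.
have ME z : monomial beta z = 1 :> R.
  by rewrite /monomial big1// => i _; rewrite bi.
transitivity (\int[mu]_z (gauss_increment k x z * cos (dot 0 z + 0))).
  by apply: eq_Rintegral => z _; rewrite ME dot0l addr0 cos0 mulr1 mul1r.
by rewrite gauss_increment_cos// /cosdiff !dot0r subrr mulr0.
Qed.

Lemma cvg_gauss_rV_small xi :
  expR (- (dot xi xi / (4 * n.+1%:R))) @[n --> \oo] --> (1 : R).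
Proof.
rewrite -[X in _ --> X](@expR0 R); apply: continuous_cvg; first exact: continuous_expR.
rewrite -[X in _ --> X]oppr0; apply: cvgN.
rewrite (_ : (fun n => _) = fun n => dot xi xi / 4 * harmonic n); last first.
  by apply/funext => n; rewrite /harmonic invfM mulrA.
rewrite -[X in _ --> X](mulr0 (dot xi xi / 4)); apply: cvgM; first exact: cvg_cst.
exact: cvg_harmonic.
Qed.

Lemma gauss_small01 (k : R) xi : 0 < k -> 0 <= expR (- (dot xi xi / (4 * k))) <= 1.
Proof.
move=> k0; rewrite expR_ge0 -expR0 ler_expR oppr_le0 divr_ge0 ?dot_ge0//.
by rewrite mulr_ge0// ltW.
Qed.

Variable s : R.
Hypothesis hs : 0 < Hurst d s < 1.

(** This is |e^(-it) - 1|^2 = 2 (1 - cos t), the link to [integral_weight_ncos]. *)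
Lemma normc_delta_ft x xi : ComplexField.Normc.normc (delta_ft x xi) ^+ 2 =
  2 * fourier_cst (d := d) ^+ 2 * ncos x xi.
Proof.
rewrite normc_sqr /= /cosdiff dot0l !add0r cos0 cos_pihalf subr0 cosDpihalf addr0.
have := cos2Dsin2 (dot x xi); rewrite /ncos addr0.
move=> H; have sE : sin (dot x xi) ^+ 2 = 1 - cos (dot x xi) ^+ 2 by rewrite -H; ring.
by rewrite !exprMn sqrrN sE; ring.
Qed.

Lemma weighted_sqnorm_EFin (g : E -> R[i]) : mu.-integrable setT
    (EFin \o (fun xi => fgf_weight s xi * ComplexField.Normc.normc (g xi) ^+ 2)) ->
  weighted_sqnorm s g =
  (\int[mu]_xi (fgf_weight s xi * ComplexField.Normc.normc (g xi) ^+ 2))%:E.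
Proof. exact: integral_EFinE. Qed.

Lemma integrable_weighted_delta x : mu.-integrable setT
  (EFin \o (fun xi => fgf_weight s xi * ComplexField.Normc.normc (delta_ft x xi) ^+ 2)).
Proof.
have [intw _] := integral_weight_ncos hs x.
rewrite (_ : (fun xi => _) = fun xi => 2 * fourier_cst (d := d) ^+ 2 * (fgf_weight s xi
  * ncos x xi)).
  exact: integrable_scale.
by apply/funext => xi; rewrite normc_delta_ft mulrCA.
Qed.

Lemma weighted_sqnorm_delta_lty x : (weighted_sqnorm s (delta_ft x) < +oo)%E.
Proof.
by rewrite (weighted_sqnorm_EFin (integrable_weighted_delta x)) ltry.
Qed.

(** Mollification multiplies the transform by a factor e in [0, 1] tending to 1, so the squared
    error is (1 - e)^2 times the integrable limit, which dominates it. The shift [n.+1] keeps the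
    Gaussian parameter positive. *)
Lemma cvg_weighted_gauss_increment x :
  weighted_sqnorm s (fun xi => fourier (gauss_increment n.+1%:R x) xi - delta_ft x xi)
    @[n --> \oo] --> 0%E.
Proof.
pose e n xi : R := expR (- (dot xi xi / (4 * n.+1%:R))).
pose W xi := fgf_weight s xi * ComplexField.Normc.normc (delta_ft x xi) ^+ 2.
have intW : mu.-integrable setT (EFin \o W) by exact: integrable_weighted_delta.
have e01 n xi : 0 <= e n xi <= 1 by exact: gauss_small01.
have EE n xi : fgf_weight s xi * ComplexField.Normc.normc (fourier (gauss_increment
  n.+1%:R x) xi - delta_ft x xi) ^+ 2 =
    (1 - e n xi) ^+ 2 * W xi.
  rewrite fourier_gauss_increment// /W !normc_sqr -/(e n xi).
  by case: (delta_ft x xi) => a b /=; ring.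
have me n : measurable_fun setT (e n).
  apply: measurableT_comp => //; apply: measurableT_comp => //.
  apply: measurable_funM => //; apply: measurable_sum => i.
  by apply: measurable_funM; exact: measurable_rV_coord.
have mW := integrable_measurable intW.
have m1 n : measurable_fun setT (fun xi => (1 - e n xi) ^+ 2 * W xi).
  by apply: measurable_funM => //; apply: measurable_funX; exact: measurable_funB.
have W0 xi : 0 <= W xi by rewrite mulr_ge0 ?fgf_weight_ge0 ?sqr_ge0.
have b1 n xi : `|(1 - e n xi) ^+ 2 * W xi| <= W xi.
  rewrite (ger0_norm (mulr_ge0 (sqr_ge0 _) (W0 xi))) ler_piMl//.
  by have /andP[] := e01 n xi; nra.
have c1 xi : (1 - e n xi) ^+ 2 * W xi @[n --> \oo] --> (0 : R).
  rewrite -[X in _ --> X](mul0r (W xi)); apply: cvgM; last exact: cvg_cst.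
  have : 1 - e n xi @[n --> \oo] --> (0 : R).
    by rewrite -[X in _ --> X](subrr 1); apply: cvgB;
      [exact: cvg_cst|exact: cvg_gauss_rV_small].
  by move=> h; rewrite -[X in _ --> X](mulr0 (0 : R)); exact: (cvgM h h).
have [_] := @Rintegral_cvg _ _ _ mu _ _ _ m1 c1 intW b1.
rewrite (_ : \int[mu]_x0 0 = 0); last by rewrite /Rintegral integral0.
move=> cv; rewrite (_ : (fun n => weighted_sqnorm s _) =
    EFin \o (fun n => \int[mu]_xi ((1 - e n xi) ^+ 2 * W xi))).
  by apply: cvg_EFin; [exact: nearW|exact: cv].
apply/funext => n /=; rewrite -integral_EFinE.
  by apply: eq_integral => xi _; rewrite -EE.
exact: integrable_dominated (m1 n) (b1 n) intW.
Qed.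

Lemma approximates_gauss_increment x :
  approximates s (fun n => gauss_increment n.+1%:R x) (delta x).
Proof.
split=> [n|].
  by apply: gauss_increment_moment0 => //; case/andP: hs.
exists (delta_ft x); split; first exact: is_fourier_delta.
exact: cvg_weighted_gauss_increment.
Qed.

Lemma Tspace_delta x : Tspace s (delta x).
Proof.
split; last by exists (fun n => gauss_increment n.+1%:R x);
  exact: approximates_gauss_increment.
split; first exact: dual_delta.
exists (delta_ft x); split; first exact: is_fourier_delta.
exact: weighted_sqnorm_delta_lty.
Qed.

End delta_increments.

(** * Convergence in L^2 and the pairing *)

(** Terms may be infinite at first; the instance e = 1 makes them finite from some rank on. *)
Lemma cvge0P (R : realType) (u : nat -> \bar R) : (forall n, 0 <= u n)%E ->
  (forall e : R, 0 < e -> exists N, forall n, (N <= n)%N -> (u n <= e%:E)%E) <->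
  u n @[n --> \oo] --> 0%E.
Proof.
move=> u0; split => [H|/fine_cvgP[fu cu] e e0].
  apply/fine_cvgP; split.
    have [N HN] := H 1 ltr01; exists N => // n /= /HN un.
    by rewrite ge0_fin_numE// (le_lt_trans un)// ltry.
  apply/cvgrPdist_le => e e0; have [N HN] := H e e0.
  exists N => // n /= /HN un; rewrite sub0r normrN ger0_norm ?fine_ge0//.
  by rewrite -lee_fin fineK// ge0_fin_numE// (le_lt_trans un)// ltry.
have /cvgrPdist_le/(_ e e0) ce := cu.
have [N _ HN] : \forall n \near \oo, (u n <= e%:E)%E.
  apply: filterS2 fu ce => n fn; rewrite sub0r normrN /= => ne.
  by rewrite -(fineK fn) lee_fin (le_trans (ler_norm _)).
by exists N.
Qed.

Section L2_completeness.
Context d (T : measurableType d) (R : realType) (P : probability T R).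

(* Weighted AM-GM in place of the Cauchy-Schwarz inequality. *)
Lemma integral_norm_le_sqr (f : T -> R) (e : R) : measurable_fun setT f -> 0 < e ->
  (\int[P]_w (f w ^+ 2)%:E <= (e ^+ 2)%:E)%E ->
  (\int[P]_w `|f w|%:E <= e%:E)%E.
Proof.
move=> mf e0 H.
have mf2 : measurable_fun setT (fun w => (f w ^+ 2)%:E).
  by apply/measurable_EFinP; exact: measurable_funX.
apply: (@le_trans _ _ (\int[P]_w ((e / 2)%:E + ((2 * e)^-1)%:E * (f w ^+ 2)%:E))%E).
  apply: ge0_le_integral => //.
  - by apply/measurable_EFinP; exact: measurableT_comp.
  - by apply: emeasurable_funD => //; exact: emeasurable_funM.
  - move=> w _; rewrite -EFinM -EFinD lee_fin.
    have e20 : 0 < 2 * e by rewrite mulr_gt0.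
    rewrite -(ler_pM2l e20) mulrDr mulrA divff ?gt_eqF// mul1r.
    have -> : 2 * e * (e / 2) = e ^+ 2 by field.
    by rewrite -(real_normK (num_real (f w))); have := sqr_ge0 (`|f w| - e); nra.
rewrite ge0_integralD//; first last.
- exact: emeasurable_funM.
- by move=> w _; rewrite -EFinM lee_fin mulr_ge0 ?sqr_ge0// invr_ge0 mulr_ge0// ltW.
- by move=> w _; rewrite lee_fin divr_ge0// ltW.
rewrite ge0_integralZl//; last 2 first.
- by move=> w _; rewrite lee_fin sqr_ge0.
- by rewrite lee_fin invr_ge0 mulr_ge0// ltW.
have -> : (\int[P]_w (e / 2)%:E = (e / 2)%:E)%E.
  rewrite integral_cst//; transitivity ((e / 2)%:E * 1)%E; last by rewrite mule1.
  by congr (_ * _)%E; exact: probability_setT.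
have e2 : (0 <= ((2 * e)^-1)%:E)%E by rewrite lee_fin invr_ge0 mulr_ge0// ltW.
apply: (@le_trans _ _ ((e / 2)%:E + ((2 * e)^-1)%:E * (e ^+ 2)%:E)%E).
  by rewrite leeD2l// lee_wpmul2l.
rewrite -EFinM -EFinD lee_fin le_eqVlt; apply/orP; left; apply/eqP.
by field; rewrite gt_eqF.
Qed.

Lemma limn_einf_le (u : nat -> \bar R) (x : \bar R) :
  (\forall n \near \oo, u n <= x)%E -> (limn_einf u <= x)%E.
Proof.
move=> ux; rewrite limn_einf_lim; apply: lime_le; first exact: is_cvg_einfs.
apply: filterS ux => n; apply: le_trans; apply: ereal_inf_lbound.
by exists n => /=.
Qed.

Variable X_ : nat -> T -> R.
Hypothesis mX_ : forall n, measurable_fun setT (X_ n).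
Hypothesis cauchyX : forall e : R, 0 < e -> exists N, forall n m, (N <= n)%N -> (N <=
  m)%N ->
  (\int[P]_w ((X_ n w - X_ m w) ^+ 2)%:E <= e%:E)%E.

(** Riesz-Fischer: along a fast subsequence the increments have summable L^1 norms, so it converges
    almost everywhere; Fatou's lemma then gives the convergence of the whole sequence in L^2. *)
Lemma L2_complete : exists X : {mfun T >-> R},
  (\int[P]_w ((X_ n w - X w) ^+ 2)%:E @[n --> \oo] --> 0)%E.
Proof.
have h0 k : 0 < (2^-1 ^+ k : R) by rewrite exprn_gt0// invr_gt0.
(* The Cauchy condition is used at (2^-k)^2, since it bounds squared norms. *)
have [N HN] := choice (fun k => cauchyX (exprn_gt0 2 (h0 k))).
(* A partial sum dominates each of its terms, so [phi k] is beyond every [N j] with j <= k. *)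
pose phi k := (\sum_(j < k.+1) N j)%N.
have phiN j k : (j <= k)%N -> (N j <= phi k)%N.
  move=> jk; rewrite /phi (bigD1 (Ordinal (jk : (j < k.+1)%N)))//=.
  exact: leq_addr.
pose Y k := X_ (phi k).
have mY k : measurable_fun setT (Y k) by exact: mX_.
pose D k w : R := Y k.+1 w - Y k w.
have mD k : measurable_fun setT (D k) by exact: measurable_funB.
have mDE k : measurable_fun setT (fun w => `|D k w|%:E).
  by apply/measurable_EFinP; exact: measurableT_comp.
have D0 k w : (0 <= `|D k w|%:E)%E by rewrite lee_fin.
have intD k : (\int[P]_w `|D k w|%:E <= (2 / (2 ^ k.+1)%:R)%:E)%E.
  have -> : 2 / (2 ^ k.+1)%:R = 2^-1 ^+ k :> R.
    by rewrite natrX exprS invfM mulrA divff// mul1r exprVn.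
  apply: integral_norm_le_sqr => //; apply: HN; apply: phiN => //.
have sumD : (\int[P]_w \sum_(0 <= k <oo) `|D k w|%:E < +oo)%E.
  rewrite integral_nneseries//.
  apply: (@le_lt_trans _ _ 2%:E); last exact: ltry.
  apply: (@le_trans _ _ (\sum_(0 <= k <oo) (0 + (2 / (2 ^ k.+1)%:R)%:E))%E).
    apply: lee_nneseries => [k _ _|k _]; first exact: integral_ge0.
    by rewrite add0e.
  apply: le_trans (@epsilon_trick _ (fun=> 0%E) 2 predT _ _) _ => //.
  by rewrite eseries0// add0e.
have aeC : {ae P, forall w, cvgn (fun k => Y k w)}.
  have intS : P.-integrable setT (fun w => \sum_(0 <= k <oo) `|D k w|%:E)%E.
    apply/integrableP; split.
      by apply: ge0_emeasurable_sum => // k w _ _; exact: D0.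
    under eq_integral => w _ do rewrite gee0_abs ?nneseries_ge0//.
    exact: sumD.
  apply: filterS (integrable_ae measurableT intS) => w /(_ Logic.I) fin.
  have cvD : cvgn (series (fun k => D k w)).
    apply: normed_cvg; apply: nondecreasing_is_cvgn.
      by apply: nondecreasing_series => k _ _; exact: normr_ge0.
    exists (fine (\sum_(0 <= k <oo) `|D k w|%:E)%E) => _ [n _ <-].
    rewrite -lee_fin fineK//= /series/= -sumEFin.
    by apply: nneseries_lim_ge => k _ _; exact: D0.
  have -> : (fun k => Y k w) = (fun k => Y 0%N w + series (fun k => D k w) k).
    apply/funext => k; rewrite /series/= /D telescope_sumr//.
    by rewrite addrC subrK.
  by apply: is_cvgD => //; exact: is_cvg_cst.
(* The upper limit is measurable everywhere, including on the null set where the subsequence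
   diverges. *)
pose X w := fine (limn_esup (fun k => (Y k w)%:E)).
have mX : measurable_fun setT X.
  apply: (measurableT_comp (fine_measurable measurableT)).
  by apply: measurable_fun_limn_esup => k; exact/measurable_EFinP.
have XE w : cvgn (fun k => Y k w) -> Y k w @[k --> \oo] --> X w.
  move=> cY; have cE : (Y k w)%:E @[k --> \oo] --> (limn (fun k => Y k w))%:E.
    by apply: cvg_EFin; [exact: nearW|exact: cY].
  by rewrite /X (cvg_limn_einf_sup cE).2/=.
(* Fatou's lemma as k tends to infinity in the Cauchy bound between [X_ n] and [Y k]. *)
have le4 j n : (N j <= n)%N ->
    (\int[P]_w ((X_ n w - X w) ^+ 2)%:E <= (2^-1 ^+ j ^+ 2)%:E)%E.
  move=> jn.
  have mnk k : measurable_fun setT (fun w => ((X_ n w - Y k w) ^+ 2)%:E).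
    apply/measurable_EFinP; apply: measurable_funX; exact: measurable_funB.
  apply: (@le_trans _ _ (\int[P]_w limn_einf (fun k => ((X_ n w - Y k w) ^+ 2)%:E))%E).
    rewrite le_eqVlt; apply/orP; left; apply/eqP; apply: ae_eq_integral => //.
    - by apply/measurable_EFinP; apply: measurable_funX; exact: measurable_funB.
    - under eq_fun do rewrite -[limn_einf _]oppeK -limn_esupN.
      apply: measurableT_comp => //; apply: measurable_fun_limn_esup => k.
      exact: measurableT_comp.
    apply: filterS aeC => w /XE cY _.
    have cE : ((X_ n w - Y k w) ^+ 2)%:E @[k --> \oo] --> ((X_ n w - X w) ^+ 2)%:E.
      apply: cvg_EFin; first exact: nearW.
      have h : X_ n w - Y k w @[k --> \oo] --> X_ n w - X w.
        by apply: cvgB => //; exact: cvg_cst.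
      exact: (cvgM h h).
    by rewrite (cvg_limn_einf_sup cE).1.
  apply: le_trans (fatou P measurableT mnk _) _.
    by move=> k w _; rewrite lee_fin sqr_ge0.
  apply: limn_einf_le; exists j => // k /= jk.
  by apply: HN => //; exact: phiN.
exists (mfun_Sub (mem_set mX)).
apply/cvge0P => [n|e e0].
  by apply: integral_ge0 => w _; rewrite lee_fin sqr_ge0.
have [j _ hj] : \forall j \near \oo, (2^-1 ^+ j ^+ 2 : R) <= e.
  have /cvgrPdist_le/(_ e e0) : 2^-1 ^+ j @[j --> \oo] --> (0 : R).
    by apply: cvg_expr; rewrite ger0_norm// invf_lt1 ?ltr1n.
  apply: filterS => j; rewrite sub0r normrN ger0_norm ?(ltW (h0 _))// => h.
  rewrite (le_trans _ h)// expr2 ler_piMr ?(ltW (h0 _))//.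
  by rewrite exprn_ile1// invf_le1 ?ler1n.
exists (N j) => n jn; apply: le_trans (le4 _ _ jn) _.
by rewrite lee_fin; exact: (hj j (leqnn j)).
Qed.

End L2_completeness.

Section L2_convergence.
Context d (T : measurableType d) (R : realType) (P : probability T R).

Definition L2_cvg (X_ : nat -> T -> R) (X : T -> R) :=
  (\int[P]_w ((X_ n w - X w) ^+ 2)%:E)%E @[n --> \oo] --> 0%E.

Lemma cvge0_le_add (u v w : nat -> \bar R) (a b : R) : 0 <= a -> 0 <= b ->
  (forall n, 0 <= u n)%E -> (forall n, 0 <= v n)%E -> (forall n, 0 <= w n)%E ->
  (forall n, w n <= a%:E * u n + b%:E * v n)%E ->
  u n @[n --> \oo] --> 0%E -> v n @[n --> \oo] --> 0%E -> w n @[n --> \oo] --> 0%E.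
Proof.
move=> a0 b0 u0 v0 w0 wuv /(cvge0P u0) cu /(cvge0P v0) cv; apply/cvge0P => // e e0.
(* Dividing by a + 1 and b + 1 also covers zero coefficients. *)
have a1 : 0 < 2 * (a + 1) by rewrite mulr_gt0// ltr_wpDl.
have b1 : 0 < 2 * (b + 1) by rewrite mulr_gt0// ltr_wpDl.
have [N1 H1] := cu _ (divr_gt0 e0 a1); have [N2 H2] := cv _ (divr_gt0 e0 b1).
exists (maxn N1 N2) => n; rewrite geq_max => /andP[n1 n2].
have half (c : R) : 0 <= c -> c * (e / (2 * (c + 1))) <= e / 2.
  move=> c0; have c1 : 0 < c + 1 by rewrite ltr_wpDl.
  rewrite mulrA ler_pdivrMr ?mulr_gt0//.
  have -> : e / 2 * (2 * (c + 1)) = c * e + e by field.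
  by rewrite lerDl ltW.
apply: le_trans (wuv n) _; rewrite (splitr e) EFinD; apply: leeD.
  apply: le_trans (_ : _ <= a%:E * (e / (2 * (a + 1)))%:E)%E _.
    by rewrite lee_wpmul2l ?lee_fin// H1.
  by rewrite -EFinM lee_fin half.
apply: le_trans (_ : _ <= b%:E * (e / (2 * (b + 1)))%:E)%E _.
  by rewrite lee_wpmul2l ?lee_fin// H2.
by rewrite -EFinM lee_fin half.
Qed.

Lemma integral_sqr_add_le (f g : T -> R) (a : R) :
  measurable_fun setT f -> measurable_fun setT g ->
  (\int[P]_w ((a * f w + g w) ^+ 2)%:E <=
   (2 * a ^+ 2)%:E * \int[P]_w (f w ^+ 2)%:E + 2%:E * \int[P]_w (g w ^+ 2)%:E)%E.
Proof.
move=> mf mg; have mf2 : measurable_fun setT (fun w => (f w ^+ 2)%:E).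
  by apply/measurable_EFinP; exact: measurable_funX.
have mg2 : measurable_fun setT (fun w => (g w ^+ 2)%:E).
  by apply/measurable_EFinP; exact: measurable_funX.
have a0 : 0 <= 2 * a ^+ 2 by rewrite mulr_ge0 ?sqr_ge0.
rewrite -!ge0_integralZl//; try by move=> w _; rewrite lee_fin sqr_ge0.
rewrite -ge0_integralD//; first last.
- exact: emeasurable_funM.
- by move=> w _; rewrite mule_ge0// lee_fin sqr_ge0.
- exact: emeasurable_funM.
- by move=> w _; rewrite mule_ge0// lee_fin ?sqr_ge0.
apply: ge0_le_integral => //.
- by move=> w _; rewrite lee_fin sqr_ge0.
- apply/measurable_EFinP; apply: measurable_funX; apply: measurable_funD => //.
  exact: measurable_funM.
- by apply: emeasurable_funD; exact: emeasurable_funM.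
- move=> w _; rewrite -!EFinM -EFinD lee_fin.
  by have := sqr_ge0 (a * f w - g w); nra.
Qed.

Lemma L2_cvg_lin (a : R) (X_ Y_ : nat -> T -> R) (X Y : T -> R) :
  (forall n, measurable_fun setT (X_ n)) -> measurable_fun setT X ->
  (forall n, measurable_fun setT (Y_ n)) -> measurable_fun setT Y ->
  L2_cvg X_ X -> L2_cvg Y_ Y ->
  L2_cvg (fun n w => a * X_ n w + Y_ n w) (fun w => a * X w + Y w).
Proof.
move=> mX_ mX mY_ mY cX cY.
apply: (@cvge0_le_add _ _ _ (2 * a ^+ 2) 2 _ _ _ _ _ _ cX cY) => //.
- by rewrite mulr_ge0 ?sqr_ge0.
- by move=> n; apply: integral_ge0 => w _; rewrite lee_fin sqr_ge0.
- by move=> n; apply: integral_ge0 => w _; rewrite lee_fin sqr_ge0.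
- by move=> n; apply: integral_ge0 => w _; rewrite lee_fin sqr_ge0.
move=> n; apply: le_trans (integral_sqr_add_le a _ _).
- rewrite le_eqVlt; apply/orP; left; apply/eqP; apply: eq_integral => w _.
  by congr (_ ^+ 2)%:E; ring.
- exact: measurable_funB.
- exact: measurable_funB.
Qed.

Lemma L2_cvg_shift (X_ Y_ : nat -> T -> R) (X : T -> R) :
  (forall n, measurable_fun setT (X_ n)) -> (forall n, measurable_fun setT (Y_ n)) ->
  measurable_fun setT X -> L2_cvg X_ X ->
  (\int[P]_w ((Y_ n w - X_ n w) ^+ 2)%:E)%E @[n --> \oo] --> 0%E -> L2_cvg Y_ X.
Proof.
move=> mX_ mY_ mX cX cYX.
apply: (@cvge0_le_add _ _ _ (2 * 1 ^+ 2) 2 _ _ _ _ _ _ cYX cX) => //.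
- by move=> n; apply: integral_ge0 => w _; rewrite lee_fin sqr_ge0.
- by move=> n; apply: integral_ge0 => w _; rewrite lee_fin sqr_ge0.
- by move=> n; apply: integral_ge0 => w _; rewrite lee_fin sqr_ge0.
move=> n; apply: le_trans (integral_sqr_add_le 1 _ _).
- rewrite le_eqVlt; apply/orP; left; apply/eqP; apply: eq_integral => w _.
  by congr (_ ^+ 2)%:E; ring.
- exact: measurable_funB.
- exact: measurable_funB.
Qed.

Lemma cos_lipschitz (x y : R) : `|cos x - cos y| <= `|x - y|.
Proof.
wlog xy : x y / x <= y => [H|].
  have [|/ltW] := leP x y; first exact: H.
  by move=> /H; rewrite distrC (distrC y).
have dcos z : z \in `]x, y[ -> is_derive z 1 (@cos R) (- sin z) by move=> _;
  exact: is_derive_cos.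
have [|c _ cE] := MVT_segment xy dcos.
  by apply: continuous_subspaceT; exact: continuous_cos.
rewrite distrC cE normrM normrN (distrC x) ler_piMl//; exact: sin_max.
Qed.

(** The cosine is 1-Lipschitz and, on a probability space, the L^1 norm is controlled by the L^2
    norm. *)
Lemma L2_cvg_cos (X_ : nat -> T -> R) (X : T -> R) (b : R) :
  (forall n, measurable_fun setT (X_ n)) -> measurable_fun setT X -> L2_cvg X_ X ->
  (\int[P]_w cos (X_ n w + b)) @[n --> \oo] --> \int[P]_w cos (X w + b).
Proof.
move=> mX_ mX cX; apply/cvgrPdist_le => e e0.
have mcos (Z : T -> R) : measurable_fun setT Z -> measurable_fun setT (fun w => cos (Z
  w + b)).
  by move=> mZ; apply: (measurableT_comp (@measurable_cos R)); exact: measurable_funD.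
have icos (Z : T -> R) : measurable_fun setT Z -> P.-integrable setT (EFin \o (fun w =>
  cos (Z w + b))).
  by move=> mZ; apply: (@integrable_bounded _ _ _ _ _ 1); [exact: mcos|move=> w;
    exact: cos_max].
have /cvge0P : (\int[P]_w ((X_ n w - X w) ^+ 2)%:E)%E @[n --> \oo] --> 0%E := cX.
have sq0 n : (0 <= \int[P]_w ((X_ n w - X w) ^+ 2)%:E)%E.
  by apply: integral_ge0 => w _; rewrite lee_fin sqr_ge0.
move=> /(_ sq0)/(_ (e ^+ 2)); rewrite exprn_gt0// => /(_ isT)[N HN].
exists N => // n /= /HN Hn.
have mD : measurable_fun setT (fun w => X_ n w - X w) by exact: measurable_funB.
have le1 := integral_norm_le_sqr mD e0 Hn.
have iB : P.-integrable setT (EFin \o (fun w => cos (X w + b) - cos (X_ n w + b))).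
  by apply: (@integrable_bounded _ _ _ _ _ 2);
    [apply: measurable_funB; exact: mcos|move=> w;
      rewrite (le_trans (ler_normB _ _))// -[leRHS]/(1 + 1) lerD//; exact: cos_max].
rewrite -RintegralB//; [|exact: icos..].
rewrite -lee_fin -abse_EFin -integral_EFinE//.
apply: le_trans (le_abse_integral _ measurableT _) _.
  exact: measurable_int iB.
apply: le_trans le1; apply: ge0_le_integral => //.
- by apply: measurableT_comp => //; exact: measurable_int iB.
- by apply/measurable_EFinP; exact: measurableT_comp.
- move=> w _; rewrite /= lee_fin distrC (le_trans (cos_lipschitz _ _))//.
  by rewrite opprD addrACA subrr addr0.
Qed.

End L2_convergence.

(** * The isometry of the field and its pairing with delta_x - delta_0 *)

Section fgf_pairing.
Context {R : realType} {d : nat} {dO : measure_display}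
  {Omega : measurableType dO} (P : probability Omega R).
Local Notation E := 'rV[R]_d.
Local Notation mu := (@lebesgue_rV R d).
Local Notation delta x := (delta_distr (x : E) - delta_distr 0).
Variables (s : R) (h : Omega -> (E -> R) -> R).
Hypothesis hs : 0 < Hurst d s < 1.
Hypothesis hh : is_FGF P s h.

Lemma FGF_measurable f : schwartz_moment0 (Hurst d s) f ->
  measurable_fun setT (fun w => h w f).
Proof. by case: hh => _ /[apply]-[]. Qed.

Lemma FGF_lin (a : R) f g w : schwartz_moment0 (Hurst d s) f ->
  schwartz_moment0 (Hurst d s) g -> h w (a *: f + g) = a * h w f + h w g.
Proof. by move=> sf sg; case: hh => /(_ w)[+ _] _; apply. Qed.

Lemma FGF_isometry f : schwartz_moment0 (Hurst d s) f ->
  (\int[P]_w (h w f ^+ 2)%:E)%E = weighted_sqnorm s (fourier f).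
Proof.
move=> sf; case: hh => _ /(_ _ sf)[mh [v [vE law]]].
have v0 : 0 <= v by rewrite -lee_fin -vE weighted_sqnorm_ge0.
rewrite vE; have := normal_law_sqr mh v0 law 0.
rewrite add0r expr0n/= addr0 => <-; apply: eq_integral => w _.
by rewrite addr0.
Qed.

(** By linearity the difference is the value of [h] at one test function, so the one-function
    isometry is enough. *)
Lemma FGF_isometryB f g : schwartz_moment0 (Hurst d s) f ->
  schwartz_moment0 (Hurst d s) g -> (\int[P]_w ((h w f - h w g) ^+ 2)%:E)%E =
  weighted_sqnorm s (fun xi => fourier f xi - fourier g xi).
Proof.
move=> sf sg; have sgf := schwartz_moment0_lin (- 1) sg sf.
rewrite [RHS](_ : _ = weighted_sqnorm s (fourier ((- 1) *: g + f))).
  rewrite -FGF_isometry//; apply: eq_integral => w _.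
  by rewrite FGF_lin// mulN1r addrC.
congr weighted_sqnorm; apply/funext => xi; rewrite (fourier_lin _ _ sg.1 sf.1).
by rewrite addrC; congr (_ + _); case: (fourier g xi) => a b; apply/eqP;
  rewrite eq_complex/=; apply/andP; split; apply/eqP; ring.
Qed.

Lemma cmeasurable_fourier (f : E -> R) : schwartz_moment0 (Hurst d s) f ->
  cmeasurable (fourier f).
Proof. by case=> sf _; apply: measurable_fourier; exact: schwartz_measurable. Qed.

Lemma cvg_weighted_sqnorm_sub (g : E -> R[i]) (f_ g_ : nat -> E -> R[i]) :
  cmeasurable g -> (forall n, cmeasurable (f_ n)) -> (forall n, cmeasurable (g_ n)) ->
  weighted_sqnorm s (fun xi => f_ n xi - g xi) @[n --> \oo] --> 0%E ->
  weighted_sqnorm s (fun xi => g_ n xi - g xi) @[n --> \oo] --> 0%E ->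
  weighted_sqnorm s (fun xi => f_ n xi - g_ n xi) @[n --> \oo] --> 0%E.
Proof.
move=> mg mf_ mg_ cf cg.
apply: (@cvge0_le_add _ _ _ _ 2 2 _ _ _ _ _ _ cf cg) => // n.
- exact: weighted_sqnorm_ge0.
- exact: weighted_sqnorm_ge0.
- exact: weighted_sqnorm_ge0.
- exact: weighted_sqnorm_sub_le.
Qed.

(** [approximates] allows some Fourier transform g of the limit, depending on the sequence;
    uniqueness almost everywhere replaces it by [delta_ft x], common to all sequences. *)
Lemma approximates_weighted x phi : approximates s phi (delta x) ->
  weighted_sqnorm s (fun xi => fourier (phi n) xi - delta_ft x xi) @[n --> \oo] --> 0%E.
Proof.
move=> [sphi [g [fg cg]]].
have ae := is_fourier_unique fg (is_fourier_delta x).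
rewrite (_ : (fun n => _) = fun n => weighted_sqnorm s (fun xi => fourier (phi n) xi -
  g xi)) //.
apply/funext => n; apply/esym/weighted_sqnorm_ae => //;
  [exact: cmeasurable_fourier|by case: fg|].
exact: cmeasurable_delta_ft.
Qed.

(** It suffices to exhibit one admissible variable. The limit is built along the Gaussian
    increments; for any other sequence the difference tends to 0 in L^2 by isometry, both transforms
    having the same limit. *)
Lemma is_pairing_delta x : is_pairing s h (delta x) (pairing P s h (delta x)).
Proof.
apply: xgetPex; pose phi n := @gauss_increment R d n.+1%:R x.
have ap : approximates s phi (delta x) by exact: approximates_gauss_increment.
have cphi := approximates_weighted ap; have sphi := ap.1.
have mphi n : measurable_fun setT (fun w => h w (phi n)) by exact: FGF_measurable.
have [e e0|X XE] := L2_complete (P := P) mphi.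
  have /cvge0P : weighted_sqnorm s (fun xi => fourier (phi n) xi - delta_ft x xi) @[n
    --> \oo] --> 0%E := cphi.
  (* Each of the two terms of [weighted_sqnorm_sub_le] carries a factor 2, hence e/4. *)
  move=> /(_ (fun n => weighted_sqnorm_ge0 _ _))/(_ (e / 4));
    rewrite divr_gt0// => /(_ isT)[N HN].
  exists N => n m /HN Hn /HN Hm; rewrite FGF_isometryB//.
  apply: le_trans (weighted_sqnorm_sub_le s (cmeasurable_delta_ft x) _ _) _.
  - exact: cmeasurable_fourier.
  - exact: cmeasurable_fourier.
  have two0 : (0 <= 2%:E :> \bar R)%E by rewrite lee_fin.
  apply: le_trans (leeD (lee_wpmul2l two0 Hn) (lee_wpmul2l two0 Hm)) _.
  by rewrite -!EFinM -EFinD lee_fin; lra.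
exists X; split; first exact: Tspace_delta.
move=> psi ap'; have spsi := ap'.1.
apply: (@L2_cvg_shift _ _ _ P (fun n w => h w (phi n)) (fun n w => h w (psi n)) X) => //.
  by move=> n; exact: FGF_measurable.
rewrite (_ : (fun n => _) = fun n => weighted_sqnorm s (fun xi => fourier (psi n) xi -
  fourier (phi n) xi)).
  have mf (f : nat -> E -> R) : (forall n, schwartz_moment0 (Hurst d s) (f n)) ->
      forall n, cmeasurable (fourier (f n)) by move=> sf n; exact: cmeasurable_fourier.
  exact: (cvg_weighted_sqnorm_sub (cmeasurable_delta_ft x) (mf _ spsi) (mf _ sphi)
    (approximates_weighted ap') cphi).
by apply/funext => n; rewrite FGF_isometryB.
Qed.

Lemma L2_cvg_pairing x : L2_cvg P (fun n w => h w (gauss_increment n.+1%:R x))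
  (pairing P s h (delta x)).
Proof. exact: (is_pairing_delta x).2 (approximates_gauss_increment hs x). Qed.

End fgf_pairing.

Lemma integrable_Rintegral_sum d (T : measurableType d) (R : realType)
    (mu : {measure set T -> \bar R}) (J : Type) (r : seq J) (F : J -> T -> R) :
  (forall j, mu.-integrable setT (EFin \o F j)) ->
  mu.-integrable setT (EFin \o (fun w => \sum_(j <- r) F j w)) /\
  \int[mu]_w (\sum_(j <- r) F j w) = \sum_(j <- r) \int[mu]_w F j w.
Proof.
move=> iF; elim: r => [|j r [IHi IHe]].
  have E0 : (fun w => \sum_(j <- [::]) F j w) = (fun _ : T => 0 : R).
    by apply/funext => w; rewrite big_nil.
  rewrite E0 big_nil; split; first exact: integrable0.
  by rewrite /Rintegral integral0.
have EE : (fun w => \sum_(k <- j :: r) F k w) = (fun w => F j w + \sum_(k <- r) F k w).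
  by apply/funext => w; rewrite big_cons.
rewrite EE big_cons -IHe; split; first exact: integrable_add.
by rewrite RintegralD.
Qed.

(** * Cosine expectations for fractional Brownian motion *)

Section gaussian_combinations.
Context {R : realType} {d : nat}.
Local Notation E := 'rV[R]_d.

Definition fBM_cov (H : R) (x y : E) : R :=
  2^-1 * (enorm x `^ (2 * H) + enorm y `^ (2 * H) - enorm (x - y) `^ (2 * H)).

Definition fBM_var (H : R) (S : seq (R * E)) : R :=
  \sum_(q <- S) \sum_(r <- S) q.1 * r.1 * fBM_cov H q.2 r.2.

Lemma fBM_var_scale H c S : fBM_var H [seq (c * q.1, q.2) | q <- S] =
  c ^+ 2 * fBM_var H S.
Proof.
rewrite /fBM_var big_map mulr_sumr; apply: eq_bigr => q _.
rewrite big_map mulr_sumr; apply: eq_bigr => r _ /=; ring.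
Qed.

(** [gaussian_process] gives a normal law with unspecified parameters for each combination; they are
    identified by computing its second moment, and that of its translates, from the means and
    covariances. *)
Lemma fBM_cos (dO : measure_display) (T : measurableType dO) (P : probability T R)
    (H : R) (B : E -> {RV P >-> R}) (S : seq (R * E)) (b : R) : is_fBM H B ->
  \int[P]_w cos ((\sum_(q <- S) q.1 * B q.2 w) + b) = expR (- (fBM_var H S / 2)) * cos b.
Proof.
move=> [gB mean cov].
have [m [v [v0 law]]] := gB (size S) (fun i => (tnth (in_tuple S) i).2)
  (fun i => (tnth (in_tuple S) i).1).
pose Z w : R := \sum_(q <- S) q.1 * B q.2 w.
have ZE : (fun w => \sum_(i < size S) (tnth (in_tuple S) i).1 *
    B (tnth (in_tuple S) i).2 w) = Z.
  by apply/funext => w; rewrite /Z [RHS]big_tnth.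
rewrite {}ZE in law.
have mB x : measurable_fun setT (B x) by [].
have mZ : measurable_fun setT Z by apply: measurable_sum => q; exact: measurable_funM.
have covE x y : (\int[P]_w (B x w * B y w)%:E = (fBM_cov H x y)%:E)%E.
  by have := cov x y; rewrite unlock.
(* The covariance at x = y is a finite integral of a nonnegative function; square integrability,
   then that of [B x] and of all products, follows. *)
have iB2 x : P.-integrable setT (EFin \o (fun w => B x w * B x w)).
  apply/integrableP; split; first by apply/measurable_EFinP; exact: measurable_funM.
  under eq_integral => w _ do rewrite gee0_abs ?lee_fin -?expr2 ?sqr_ge0//.
  by rewrite -[X in (X < _)%E]/(\int[P]_w (B x w * B x w)%:E)%E covE ltry.
have iB x : P.-integrable setT (EFin \o B x).
  apply: (@integrable_dominated _ _ _ P _ (fun w => 1 + B x w * B x w)) => //.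
    by move=> w; rewrite -expr2 -(real_normK (num_real (B x w)));
      have := sqr_ge0 (`|B x w| - 1); nra.
  apply: integrable_add => //.
  by apply: (@integrable_bounded _ _ _ _ _ 1) => // w; rewrite normr1.
have iBB x y : P.-integrable setT (EFin \o (fun w => B x w * B y w)).
  apply: (@integrable_dominated _ _ _ P _ (fun w => B x w * B x w + B y w * B y w)).
  - exact: measurable_funM.
  - move=> w; rewrite ler_norml; apply/andP; split.
      by have := sqr_ge0 (B x w + B y w); have := sqr_ge0 (B x w);
        have := sqr_ge0 (B y w); nra.
    by have := sqr_ge0 (B x w - B y w); have := sqr_ge0 (B x w);
      have := sqr_ge0 (B y w); nra.
  exact: integrable_add.
have RB x : \int[P]_w B x w = 0.
  by have := mean x; rewrite unlock integral_EFinE// => -[].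
have RBB x y : \int[P]_w (B x w * B y w) = fBM_cov H x y.
  by have := covE x y; rewrite integral_EFinE// => -[].
have [iZ RZ] := integrable_Rintegral_sum S (fun q => integrable_scale q.1 (iB q.2)).
have Z0 : \int[P]_w Z w = 0.
  rewrite RZ big1// => q _.
  by rewrite (RintegralZl _ measurableT (iB q.2)) RB mulr0.
have iQ q r : P.-integrable setT (EFin \o (fun w => q.1 * r.1 * (B q.2 w * B r.2 w))).
  exact: integrable_scale.
have [iZZ RZZ] := integrable_Rintegral_sum S (fun q => (integrable_Rintegral_sum S (iQ
  q)).1).
have Z2E : (fun w => \sum_(q <- S) \sum_(r <- S) q.1 * r.1 * (B q.2 w * B r.2 w)) =
  (fun w => Z w ^+ 2).
  apply/funext => w; rewrite expr2 /Z big_distrlr/=.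
  by apply: eq_bigr => q _; apply: eq_bigr => r _; rewrite mulrACA.
rewrite Z2E in iZZ RZZ.
have Z2 : \int[P]_w (Z w ^+ 2) = fBM_var H S.
  rewrite RZZ; apply: eq_bigr => q _; rewrite (integrable_Rintegral_sum S (iQ q)).2.
  by apply: eq_bigr => r _; rewrite (RintegralZl _ measurableT (iBB _ _)) RBB.
have sqE c : v + (m + c) ^+ 2 = fBM_var H S + c ^+ 2.
  apply: EFin_inj; rewrite -(normal_law_sqr mZ v0 law c).
  have EE : (fun w => (Z w + c) ^+ 2) = (fun w => Z w ^+ 2 + (2 * c * Z w + c ^+ 2)).
    by apply/funext => w; ring.
  have i3 : P.-integrable setT (EFin \o (fun=> c ^+ 2)).
    by apply: (@integrable_bounded _ _ _ _ _ (`|c ^+ 2|)).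
  have i2 := integrable_scale (2 * c) iZ.
  have i1 := integrable_add iZZ (integrable_add i2 i3).
  rewrite (_ : (\int[P]_w ((Z w + c) ^+ 2)%:E)%E = (\int[P]_w (Z w ^+ 2 + (2 * c * Z w
    + c ^+ 2)))%:E).
    rewrite RintegralD//; last exact: integrable_add.
    rewrite RintegralD// Z2 (RintegralZl _ measurableT iZ) Z0 mulr0 add0r.
    by rewrite Rintegral_prob_cst.
  rewrite -(integral_EFinE i1); apply: eq_integral => w _.
  by rewrite (congr1 (fun f => f w) EE).
(* Subtracting the identities at c = 0 and c = 1 leaves 2m = 0. *)
have m0 : m = 0 by have := sqE 0; have := sqE 1; rewrite !expr2; lra.
have vE : v = fBM_var H S by have := sqE 0; rewrite m0 addr0 expr0n/= !addr0.
by rewrite (normal_law_cos mZ v0 law b) m0 vE add0r.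
Qed.

End gaussian_combinations.

(** * Cosine expectations for the field at increments of Dirac masses *)

Section fgf_combinations.
Context {R : realType} {d : nat}.
Local Notation E := 'rV[R]_d.
Local Notation mu := (@lebesgue_rV R d).
Local Notation delta x := (delta_distr (x : E) - delta_distr 0).
Local Notation fc := (@fourier_cst R d).
Implicit Types (S : seq (R * E)) (xi : E).
Variable s : R.
Hypothesis hs : 0 < Hurst d s < 1.

Local Notation S_H := (@schwartz_moment0 R d (Hurst d s)).

Definition comb (phi : E -> E -> R) S : E -> R :=
  foldr (fun q f => q.1 *: phi q.2 + f) 0 S.

(** A member of S_H through which the zero function is written as -g0 + g0: its membership, its
    transform and its image under [h] then follow from linearity. *)
Let g0 : E -> R := gauss_increment 1 0.

Let S_H_g0 : S_H g0.
Proof. by apply: gauss_increment_moment0 => //; case/andP: hs. Qed.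

Let zeroE : (- 1) *: g0 + g0 = 0. Proof. by rewrite scaleN1r addNr. Qed.

Lemma comb_moment0 phi S : (forall x, S_H (phi x)) -> S_H (comb phi S).
Proof.
move=> sphi; elim: S => [|q S IH] /=; last exact: schwartz_moment0_lin.
by rewrite -zeroE; exact: schwartz_moment0_lin.
Qed.

Local Open Scope complex_scope.

Lemma fourier_comb phi S xi : (forall x, S_H (phi x)) ->
  fourier (comb phi S) xi = \sum_(q <- S) q.1%:C * fourier (phi q.2) xi.
Proof.
move=> sphi; elim: S => [|q S IH] /=.
  rewrite big_nil -zeroE (fourier_lin _ _ S_H_g0.1 S_H_g0.1).
  by case: (fourier g0 xi) => a b; apply/eqP;
    rewrite eq_complex/=; apply/andP; split; apply/eqP; ring.
rewrite big_cons -IH fourier_lin//; first by case: (sphi q.2).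
by case: (comb_moment0 S sphi).
Qed.

Lemma FGF_comb (dO : measure_display) (T : measurableType dO) (P : probability T R)
    (h : T -> (E -> R) -> R) phi S w : is_FGF P s h -> (forall x, S_H (phi x)) ->
  h w (comb phi S) = \sum_(q <- S) q.1 * h w (phi q.2).
Proof.
move=> hh sphi; elim: S => [|q S IH] /=.
  by rewrite big_nil -zeroE (FGF_lin hh)// mulN1r addNr.
by rewrite big_cons -IH (FGF_lin hh)//; exact: comb_moment0.
Qed.

(** The same quadratic form as [fBM_var], with [ncos x] in place of |x|^(2H) and without the factor
    1/2; integrating against the weight exchanges the two. *)
Definition delta_quad S xi : R := \sum_(q <- S) \sum_(r <- S)
  q.1 * r.1 * (ncos q.2 xi + ncos r.2 xi - ncos (q.2 - r.2) xi).

(* [(e^(-ia) - 1) conj(e^(-ib) - 1)] has real part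
   [(1 - cos a) + (1 - cos b) - (1 - cos (a - b))]. *)
Lemma normc_delta_comb S xi :
  ComplexField.Normc.normc (\sum_(q <- S) q.1%:C * delta_ft q.2 xi) ^+ 2 =
  fc ^+ 2 * delta_quad S xi.
Proof.
have RE : complex.Re (\sum_(q <- S) q.1%:C * delta_ft q.2 xi) =
    \sum_(q <- S) q.1 * (fc * cosdiff q.2 0 xi).
  elim: S => [|q S IH]; first by rewrite !big_nil.
  by rewrite !big_cons -IH; case: (\sum_(_ <- _) _) => ? ? /=; rewrite mul0r subr0.
have IE : complex.Im (\sum_(q <- S) q.1%:C * delta_ft q.2 xi) =
    \sum_(q <- S) q.1 * (fc * cosdiff q.2 (pi / 2) xi).
  elim: S {RE} => [|q S IH]; first by rewrite !big_nil.
  by rewrite !big_cons -IH; case: (\sum_(_ <- _) _) => ? ? /=; rewrite mul0r addr0.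
rewrite normc_sqr RE IE !expr2 !big_distrlr/= -big_split/= /delta_quad mulr_sumr.
apply: eq_bigr => q _; rewrite -big_split/= mulr_sumr; apply: eq_bigr => r _.
rewrite /cosdiff /ncos !dot0l !add0r !addr0 cos0 cos_pihalf !subr0 !cosDpihalf.
by rewrite dotDl dotNl cosB; ring.
Qed.

(** Its square is the ratio of the variances: fc^2 from the normalization of the transform,
    [kernel_cst] from the integral, and 2 to compensate the 1/2 in [fBM_cov]. *)
Definition delta_cst : R := fc * Num.sqrt (2 * @kernel_cst R d s).

Lemma delta_cst_gt0 : 0 < delta_cst.
Proof.
rewrite mulr_gt0 ?fourier_cst_gt0// sqrtr_gt0 mulr_gt0//; exact: kernel_cst_gt0.
Qed.

Lemma integral_delta_quad S :
  mu.-integrable setT (EFin \o (fun xi => fgf_weight s xi * (fc ^+ 2 * delta_quad S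
    xi))) /\
  \int[mu]_xi (fgf_weight s xi * (fc ^+ 2 * delta_quad S xi)) =
    delta_cst ^+ 2 * fBM_var (Hurst d s) S.
Proof.
pose K x xi := fgf_weight s xi * ncos x xi.
have iK x : mu.-integrable setT (EFin \o K x) by case: (integral_weight_ncos hs x).
have RK x : \int[mu]_xi K x xi = @kernel_cst R d s * enorm x `^ (2 * Hurst d s).
  by case: (integral_weight_ncos hs x).
pose F q r xi := fc ^+ 2 * (q.1 * r.1) * (K q.2 xi + (K r.2 xi + (- 1) * K (q.2 - r.2)
  xi)).
have iF0 (q r : R * E) : mu.-integrable setT
    (EFin \o (fun xi => K r.2 xi + (- 1) * K (q.2 - r.2) xi)).
  by apply: integrable_add => //; exact: integrable_scale.
have iF1 (q r : R * E) : mu.-integrable setT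
    (EFin \o (fun xi => K q.2 xi + (K r.2 xi + (- 1) * K (q.2 - r.2) xi))).
  exact: integrable_add.
have iF q r : mu.-integrable setT (EFin \o F q r) by exact: integrable_scale.
have FE : (fun xi => fgf_weight s xi * (fc ^+ 2 * delta_quad S xi)) =
    (fun xi => \sum_(q <- S) \sum_(r <- S) F q r xi).
  apply/funext => xi; rewrite /delta_quad !mulr_sumr; apply: eq_bigr => q _.
  by rewrite !mulr_sumr; apply: eq_bigr => r _; rewrite /F /K; ring.
have i1 q := integrable_Rintegral_sum S (iF q).
have [i2 R2] := integrable_Rintegral_sum S (fun q => (i1 q).1).
rewrite FE; split => //; rewrite R2 /fBM_var mulr_sumr; apply: eq_bigr => q _.
rewrite (i1 q).2 mulr_sumr; apply: eq_bigr => r _.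
rewrite /F (RintegralZl _ measurableT (iF1 q r)) RintegralD// RintegralD//;
  last exact: integrable_scale.
rewrite (RintegralZl _ measurableT (iK _)) !RK /delta_cst exprMn sqr_sqrtr; last first.
  by rewrite mulr_ge0// ltW// kernel_cst_gt0.
have key (f k u v w a b : R) : f ^+ 2 * (a * b) * (k * u + (k * v + (- 1) * (k * w))) =
  f ^+ 2 * (2 * k) * (a * b * (2^-1 * (u + v - w))) by field.
exact: key.
Qed.

Lemma delta_quad_ge0 S xi : 0 <= fc ^+ 2 * delta_quad S xi.
Proof. by rewrite -normc_delta_comb sqr_ge0. Qed.

(** All increments carry the same mollifying factor e, so the squared modulus is e^2 times that of
    the limit and is dominated by it. The norms are given as reals [v n] because they become
    variances of normal laws. *)
Lemma cvg_weighted_comb S : exists2 v : nat -> R,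
  (forall n, weighted_sqnorm s (fourier (comb (gauss_increment n.+1%:R) S)) = (v n)%:E) &
  v n @[n --> \oo] --> delta_cst ^+ 2 * fBM_var (Hurst d s) S.
Proof.
pose e n xi : R := expR (- (dot xi xi / (4 * n.+1%:R))).
pose W xi := fgf_weight s xi * (fc ^+ 2 * delta_quad S xi).
have [intW RW] := integral_delta_quad S.
have e01 n xi : 0 <= e n xi <= 1 by exact: gauss_small01.
have me n : measurable_fun setT (e n).
  apply: measurableT_comp => //; apply: measurableT_comp => //.
  apply: measurable_funM => //; apply: measurable_sum => i.
  by apply: measurable_funM; exact: measurable_rV_coord.
have m1 n : measurable_fun setT (fun xi => e n xi ^+ 2 * W xi).
  by apply: measurable_funM; [exact: measurable_funX|exact: integrable_measurable intW].
have W0 xi : 0 <= W xi by rewrite mulr_ge0 ?fgf_weight_ge0 ?delta_quad_ge0.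
have b1 n xi : `|e n xi ^+ 2 * W xi| <= W xi.
  rewrite (ger0_norm (mulr_ge0 (sqr_ge0 _) (W0 xi))) ler_piMl//.
  by have /andP[] := e01 n xi; nra.
have c1 xi : e n xi ^+ 2 * W xi @[n --> \oo] --> W xi.
  rewrite -[X in _ --> X]mul1r; apply: cvgM; last exact: cvg_cst.
  have h : e n xi @[n --> \oo] --> (1 : R) by exact: cvg_gauss_rV_small.
  by rewrite -[X in _ --> X](mulr1 (1 : R)); exact: (cvgM h h).
have [_] := @Rintegral_cvg _ _ _ mu _ _ _ m1 c1 intW b1.
rewrite RW => cv; exists (fun n => \int[mu]_xi (e n xi ^+ 2 * W xi)) => // n.
rewrite -integral_EFinE; last exact: integrable_dominated (m1 n) (b1 n) intW.
apply: eq_integral => xi _; congr _%:E; rewrite fourier_comb; last first.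
  by move=> x; apply: gauss_increment_moment0 => //; case/andP: hs.
rewrite (_ : \sum_(q <- S) _ = (e n xi)%:C * \sum_(q <- S) q.1%:C * delta_ft q.2 xi).
  rewrite /W -normc_delta_comb -/(fgf_weight s xi) !normc_sqr.
  by case: (\sum_(_ <- _) _) => a b /=; ring.
rewrite mulr_sumr; apply: eq_bigr => q _; rewrite fourier_gauss_increment//.
by rewrite -/(e n xi) mulrCA.
Qed.

(** The approximating combination is [h] at the single function [comb (phi n) S], so its cosine
    expectation is explicit; both the expectation and the formula converge, and the limits agree. *)
Lemma pairing_cos (dO : measure_display) (T : measurableType dO) (P : probability T R)
    (h : T -> (E -> R) -> R) S (b : R) : is_FGF P s h ->
  \int[P]_w cos ((\sum_(q <- S) q.1 * pairing P s h (delta q.2) w) + b) =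
  expR (- (delta_cst ^+ 2 * fBM_var (Hurst d s) S / 2)) * cos b.
Proof.
move=> hh; pose phi n : E -> E -> R := gauss_increment n.+1%:R.
have sphi n x : S_H (phi n x).
  by apply: gauss_increment_moment0 => //; case/andP: hs.
have mphi n x : measurable_fun setT (fun w => h w (phi n x)) by exact: (FGF_measurable
  hh (sphi n x)).
have cS : L2_cvg P (fun n w => \sum_(q <- S) q.1 * h w (phi n q.2))
    (fun w => \sum_(q <- S) q.1 * pairing P s h (delta q.2) w).
  elim: S => [|q S IH].
    apply/cvge0P => [n|e e0]; first by apply: integral_ge0 => w _;
      rewrite lee_fin sqr_ge0.
    exists 0%N => n _; rewrite (_ : (\int[P]_w _)%E = 0%E) ?lee_fin ?ltW//.
    by apply: integral0_eq => w _; rewrite !big_nil subrr expr0n.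
  have cq := L2_cvg_pairing hs hh q.2.
  have := @L2_cvg_lin _ _ _ P q.1 _ _ _ _ (fun n => mphi n q.2) _ _ _ cq IH.
  rewrite (_ : (fun n w => _) = (fun n w => \sum_(r <- q :: S) r.1 * h w (phi n r.2)));
    last first.
    by apply/funext => n; apply/funext => w; rewrite big_cons.
  rewrite (_ : (fun w => q.1 * _ + _) = (fun w => \sum_(r <- q :: S) r.1 * pairing P s
    h (delta r.2) w)); last first.
    by apply/funext => w; rewrite big_cons.
  apply=> //; first by move=> n; apply: measurable_sum => r; exact: measurable_funM.
  by apply: measurable_sum => r; exact: measurable_funM.
have c1 : (\int[P]_w cos ((\sum_(q <- S) q.1 * h w (phi n q.2)) + b)) @[n --> \oo] -->
    \int[P]_w cos ((\sum_(q <- S) q.1 * pairing P s h (delta q.2) w) + b).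
  apply: L2_cvg_cos cS => [n|]; first by apply: measurable_sum => r;
    exact: measurable_funM.
  by apply: measurable_sum => r; exact: measurable_funM.
have [v vE cv] := cvg_weighted_comb S.
have cosE n : \int[P]_w cos ((\sum_(q <- S) q.1 * h w (phi n q.2)) + b) =
    expR (- (v n / 2)) * cos b.
  have sC : S_H (comb (phi n) S) by exact: (comb_moment0 S (sphi n)).
  have [mh [v' [v'E law]]] := hh.2 _ sC.
  have vv : v' = v n by apply: EFin_inj; rewrite -v'E vE.
  have v0 : 0 <= v n by rewrite -lee_fin -vE weighted_sqnorm_ge0.
  rewrite vv in law.
  rewrite -[b in RHS]add0r -(normal_law_cos mh v0 law b).
  by apply: eq_Rintegral => w _; rewrite (FGF_comb S w hh (sphi n)).
have c2 : expR (- (v n / 2)) * cos b @[n --> \oo] -->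
    expR (- (delta_cst ^+ 2 * fBM_var (Hurst d s) S / 2)) * cos b.
  apply: cvgM; last exact: cvg_cst.
  apply: continuous_cvg; first exact: continuous_expR.
  by apply: cvgN; apply: cvgM => //; exact: cvg_cst.
rewrite (funext cosE) in c1.
exact: cvg_unique c1 c2.
Qed.

End fgf_combinations.

Theorem proposition6p1 (R : realType) (d : nat) (s : R) (hd : (1 <= d)%N)
    (hs : d%:R / 2 < s < d%:R / 2 + 1) :
  exists2 c : R, 0 < c &
    forall (dO : measure_display) (Omega : measurableType dO)
      (P : probability Omega R) (h : Omega -> ('rV[R]_d -> R) -> R),
    is_FGF P s h ->
    forall (dO' : measure_display) (Omega' : measurableType dO')
      (P' : probability Omega' R) (B : 'rV[R]_d -> {RV P' >-> R}),
    is_fBM (Hurst d s) B ->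
    same_law P P'
      (fun x => pairing P s h (delta_distr x - delta_distr 0))
      (fun x w => c * B x w).
Proof.
have hs' : 0 < Hurst d s < 1 by rewrite /Hurst subr_gt0 ltrBlDl.
exists (@delta_cst R d s); first exact: delta_cst_gt0.
move=> dO Omega P h hh dO' Omega' P' B hB; apply: same_law_of_cos => [x|x|S b].
- by [].
- exact: measurable_funM.
rewrite (pairing_cos hs' S b hh).
(* The constant is moved from the process into the coefficients, where it multiplies the variance by
   its square. *)
have := fBM_cos [seq (@delta_cst R d s * q.1, q.2) | q <- S] b hB.
rewrite fBM_var_scale => <-; apply: eq_Rintegral => w _; congr (cos (_ + _)).
by rewrite big_map; apply: eq_bigr => q _ /=; rewrite mulrCA mulrA.
Qed.
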